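(* Let $p>1$ and $x\ge 1$ be integers. The algebra $K\mathcal{Q}_p/I_x$ is of wild representation type if and only if it is not of finite representation type.
   Context: Let $K=\mathbf{C}$. $\mathcal{Q}_p$ is the quiver with vertices $1,\dots,p$, arrows $\alpha_i\colon i\to i+1$ for $1\le i\le p-1$, and a loop $\alpha\colon p\to p$; $I_x=(\alpha^x)$ is the ideal of the path algebra $K\mathcal{Q}_p$ generated by $\alpha^x$. A finite-dimensional $K$-algebra $\mathcal{A}$ is of finite representation type if it has only finitely many isomorphism classes of finite-dimensional indecomposable modules. It is of wild representation type if there is a finitely generated $K\langle X,Y\rangle$-$\mathcal{A}$-bimodule $M$, free over $K\langle X,Y\rangle$, such that the functor $-\otimes_{K\langle X,Y\rangle}M$ sends non-isomorphic finite-dimensional $K\langle X,Y\rangle$-modules to non-isomorphic $\mathcal{A}$-modules. *)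

(* Defs.v *)
From HB Require Import structures.
From mathcomp Require Import all_boot all_order all_algebra ring_quotient.
From mathcomp Require Import finmap boolp reals complex monalg.

Set Implicit Arguments.
Unset Strict Implicit.
Unset Printing Implicit Defensive.

Import GRing.Theory.
Local Open Scope ring_scope.
Local Open Scope quotient_scope.

(** * Quivers and path algebras *)

(* Finite, with at least one vertex, so that the path algebra is a nonzero
   unital ring. *)
Record quiver := Quiver {
  vertex : finType;
  arrow : finType;
  source : arrow -> vertex;
  target : arrow -> vertex;
  vertex0 : vertex }.

Section Paths.
Variable Q : quiver.

Fixpoint walk (v : vertex Q) (s : seq (arrow Q)) : bool :=
  if s is a :: s' then (source a == v) && walk (target a) s' else true.

(* A path is a starting vertex with a composable list of arrows, in the order
   in which they are traversed; the empty list gives the path of length 0. *)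
Record qpath := QPath {
  qpath_val : vertex Q * seq (arrow Q);
  _ : walk qpath_val.1 qpath_val.2 }.
HB.instance Definition _ := [isSub for qpath_val].
HB.instance Definition _ := [Choice of qpath by <:].

Definition pstart (p : qpath) : vertex Q := (val p).1.
Definition parrows (p : qpath) : seq (arrow Q) := (val p).2.
Definition pend (p : qpath) : vertex Q :=
  last (pstart p) (map (@target Q) (parrows p)).

Definition trivial_path (v : vertex Q) : qpath := @QPath (v, [::]) isT.

(* First p, then q; [insub] never fails here, see [pcatP]. *)
Definition pcat (p q : qpath) : option qpath :=
  if pend p == pstart q then insub (pstart p, parrows p ++ parrows q) else None.

Lemma walk_cat v s t :
  walk v (s ++ t) = walk v s && walk (last v (map (@target Q) s)) t.
Proof. by elim: s v => //= a s IHs v; rewrite IHs andbA. Qed.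

Lemma pcatP (p q r : qpath) :
  pcat p q = Some r <->
  [/\ pend p = pstart q, pstart r = pstart p &
      parrows r = parrows p ++ parrows q].
Proof.
rewrite /pcat; split.
  case: eqP => // epq; case: insubP => //= u _ eu [<-].
  by split; [|exact: (congr1 fst eu)|exact: (congr1 snd eu)].
case=> epq er1 er2; rewrite epq eqxx.
have -> : (pstart p, parrows p ++ parrows q) = val r.
  by rewrite -er1 -er2 /pstart /parrows -surjective_pairing.
exact: valK.
Qed.

Lemma qpath_eq (p q : qpath) :
  pstart p = pstart q -> parrows p = parrows q -> p = q.
Proof.
move=> e1 e2; apply: val_inj; rewrite [LHS]surjective_pairing.
by rewrite [RHS]surjective_pairing; congr pair.
Qed.

Lemma pcat_some (p q : qpath) :
  pend p = pstart q -> {r | pcat p q = Some r}.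
Proof.
move=> epq; rewrite /pcat epq eqxx.
have w : walk (pstart p) (parrows p ++ parrows q).
  by rewrite walk_cat (valP p) -/(pend p) epq (valP q).
by exists (@QPath (pstart p, parrows p ++ parrows q) w); rewrite insubT.
Qed.

Lemma pcat_end (p q r : qpath) : pcat p q = Some r -> pend r = pend q.
Proof.
case/pcatP=> e er1 er2.
by rewrite /pend er1 er2 map_cat last_cat -/(pend p) e.
Qed.

Lemma pcatA (p q r : qpath) :
  obind (pcat p) (pcat q r) = obind (pcat^~ r) (pcat p q).
Proof.
case epq: (pend p == pstart q); case eqr: (pend q == pstart r).
- move/eqP: epq => epq; move/eqP: eqr => eqr.
  have [u eu] := pcat_some epq; have [w ew] := pcat_some eqr.
  rewrite eu ew /=.
  have /pcat_some [z ez] : pend u = pstart r by rewrite (pcat_end eu).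
  rewrite ez; case/pcatP: eu => _ u1 u2; case/pcatP: ew => _ w1 w2.
  case/pcatP: ez => _ z1 z2; apply/pcatP; split; first by rewrite w1.
    by rewrite z1 u1.
  by rewrite z2 u2 w2 catA.
- rewrite {2}/pcat eqr /=; move/eqP: epq => epq.
  have [u eu] := pcat_some epq; rewrite eu /= /pcat.
  by rewrite (pcat_end eu) eqr.
- rewrite [in RHS]/pcat epq /=; move/eqP: eqr => eqr.
  have [w ew] := pcat_some eqr; rewrite ew /= /pcat.
  by case/pcatP: ew => _ -> _; rewrite epq.
- by rewrite {2}/pcat eqr [in RHS]/pcat epq.
Qed.

Lemma pcat_triv_l v (p : qpath) :
  pcat (trivial_path v) p = if v == pstart p then Some p else None.
Proof.
case: eqP => [ev|/eqP/negPf nv]; first by apply/pcatP; split.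
by rewrite /pcat /= [pend _]/= nv.
Qed.

Lemma pcat_triv_r v (p : qpath) :
  pcat p (trivial_path v) = if v == pend p then Some p else None.
Proof.
case: eqP => [ev|/eqP/negPf nv].
  by apply/pcatP; split; rewrite /= ?cats0.
by rewrite /pcat [pstart (trivial_path _)]/= eq_sym nv.
Qed.

Lemma pcat_triv (p q : qpath) v :
  (pcat p q == Some (trivial_path v)) =
  (p == trivial_path v) && (q == trivial_path v).
Proof.
apply/eqP/andP => [/pcatP[epq e1 e2]|[/eqP-> /eqP->]]; last first.
  by rewrite pcat_triv_l eqxx.
have ep : parrows p = [::] by move: e2; case: (parrows p).
have eq : parrows q = [::] by move: e2; rewrite ep.
have sp : pstart p = v by rewrite -e1.
have -> : p = trivial_path v by apply: qpath_eq.
split=> //; apply/eqP/qpath_eq => //.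
by rewrite -epq /pend ep sp.
Qed.

End Paths.

(* The K-space on the set of paths; the name is separate from [malg] because
   the multiplication is not that of a monoid algebra. *)
Definition path_alg (K : fieldType) (Q : quiver) := {malg K[qpath Q]}.

HB.instance Definition _ K Q := GRing.Lmodule.on (path_alg K Q).

(* [pbasis] and [pa_mul] are locked only to keep unification from unfolding
   finitely supported functions. *)
HB.lock Definition pbasis (K : fieldType) (Q : quiver) (p : qpath Q) :
  path_alg K Q := << p >>.

Definition pbasis_mul (K : fieldType) (Q : quiver) (p q : qpath Q) :
    path_alg K Q :=
  if pcat p q is Some r then pbasis K r else 0.

HB.lock Definition pa_mul (K : fieldType) (Q : quiver) (f g : path_alg K Q) :
    path_alg K Q :=
  \sum_(p <- msupp f) \sum_(q <- msupp g) (f@_p * g@_q) *: pbasis_mul K p q.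

Section PathAlgebra.
Variables (K : fieldType) (Q : quiver).
Local Notation A := (path_alg K Q).
Local Notation pbasis := (@pbasis K Q).
Local Notation pbasis_mul := (@pbasis_mul K Q).
Local Notation pa_mul := (@pa_mul K Q).

Definition pa_one : A := \sum_(v : vertex Q) pbasis (trivial_path v).

Lemma pa_mulw (d1 d2 : {fset qpath Q}) (f g : A) :
  (msupp f `<=` d1)%fset -> (msupp g `<=` d2)%fset ->
  pa_mul f g =
  \sum_(p <- d1) \sum_(q <- d2) (f@_p * g@_q) *: pbasis_mul p q.
Proof.
move=> le1 le2; rewrite pa_mul.unlock (big_fset_incl _ le1) /=.
  apply/eq_bigr=> k1 _; apply/big_fset_incl => // k _ /mcoeff_outdom ->.
  by rewrite mulr0 scale0r.
move=> k _ /mcoeff_outdom fk.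
by rewrite big1 => // k' _; rewrite fk mul0r scale0r.
Qed.

Lemma pa_mulDl : left_distributive pa_mul +%R.
Proof.
move=> f g h; set d := (msupp f `|` msupp g)%fset.
rewrite (@pa_mulw d (msupp h)) ?msuppD_le ?fsubset_refl //.
rewrite (@pa_mulw d (msupp h) f) ?fsubsetUl ?fsubset_refl //.
rewrite (@pa_mulw d (msupp h) g) ?fsubsetUr ?fsubset_refl //.
rewrite -big_split; apply: eq_bigr => p _ /=.
rewrite -big_split; apply: eq_bigr => q _ /=.
by rewrite mcoeffD mulrDl scalerDl.
Qed.

Lemma pa_mulDr : right_distributive pa_mul +%R.
Proof.
move=> h f g; set d := (msupp f `|` msupp g)%fset.
rewrite (@pa_mulw (msupp h) d) ?msuppD_le ?fsubset_refl //.
rewrite (@pa_mulw (msupp h) d h f) ?fsubsetUl ?fsubset_refl //.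
rewrite (@pa_mulw (msupp h) d h g) ?fsubsetUr ?fsubset_refl //.
rewrite -big_split; apply: eq_bigr => p _ /=.
rewrite -big_split; apply: eq_bigr => q _ /=.
by rewrite mcoeffD mulrDr scalerDl.
Qed.

Lemma pa_mulZl c (f g : A) : pa_mul (c *: f) g = c *: pa_mul f g.
Proof.
rewrite !(@pa_mulw (msupp f) (msupp g)) ?msuppZ_le ?fsubset_refl //.
rewrite scaler_sumr; apply: eq_bigr => p _.
by rewrite scaler_sumr; apply: eq_bigr => q _; rewrite mcoeffZ scalerA mulrA.
Qed.

Lemma pa_mulZr c (f g : A) : pa_mul f (c *: g) = c *: pa_mul f g.
Proof.
rewrite !(@pa_mulw (msupp f) (msupp g)) ?msuppZ_le ?fsubset_refl //.
rewrite scaler_sumr; apply: eq_bigr => p _.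
rewrite scaler_sumr; apply: eq_bigr => q _.
by rewrite mcoeffZ scalerA mulrCA.
Qed.

Lemma pa_mul0l (g : A) : pa_mul 0 g = 0.
Proof. by rewrite -[0 in LHS](scale0r (0 : A)) pa_mulZl scale0r. Qed.

Lemma pa_mul0r (g : A) : pa_mul g 0 = 0.
Proof. by rewrite -[0 in LHS](scale0r (0 : A)) pa_mulZr scale0r. Qed.

Lemma pa_mul_suml I (r : seq I) (F : I -> A) (g : A) :
  pa_mul (\sum_(i <- r) F i) g = \sum_(i <- r) pa_mul (F i) g.
Proof.
exact: (big_morph (pa_mul^~ g) (fun _ _ => pa_mulDl _ _ _) (pa_mul0l g)).
Qed.

Lemma pa_mul_sumr I (r : seq I) (F : I -> A) (g : A) :
  pa_mul g (\sum_(i <- r) F i) = \sum_(i <- r) pa_mul g (F i).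
Proof.
exact: (big_morph (pa_mul g) (fun _ _ => pa_mulDr _ _ _) (pa_mul0r g)).
Qed.

Lemma mcoeff_pbasis p q : (pbasis p)@_q = (p == q)%:R.
Proof. by rewrite pbasis.unlock; apply: mcoeffU. Qed.

Lemma pa_decomp (f : A) : f = \sum_(p <- msupp f) f@_p *: pbasis p.
Proof.
rewrite {1}[f]monalgE; apply: eq_bigr => p _.
apply/malgP => q; rewrite mcoeffZ mcoeff_pbasis mcoeffU.
by rewrite mulr_natr.
Qed.

Lemma pa_mul_basis p q : pa_mul (pbasis p) (pbasis q) = pbasis_mul p q.
Proof.
rewrite (@pa_mulw [fset p]%fset [fset q]%fset); try by rewrite pbasis.unlock; exact: msuppU_le.
by rewrite !big_seq_fset1 !mcoeff_pbasis !eqxx mulr1 scale1r.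
Qed.

Lemma pa_mulA_basis p q r :
  pa_mul (pbasis p) (pa_mul (pbasis q) (pbasis r)) =
  pa_mul (pa_mul (pbasis p) (pbasis q)) (pbasis r).
Proof.
rewrite !pa_mul_basis /pbasis_mul.
have := pcatA p q r.
case: (pcat q r) => [u|]; case: (pcat p q) => [w|] /= e;
  rewrite ?pa_mul0l ?pa_mul0r ?pa_mul_basis //= /pbasis_mul ?e //.
by rewrite -e.
Qed.

Lemma pa_mul_expl (f g : A) :
  pa_mul f g = \sum_(p <- msupp f) f@_p *: pa_mul (pbasis p) g.
Proof.
rewrite {1}(pa_decomp f) (@pa_mul_suml _ _ _ g).
by apply: eq_bigr => p _; rewrite pa_mulZl.
Qed.

Lemma pa_mul_expr (f g : A) :
  pa_mul f g = \sum_(q <- msupp g) g@_q *: pa_mul f (pbasis q).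
Proof.
rewrite {1}(pa_decomp g) (@pa_mul_sumr _ _ _ f).
by apply: eq_bigr => q _; rewrite pa_mulZr.
Qed.

Lemma pa_mulA : associative pa_mul.
Proof.
move=> f g h.
rewrite (pa_mul_expl f (pa_mul g h)) (pa_mul_expl f g) (@pa_mul_suml _ _ _ h).
apply: eq_bigr => p _; rewrite pa_mulZl; congr (_ *: _).
rewrite (pa_mul_expl g h) (pa_mul_expr _ g).
rewrite (@pa_mul_suml _ _ _ h) (@pa_mul_sumr _ _ _ (pbasis p)).
apply: eq_bigr => q _; rewrite pa_mulZl pa_mulZr; congr (_ *: _).
rewrite (pa_mul_expr (pbasis q) h) (pa_mul_expr _ h).
rewrite (@pa_mul_sumr _ _ _ (pbasis p)).
by apply: eq_bigr => r _; rewrite pa_mulZr pa_mulA_basis.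
Qed.

Lemma pa_mul1l : left_id pa_one pa_mul.
Proof.
move=> f; rewrite pa_mul_expr [RHS]pa_decomp; apply: eq_bigr => p _.
congr (_ *: _); rewrite /pa_one (@pa_mul_suml _ _ _ (pbasis p)).
rewrite (bigD1 (pstart p)) //= pa_mul_basis /pbasis_mul pcat_triv_l eqxx.
rewrite big1 ?addr0 // => v /negPf nv.
by rewrite pa_mul_basis /pbasis_mul pcat_triv_l nv.
Qed.

Lemma pa_mul1r : right_id pa_one pa_mul.
Proof.
move=> f; rewrite pa_mul_expl [RHS]pa_decomp; apply: eq_bigr => p _.
congr (_ *: _); rewrite /pa_one (@pa_mul_sumr _ _ _ (pbasis p)).
rewrite (bigD1 (pend p)) //= pa_mul_basis /pbasis_mul pcat_triv_r eqxx.
rewrite big1 ?addr0 // => v /negPf nv.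
by rewrite pa_mul_basis /pbasis_mul pcat_triv_r nv.
Qed.

Lemma pa_one_coef v : pa_one@_(trivial_path v) = 1.
Proof.
rewrite /pa_one raddf_sum (bigD1 v) //= mcoeff_pbasis eqxx.
rewrite big1 ?addr0 // => w nwv.
by rewrite mcoeff_pbasis -val_eqE xpair_eqE (negPf nwv).
Qed.

Lemma pa_one_neq0 : pa_one != 0.
Proof.
apply/eqP => /malgP /(_ (trivial_path (vertex0 Q))) /eqP.
by rewrite pa_one_coef mcoeff0 oner_eq0.
Qed.

HB.instance Definition _ := GRing.Zmodule_isNzRing.Build A
  pa_mulA pa_mul1l pa_mul1r pa_mulDl pa_mulDr pa_one_neq0.

Fact pa_scalerAl c (f g : A) : c *: (f * g) = (c *: f) * g.
Proof. by rewrite [RHS]pa_mulZl. Qed.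
HB.instance Definition _ := GRing.Lmodule_isLalgebra.Build K A pa_scalerAl.

Fact pa_scalerAr c (f g : A) : c *: (f * g) = f * (c *: g).
Proof. by rewrite [RHS]pa_mulZr. Qed.
HB.instance Definition _ := GRing.Lalgebra_isAlgebra.Build K A pa_scalerAr.

Lemma pa_coef_trivM v (f g : A) :
  (f * g)@_(trivial_path v) = f@_(trivial_path v) * g@_(trivial_path v).
Proof.
set t := trivial_path v.
have coefE (h : A) : h@_t = \sum_(p <- msupp h) h@_p * (p == t)%:R.
  rewrite {1}[h]pa_decomp raddf_sum; apply: eq_bigr => p _ /=.
  by rewrite mcoeffZ mcoeff_pbasis.
have mulE p q : (pbasis_mul p q)@_t = ((p == t) && (q == t))%:R.
  rewrite -pcat_triv /pbasis_mul; case: (pcat p q) => [r|]; last exact: mcoeff0.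
  by rewrite mcoeff_pbasis.
rewrite (coefE f) (coefE g) mulr_suml.
have -> : f * g = pa_mul f g by [].
rewrite pa_mul.unlock raddf_sum; apply: eq_bigr => p _.
rewrite raddf_sum mulr_sumr; apply: eq_bigr => q _ /=.
by rewrite mcoeffZ mulE mulrACA -natrM mulnb.
Qed.

End PathAlgebra.

(** * Two-sided ideals and quotient algebras *)

Record ideal (A : nzRingType) := Ideal {
  ideal_pred :> zmodClosed A;
  idealMl : forall a u : A, u \in ideal_pred -> a * u \in ideal_pred;
  idealMr : forall a u : A, u \in ideal_pred -> u * a \in ideal_pred;
  ideal_proper : 1 \notin ideal_pred }.

Section GeneratedIdeal.
Variables (A : nzRingType) (a : A).

Definition gen_ideal : {pred A} := fun b =>
  `[< exists s : seq (A * A), b = \sum_(u <- s) u.1 * a * u.2 >].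

Fact gen_ideal_closed : zmod_closed gen_ideal.
Proof.
split; first by apply/asboolP; exists [::]; rewrite big_nil.
move=> _ _ /asboolP[s ->] /asboolP[t ->]; apply/asboolP.
exists (s ++ [seq (- u.1, u.2) | u <- t]); rewrite big_cat /= big_map -sumrN.
by congr (_ + _); apply: eq_bigr => u _; rewrite !mulNr.
Qed.
HB.instance Definition _ := GRing.isZmodClosed.Build A gen_ideal
  gen_ideal_closed.

Lemma gen_idealMl b u : u \in gen_ideal -> b * u \in gen_ideal.
Proof.
move=> /asboolP[s ->]; apply/asboolP; exists [seq (b * u.1, u.2) | u <- s].
by rewrite big_map mulr_sumr; apply: eq_bigr => v _; rewrite !mulrA.
Qed.

Lemma gen_idealMr b u : u \in gen_ideal -> u * b \in gen_ideal.
Proof.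
move=> /asboolP[s ->]; apply/asboolP; exists [seq (u.1, u.2 * b) | u <- s].
by rewrite big_map mulr_suml; apply: eq_bigr => v _; rewrite !mulrA.
Qed.

Definition principal_ideal (a_proper : 1 \notin gen_ideal) : ideal A :=
  Ideal gen_idealMl gen_idealMr a_proper.

End GeneratedIdeal.

Definition quot_alg (K : fieldType) (A : algType K) (I : ideal A) :=
  Quotient.quot I.

Section QuotientAlgebra.
Variables (K : fieldType) (A : algType K) (I : ideal A).
Local Notation B := (quot_alg I).

HB.instance Definition _ := GRing.Zmodule.on B.

Local Notation pi := (\pi_(Quotient.quot I) : A -> B).

Definition qa_one : B := pi 1.
Definition qa_mul (x y : B) : B := pi (repr x * repr y).
Definition qa_scale (c : K) (x : B) : B := pi (c *: repr x).

Lemma qa_piP (a b : A) : pi a = pi b <-> a - b \in I.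
Proof. by rewrite Quotient.idealrBE; split=> [/eqP|/eqP]. Qed.

Lemma qa_repr (a : A) : repr (pi a) - a \in I.
Proof. by apply/qa_piP; rewrite reprK. Qed.

Lemma qa_piD (a b : A) : pi (a + b) = pi a + pi b.
Proof. exact: (raddfD \pi_(Quotient.quot I)). Qed.

Lemma qa_piM (a b : A) : pi (a * b) = qa_mul (pi a) (pi b).
Proof.
apply/qa_piP; set a' := repr _; set b' := repr _.
have -> : a * b - a' * b' = - ((a' - a) * b' + a * (b' - b)).
  by rewrite mulrBl mulrBr addrA subrK opprB.
rewrite rpredN; apply: rpredD; [apply: idealMr | apply: idealMl];
  exact: qa_repr.
Qed.

Lemma qa_piZ c (a : A) : pi (c *: a) = qa_scale c (pi a).
Proof.
apply/qa_piP; rewrite -scalerBr -mulr_algl; apply: idealMl.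
by rewrite -opprB rpredN; apply: qa_repr.
Qed.

Lemma qa_ind (P : B -> Prop) : (forall a : A, P (pi a)) -> forall x, P x.
Proof. by move=> Ppi x; rewrite -[x]reprK; apply: Ppi. Qed.

Fact qa_mulA : associative qa_mul.
Proof.
elim/qa_ind=> a; elim/qa_ind=> b; elim/qa_ind=> c.
by rewrite -!qa_piM mulrA.
Qed.

Fact qa_mul1l : left_id qa_one qa_mul.
Proof. by elim/qa_ind=> a; rewrite -qa_piM mul1r. Qed.

Fact qa_mul1r : right_id qa_one qa_mul.
Proof. by elim/qa_ind=> a; rewrite -qa_piM mulr1. Qed.

Fact qa_mulDl : left_distributive qa_mul +%R.
Proof.
elim/qa_ind=> a; elim/qa_ind=> b; elim/qa_ind=> c.
by rewrite -qa_piD -!qa_piM -qa_piD mulrDl.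
Qed.

Fact qa_mulDr : right_distributive qa_mul +%R.
Proof.
elim/qa_ind=> a; elim/qa_ind=> b; elim/qa_ind=> c.
by rewrite -qa_piD -!qa_piM -qa_piD mulrDr.
Qed.

Fact qa_one_neq0 : qa_one != 0.
Proof.
apply/eqP; rewrite /qa_one -[0](raddf0 \pi_(Quotient.quot I)).
by move/qa_piP; rewrite subr0; apply/negP/ideal_proper.
Qed.

HB.instance Definition _ := GRing.Zmodule_isNzRing.Build B
  qa_mulA qa_mul1l qa_mul1r qa_mulDl qa_mulDr qa_one_neq0.

Fact qa_scaleA c d (x : B) : qa_scale c (qa_scale d x) = qa_scale (c * d) x.
Proof. by elim/qa_ind: x => a; rewrite -!qa_piZ scalerA. Qed.

Fact qa_scale1 : left_id 1 qa_scale.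
Proof. by elim/qa_ind=> a; rewrite -qa_piZ scale1r. Qed.

Fact qa_scaleDr : right_distributive qa_scale +%R.
Proof.
move=> c; elim/qa_ind=> a; elim/qa_ind=> b.
by rewrite -qa_piD -!qa_piZ -qa_piD scalerDr.
Qed.

Fact qa_scaleDl (x : B) : {morph qa_scale^~ x : c d / c + d}.
Proof. by elim/qa_ind: x => a c d; rewrite -!qa_piZ -qa_piD scalerDl. Qed.

HB.instance Definition _ := GRing.Zmodule_isLmodule.Build K B
  qa_scaleA qa_scale1 qa_scaleDr qa_scaleDl.

Fact qa_scalerAl c (x y : B) : c *: (x * y) = (c *: x) * y.
Proof.
elim/qa_ind: x => a; elim/qa_ind: y => b.
by rewrite -[pi a * pi b]qa_piM -![_ *: pi _]qa_piZ -[RHS]qa_piM scalerAl.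
Qed.
HB.instance Definition _ := GRing.Lmodule_isLalgebra.Build K B qa_scalerAl.

Fact qa_scalerAr c (x y : B) : c *: (x * y) = x * (c *: y).
Proof.
elim/qa_ind: x => a; elim/qa_ind: y => b.
by rewrite -[pi a * pi b]qa_piM -![_ *: pi _]qa_piZ -[RHS]qa_piM scalerAr.
Qed.
HB.instance Definition _ := GRing.Lalgebra_isAlgebra.Build K B qa_scalerAr.

End QuotientAlgebra.

(** * Modules *)

(* A right A-module is a left module over the converse ring: for [a : A^c],
   [a *: v] is v.a. *)
Notation rmodType A := (lmodType [the pzRingType of A^c]).

Section Modules.
Variables (K : fieldType) (A : algType K).
Implicit Types V W : rmodType A.

Definition rmod_iso V W : Prop := exists f : {linear V -> W}, bijective f.

Definition fin_dim V : Prop :=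
  exists n (e : 'I_n -> V), forall v : V,
  exists c : 'I_n -> K, v = \sum_(i < n) ((c i)%:A : A^c) *: e i.

Definition indecomposable V : Prop :=
  (exists v : V, v != 0) /\
  forall U W : rmodType A, rmod_iso V (U * W)%type ->
    (forall u : U, u = 0) \/ (forall w : W, w = 0).

Definition finite_rep_type : Prop :=
  exists n (W : 'I_n -> rmodType A),
  forall V, fin_dim V -> indecomposable V -> exists i, rmod_iso V (W i).

End Modules.

(* The base field acts centrally, as in [bactZ]. *)
Record bimodule (K : fieldType) (F A : algType K) := Bimodule {
  bimod_left :> lmodType F;
  bact : bimod_left -> A -> bimod_left;
  bactDl : forall a, {morph bact^~ a : m m' / m + m'};
  bactDr : forall m, {morph bact m : a b / a + b};
  bact1 : forall m, bact m 1 = m;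
  bactM : forall m a b, bact m (a * b) = bact (bact m a) b;
  bact_left : forall (f : F) m a, bact (f *: m) a = f *: bact m a;
  bactZ : forall m (c : K), bact m c%:A = (c%:A : F) *: m }.

Section BimoduleProperties.
Variables (K : fieldType) (F A : algType K) (M : bimodule F A).

Definition bimod_fin_gen : Prop :=
  exists n (g : 'I_n -> M), forall m : M, exists s : seq (F * 'I_n * A),
  m = \sum_(u <- s) bact (u.1.1 *: g u.1.2) u.2.

Definition left_free : Prop :=
  exists (B : choiceType) (h : {linear {malg F[B]} -> M}), bijective h.

End BimoduleProperties.

(** * The tensor product of a right module and a bimodule *)

Section GeneratedSubgroup.
Variables (V : zmodType) (S : V -> Prop).

Inductive gen_subgroup_spec : V -> Prop :=
| GenSubgroupIn x of S x : gen_subgroup_spec x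
| GenSubgroup0 : gen_subgroup_spec 0
| GenSubgroupB x y of gen_subgroup_spec x & gen_subgroup_spec y :
    gen_subgroup_spec (x - y).

Definition gen_subgroup : {pred V} := fun x => `[< gen_subgroup_spec x >].

Fact gen_subgroup_closed : zmod_closed gen_subgroup.
Proof.
split; first by apply/asboolP/GenSubgroup0.
by move=> x y /asboolP xS /asboolP yS; apply/asboolP/GenSubgroupB.
Qed.
HB.instance Definition _ := GRing.isZmodClosed.Build V gen_subgroup
  gen_subgroup_closed.

End GeneratedSubgroup.

Section TensorProduct.
Variables (K : fieldType) (F A : algType K).
Variables (N : rmodType F) (M : bimodule F A).

Local Notation ZNM := {malg int[(N * M)%type]}.

Inductive tensor_rel : ZNM -> Prop :=
| TensorDl n n' m :
    tensor_rel (<< (n + n', m) >> - << (n, m) >> - << (n', m) >>)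
| TensorDr n m m' :
    tensor_rel (<< (n, m + m') >> - << (n, m) >> - << (n, m') >>)
| TensorMid n (f : F) m :
    tensor_rel (<< ((f : F^c) *: n, m) >> - << (n, f *: m) >>).

Definition tensor := Quotient.quot (gen_subgroup tensor_rel).

HB.instance Definition _ := GRing.Zmodule.on tensor.

Local Notation pi :=
  (\pi_(Quotient.quot (gen_subgroup tensor_rel)) : ZNM -> tensor).

Definition free_act (a : A) (g : ZNM) : ZNM :=
  \sum_(k <- msupp g) << g@_k *g (k.1, bact k.2 a) >>.

Definition tensor_act (a : A^c) (t : tensor) : tensor :=
  pi (free_act a (repr t)).

Lemma free_actw (d : {fset N * M}) a (g : ZNM) : (msupp g `<=` d)%fset ->
  free_act a g = \sum_(k <- d) << g@_k *g (k.1, bact k.2 a) >>.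
Proof.
move=> le; rewrite /free_act; apply: big_fset_incl => // k _ /mcoeff_outdom ->.
by rewrite monalgU0.
Qed.

Lemma free_act_is_additive a : zmod_morphism (free_act a).
Proof.
move=> g h; set d := (msupp g `|` msupp h)%fset.
rewrite (@free_actw d) ?msuppB_le // (@free_actw d _ g) ?fsubsetUl //.
rewrite (@free_actw d _ h) ?fsubsetUr // -sumrB.
by apply: eq_bigr => k _; rewrite mcoeffB monalgUB.
Qed.
HB.instance Definition _ a := GRing.isZmodMorphism.Build ZNM ZNM (free_act a)
  (free_act_is_additive a).

Lemma free_actU a c n (m : M) :
  free_act a << c *g (n, m) >> = << c *g (n, bact m a) >>.
Proof.
by rewrite (@free_actw [fset (n, m)]%fset) ?msuppU_le // big_seq_fset1 mcoeffUU.
Qed.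

Lemma free_act_sub a g :
  g \in gen_subgroup tensor_rel -> free_act a g \in gen_subgroup tensor_rel.
Proof.
move=> /asboolP gR; apply/asboolP; elim: {g} gR => [_ [n n' m|n m m'|n f m]||].
- rewrite !raddfB /= !free_actU; exact/GenSubgroupIn/TensorDl.
- rewrite !raddfB /= !free_actU bactDl; exact/GenSubgroupIn/TensorDr.
- rewrite !raddfB /= !free_actU bact_left; exact/GenSubgroupIn/TensorMid.
- by rewrite raddf0; apply: GenSubgroup0.
- by move=> x y _ IHx _ IHy; rewrite raddfB; apply: GenSubgroupB.
Qed.

Lemma tensor_piP (g h : ZNM) :
  pi g = pi h <-> g - h \in gen_subgroup tensor_rel.
Proof. by rewrite Quotient.idealrBE; split=> [/eqP|/eqP]. Qed.

Lemma tensor_piD (g h : ZNM) : pi (g + h) = pi g + pi h.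
Proof. exact: (raddfD \pi_(Quotient.quot (gen_subgroup tensor_rel))). Qed.

Lemma tensor_act_pi (a : A) g : tensor_act a (pi g) = pi (free_act a g).
Proof.
apply/tensor_piP; rewrite -raddfB /=; apply: free_act_sub.
by apply/tensor_piP; rewrite reprK.
Qed.

Lemma tensor_ind (P : tensor -> Prop) :
  (forall n m, P (pi << (n, m) >>)) -> P 0 ->
  (forall t u, P t -> P u -> P (t - u)) -> forall t, P t.
Proof.
move=> P1 P0 PB t; rewrite -[t]reprK; set g := repr t; rewrite [g]monalgE.
have PN u : P u -> P (- u) by rewrite -[- u]add0r; apply: PB.
have PD u w : P u -> P w -> P (u + w).
  by move=> Pu /PN Pw; rewrite -[w]opprK; apply: PB.
elim/big_rec: _ => [|[n m] h _ Ph].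
  by rewrite (raddf0 \pi_(Quotient.quot (gen_subgroup tensor_rel))).
change (P (pi (<< g@_(n, m) *g (n, m) >> + h))).
rewrite tensor_piD; apply: (PD) => //.
have Pn k : P (pi << k%:Z *g (n, m) >>).
  elim: k => [|k IHk].
    by rewrite monalgU0 (raddf0 \pi_(Quotient.quot (gen_subgroup tensor_rel))).
  by rewrite -addn1 PoszD monalgUD tensor_piD; apply: PD.
case: (g@_(n, m)) => k; first exact: Pn.
rewrite NegzE monalgUN.
rewrite (raddfN \pi_(Quotient.quot (gen_subgroup tensor_rel))).
exact/PN/Pn.
Qed.

Fact tensor_actDr : right_distributive tensor_act +%R.
Proof.
move=> a t u; rewrite -[t]reprK -[u]reprK.
rewrite -[X in tensor_act _ X]tensor_piD !tensor_act_pi -tensor_piD.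
by rewrite raddfD.
Qed.

Fact tensor_actB (a : A^c) t u :
  tensor_act a (t - u) = tensor_act a t - tensor_act a u.
Proof.
by rewrite -[in RHS](subrK u t) [in RHS]tensor_actDr addrK.
Qed.

Fact tensor_act0 (a : A^c) : tensor_act a 0 = 0.
Proof. by rewrite -[in LHS](subrr 0) tensor_actB subrr. Qed.

Fact tensor_actA (a b : A^c) (t : tensor) :
  tensor_act a (tensor_act b t) = tensor_act (a * b) t.
Proof.
elim/tensor_ind: t => [n m||t u IHt IHu].
- by rewrite !tensor_act_pi !free_actU bactM.
- by rewrite !tensor_act0.
- by rewrite !tensor_actB IHt IHu.
Qed.

Fact tensor_act1 : left_id 1 tensor_act.
Proof.
elim/tensor_ind=> [n m||t u IHt IHu].
- by rewrite tensor_act_pi free_actU bact1.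
- by rewrite tensor_act0.
- by rewrite tensor_actB IHt IHu.
Qed.

Fact tensor_actDl (t : tensor) : {morph tensor_act^~ t : a b / a + b}.
Proof.
move=> a b; elim/tensor_ind: t => [n m||t u IHt IHu].
- rewrite !tensor_act_pi -tensor_piD; apply/tensor_piP; rewrite !free_actU.
  rewrite bactDr opprD addrA; exact/asboolP/GenSubgroupIn/TensorDr.
- by rewrite !tensor_act0 addr0.
- by rewrite !tensor_actB IHt IHu opprD addrACA.
Qed.

HB.instance Definition _ := GRing.Zmodule_isLmodule.Build [the pzRingType of A^c]
  tensor
  tensor_actA tensor_act1 tensor_actDr tensor_actDl.

End TensorProduct.

(** * Wild representation type *)

(* The free algebra K<X,Y>, as the algebra of the free monoid on two letters. *)
Definition free_alg2 (K : fieldType) := {malg K[{fmonom bool}]}.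

Section FreeAlgebra.
Variable K : fieldType.

HB.instance Definition _ := GRing.Lalgebra.on (free_alg2 K).

Fact free_alg2_scalerAr c (f g : free_alg2 K) : c *: (f * g) = f * (c *: g).
Proof.
rewrite (malgMEw (fsubset_refl _) (msuppZ_le c g)) malgME scaler_sumr.
apply: eq_bigr => k1 _; rewrite scaler_sumr; apply: eq_bigr => k2 _.
apply/malgP => k; rewrite [LHS]mcoeffZ [in LHS]mcoeffU [RHS]mcoeffU.
by rewrite (mcoeffZ c g) mulrnAr mulrCA.
Qed.
HB.instance Definition _ := GRing.Lalgebra_isAlgebra.Build K (free_alg2 K)
  free_alg2_scalerAr.

End FreeAlgebra.

Definition wild_rep_type (K : fieldType) (A : algType K) : Prop :=
  exists M : bimodule (free_alg2 K) A,
  [/\ bimod_fin_gen M, left_free M &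
      forall N N' : rmodType (free_alg2 K), fin_dim N -> fin_dim N' ->
      ~ rmod_iso N N' -> ~ rmod_iso (tensor N M) (tensor N' M)].

(** * The algebras K Q_p / I_x *)

(* The vertices 1, ..., p are numbered from 0, so that [ord_max] is the vertex
   p; [Some i] is the arrow from i to i + 1 and [None] is the loop.  The type
   ['I_p.-1.+1] of vertices has p elements as soon as p > 0. *)
Definition Qp (p : nat) : quiver := {|
  vertex := 'I_p.-1.+1;
  arrow := option 'I_p.-1;
  source := fun a => if a is Some i then widen_ord (leqnSn _) i else ord_max;
  target := fun a => if a is Some i then lift ord0 i else ord_max;
  vertex0 := ord0 |}.

Section QpAlgebra.
Variables (K : fieldType) (p : nat).

Fact loop_walk : walk (ord_max : vertex (Qp p)) [:: None].
Proof. by rewrite /= eqxx. Qed.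

Definition loop_path : qpath (Qp p) := @QPath (Qp p) (ord_max, [:: None]) loop_walk.

Definition alpha : path_alg K (Qp p) := pbasis K loop_path.

Fact alphaX_proper x : (0 < x)%N -> 1 \notin gen_ideal (alpha ^+ x).
Proof.
case: x => // x _; apply/asboolP => -[s es].
set t := trivial_path (vertex0 (Qp p)).
have := congr1 (fun f : path_alg K (Qp p) => f@_t) es.
rewrite [in LHS]pa_one_coef raddf_sum big1 /= => [/eqP|u _].
  by rewrite oner_eq0.
rewrite !pa_coef_trivM exprS pa_coef_trivM mcoeff_pbasis -val_eqE xpair_eqE andbF.
by rewrite mul0r mulr0 mul0r.
Qed.

Definition Ix (x : nat) (x_gt0 : (0 < x)%N) : ideal (path_alg K (Qp p)) :=
  principal_ideal (alphaX_proper x_gt0).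

Definition KQp_quot (x : nat) (x_gt0 : (0 < x)%N) : algType K :=
  quot_alg (Ix x_gt0).

End QpAlgebra.

(* Main.v *)
From HB Require Import structures.
Require Import Defs.
From mathcomp Require Import all_boot all_order all_algebra ring_quotient.
From mathcomp Require Import finmap boolp reals complex monalg.

Set Implicit Arguments.
Unset Strict Implicit.
Unset Printing Implicit Defensive.

Import GRing.Theory.
Local Open Scope ring_scope.
Local Open Scope quotient_scope.

(** A right module over [K Q_p / I_x] is a chain of spaces [V_1 -> ... -> V_p]
    with an operator [T] on [V_p] such that [T^x = 0].  The algebra is of finite
    type if [x <= 2], or if [x = 3] and [p = 2]; it is wild in all other cases;
    and no algebra of finite dimension over a field of characteristic zero is
    both.

    Wild algebras are not of finite type ([wild_not_finite]).  The modules of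
    dimension one over the free algebra on which [X] acts by an integer and [Y]
    by zero are pairwise non-isomorphic.  Tensored with the bimodule that
    exhibits wildness they stay so, and they are spanned by a bounded number of
    vectors ([tensor_line_spans]).  A finite type would leave only finitely many
    modules of bounded dimension ([finite_bounded]).

    The finite cases ([finite_case]) rest on one consequence of indecomposability,
    from Fitting's lemma: an endomorphism that fixes a nonzero vector is
    invertible.  If some map of the chain is not injective, a Jordan block of
    the maps of the chain splits off, and the module is an interval
    ([chain_interval]).  Otherwise the chain is a flag in [V_p], and one looks
    for Jordan blocks of [T], together with functionals, such that the sum of
    the retractions onto the blocks preserves the flag.  This sum fixes the socle
    of a block, so it is invertible; hence the blocks span [V_p], and the module
    is one of finitely many ([code_of_blocks]).  Functionals with the required
    properties solve a linear system, so that they exist unless some vector lies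
    in some subspace.  A module that resists all attempts thus satisfies many
    inclusions between subspaces.  If [T^2 = 0], those from single blocks imply
    that the module is zero ([code_of_square_zero]).  If [T^3 = 0] and [p = 2],
    one needs configurations of up to three linked blocks, and the inclusions
    imply that [T^2 = 0] ([code_of_cube_zero]).

    For the wild cases ([wild_loop_four], [wild_loop_three]) the bimodule is free
    over the free algebra, and its tensor product with [N] is a system of powers
    of [N] with maps given by explicit matrices.  The matrices are chosen such
    that the kernel of the loop is a sum of copies of [N * N] in which canonical
    subspaces, the images of kernels under powers of the loop, cut out the
    summands, a diagonal, the graph of the operator
    [(n1, n2) |-> (n1 X + n2 Y, n1)] and the line [N * 0].  A map of such systems
    therefore comes from one map of [N] that commutes with [X] and [Y]
    ([rigid4], [rigid3]), so the system determines [N] ([wild_of_witness]). *)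

(** * Linear systems over a field *)

Section LinearSystems.
Variable K : fieldType.

(** Fredholm alternative: a linear system for a column is solvable as soon as
    every linear dependency between its equations is respected by the right
    hand side. *)
Lemma solve_col (m d : nat) (M : 'M[K]_(m, d)) (c : 'cV[K]_m) :
  (forall z : 'rV_m, z *m M = 0 -> z *m c = 0) -> exists f, M *m f = c.
Proof.
move=> H; have: (c^T <= M^T)%MS.
  rewrite submxE -trmx_eq0 trmx_mul trmxK; apply/eqP/row_matrixP => i.
  rewrite row_mul row0; apply: H; rewrite -row_mul.
  by rewrite -[_ *m M]trmxK trmx_mul trmxK mulmx_coker trmx0 row0.
case/submxP=> f Hf; exists f^T.
by rewrite -[LHS]trmxK trmx_mul trmxK -Hf trmxK.
Qed.

(** The systems that occur below: a functional killing [N], with prescribed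
    values on [U]. *)
Lemma solve_functional (m1 m2 d : nat) (U : 'M[K]_(m1, d)) (N : 'M_(m2, d))
    (c : 'cV[K]_m1) :
  (forall z : 'rV_m1, (z *m U <= N)%MS -> z *m c = 0) ->
  exists f, U *m f = c /\ N *m f = 0.
Proof.
move=> H; have [z Hz|f] := @solve_col _ _ (col_mx U N) (col_mx c 0).
  move: Hz; rewrite -[z]hsubmxK !mul_row_col mulmx0 addr0 => /eqP.
  rewrite addr_eq0 => /eqP Hz; apply: H; rewrite Hz eqmx_opp.
  exact: submxMl.
by rewrite mul_col_mx => /eq_col_mx; exists f.
Qed.

Lemma separate (m d : nat) (N : 'M[K]_(m, d)) (e : 'rV[K]_d) :
  ~~ (e <= N)%MS -> exists f : 'cV_d, N *m f = 0 /\ e *m f = 1%:M.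
Proof.
move=> H; have [z|f [H1 H2]] := @solve_functional _ _ _ e N 1%:M.
  rewrite [z]mx11_scalar mul_scalar_mx; case: (eqVneq (z 0 0) 0) => [->|nz].
    by rewrite raddf0 mul0mx.
  by rewrite (eqmx_scale _ nz) (negPf H).
by exists f.
Qed.

End LinearSystems.

(** * Direct sums of Jordan blocks *)

Section Blocks.
Variables (K : fieldType) (D : nat) (T : 'M[K]_D).

(** A Jordan block of [T] is given by its length and a generator; the functional
    is meant to detect its socle. *)
Record block := Block { bsize : nat; bgen : 'rV[K]_D; bfun : 'cV[K]_D }.

Definition jordan_rows (n : nat) (x : 'rV[K]_D) : 'M_(n, D) :=
  \matrix_(k < n) (x *m T ^+ k).

Fixpoint block_rows (bs : seq block) :
    'M[K]_(sumn [seq bsize b | b <- bs], D) :=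
  if bs is b :: bs' then
    col_mx (jordan_rows (bsize b) (bgen b)) (block_rows bs')
  else 0.

Fixpoint jordan_code (ns : seq nat) : 'M[bool]_(sumn ns) :=
  if ns is n :: ns' then
    block_mx (\matrix_(i < n, j < n) (i.+1 == j)) (const_mx false)
             (const_mx false) (jordan_code ns')
  else const_mx false.

Definition socle (b : block) : 'rV[K]_D := bgen b *m T ^+ (bsize b).-1.

(** With [n] the length, [x] the generator and [f] the functional, [u] is sent to
    the sum of the vectors [(u T^(n-1-k) f) x T^k]: the operator reads off
    coordinates in a cyclic module of length [n] and puts them on the block.  It
    need not be idempotent, but it fixes the socle. *)
Definition retract (b : block) : 'M[K]_D :=
  \sum_(k < bsize b)
    T ^+ ((bsize b).-1 - k) *m bfun b *m (bgen b *m T ^+ k).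

Definition block_wf (b : block) : Prop :=
  [/\ (0 < bsize b)%N, bgen b *m T ^+ bsize b = 0, T ^+ bsize b *m bfun b = 0
    & socle b *m bfun b = 1%:M].

(** The functionals are only asked to be triangular on the socles.  This is enough
    for the independence of the blocks, and leaves room in the choice of the
    functionals. *)
Fixpoint blocks_wf (bs : seq block) : Prop :=
  if bs is b :: bs' then
    [/\ block_wf b, foldr (fun b' P => socle b' *m bfun b = 0 /\ P) True bs'
      & blocks_wf bs']
  else True.

Definition boolmx m n (A : 'M[bool]_(m, n)) : 'M[K]_(m, n) :=
  map_mx (fun b : bool => b%:R) A.

Lemma mul_jordan_rows n (x : 'rV_D) (y : 'rV_n) :
  y *m jordan_rows n x = \sum_(k < n) y 0 k *: (x *m T ^+ k).
Proof. by rewrite mulmx_sum_row; apply: eq_bigr => k _; rewrite rowK. Qed.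

Lemma mul_expr_succ m (x : 'M_(m, D)) k : x *m T ^+ k *m T = x *m T ^+ k.+1.
Proof. by rewrite -mulmxA exprSr. Qed.

Lemma jordan_rows_T n (x : 'rV_D) : x *m T ^+ n = 0 ->
  boolmx (\matrix_(i < n, j < n) (i.+1 == j)) *m jordan_rows n x =
  jordan_rows n x *m T.
Proof.
move=> xn; apply/row_matrixP => i; rewrite !row_mul rowK mul_jordan_rows.
rewrite mul_expr_succ.
have [lt|] := ltnP i.+1 n; last first.
  move=> le; have -> : i.+1 = n by apply/eqP; rewrite eqn_leq le ltn_ord.
  rewrite xn big1 // => k _; rewrite !mxE; case: eqP => [e|]; last first.
    by rewrite scale0r.
  by move: (ltn_ord k); rewrite -e ltnNge le.
rewrite (bigD1 (Ordinal lt)) //= !mxE eqxx scale1r big1 ?addr0 // => k nk.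
rewrite !mxE; case: eqP => [e|]; last by rewrite scale0r.
by case/eqP: nk; apply: val_inj.
Qed.

Lemma block_rows_T bs : blocks_wf bs ->
  boolmx (jordan_code [seq bsize b | b <- bs]) *m block_rows bs =
  block_rows bs *m T.
Proof.
elim: bs => [|b bs IH] /=; first by rewrite mulmx0 mul0mx.
case=> -[_ bT _ _] _ /IH {}IH.
rewrite /boolmx map_block_mx mul_block_col mul_col_mx jordan_rows_T //.
rewrite -/(boolmx _) IH !map_const_mx.
by rewrite [const_mx _](_ : _ = 0) ?[X in X *m block_rows _](_ : _ = 0) //
  ?mul0mx ?addr0 ?add0r //; apply/matrixP=> i j; rewrite !mxE.
Qed.

Lemma mul_retract b (u : 'rV_D) :
  u *m retract b = \sum_(k < bsize b)
    (u *m T ^+ ((bsize b).-1 - k) *m bfun b) 0 0 *: (bgen b *m T ^+ k).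
Proof.
rewrite mulmx_sumr; apply: eq_bigr => k _.
by rewrite -mul_scalar_mx -mx11_scalar !mulmxA.
Qed.

(** Both sides are the same sum up to a shift of the index, because the extreme
    terms contain the power of [T] that kills the block. *)
Lemma retract_comm b : block_wf b -> retract b *m T = T *m retract b.
Proof.
case: b => -[|n] x f [] //= _ xn fn _; rewrite /retract /=.
have e1 i : T ^+ (n - i) *m f *m (x *m T ^+ i) *m T =
            T ^+ (n - i) *m f *m (x *m T ^+ i.+1).
  by rewrite -mulmxA mul_expr_succ.
have e2 i : T *m (T ^+ (n - i) *m f *m (x *m T ^+ i)) =
            T ^+ (n - i).+1 *m f *m (x *m T ^+ i).
  by rewrite exprS -mulmxE !mulmxA.
rewrite mulmx_suml mulmx_sumr big_ord_recr big_ord_recl /=.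
rewrite e1 e2 xn mulmx0 addr0 subn0 fn mul0mx add0r.
by apply: eq_bigr => i _; rewrite e1 e2 /bump /= add1n -subSn // subSS.
Qed.

Lemma jordan_code_upper ns (i j : 'I_(sumn ns)) :
  jordan_code ns i j -> (i < j)%N.
Proof.
elim: ns i j => [|n ns IH] i j /=; first by rewrite mxE.
rewrite mxE; case: splitP => k ->; rewrite mxE; case: splitP => l ->; rewrite ?mxE //.
  by move/eqP<-.
by rewrite ltn_add2l; apply: IH.
Qed.

Lemma upper_nilpotent m (A : 'M[K]_m) :
  (forall i j, A i j != 0 -> (i < j)%N) -> A ^+ m = 0.
Proof.
move=> H; have P t (i j : 'I_m) : (j < i + t)%N -> (A ^+ t) i j = 0.
  elim: t i j => [|t IH] i j.
    by rewrite addn0 expr0 mxE; case: eqP => // ->; rewrite ltnn.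
  rewrite addnS ltnS => le; rewrite exprSr mxE big1 // => k _.
  case: (ltnP k (i + t)) => [lt|ge]; first by rewrite IH ?mul0r.
  case: (eqVneq (A k j) 0) => [->|/H lt]; first by rewrite mulr0.
  by move: (leq_trans (leq_ltn_trans ge lt) le); rewrite ltnn.
apply/matrixP => i j; rewrite P ?mxE //.
by rewrite (leq_trans (ltn_ord j)) ?leq_addl.
Qed.

Lemma jordan_ker n (y : 'rV[K]_n) (x : 'rV_D) :
  y *m boolmx (\matrix_(i < n, j < n) (i.+1 == j)) = 0 ->
  (forall k : 'I_n, k.+1 != n -> y 0 k = 0) /\
  forall m : 'I_n, m.+1 = n -> y *m jordan_rows n x = y 0 m *: (x *m T ^+ n.-1).
Proof.
move=> yJ; have y0 (k : 'I_n) : k.+1 != n -> y 0 k = 0.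
  move=> nk; have lt : (k.+1 < n)%N by rewrite ltn_neqAle nk ltn_ord.
  move/matrixP/(_ 0 (Ordinal lt)): yJ; rewrite !mxE (bigD1 k) //= !mxE eqxx.
  rewrite mulr1 big1 ?addr0 // => l nl; rewrite !mxE eqSS.
  by case: eqP => [e|]; rewrite ?mulr0 //; case/eqP: nl; apply: val_inj.
split=> // m em; rewrite mul_jordan_rows (bigD1 m) //= big1 ?addr0 => [|k nk].
  by congr (_ *: (_ *m T ^+ _)); move: em => /(congr1 predn).
rewrite y0 ?scale0r //; apply: contraNneq nk => ek.
by apply/eqP/val_inj/succn_inj; rewrite ek em.
Qed.

Lemma mul_boolmx_jordan n ns (y1 : 'rV[K]_n) (y2 : 'rV_(sumn ns)) :
  row_mx y1 y2 *m boolmx (jordan_code (n :: ns)) =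
  row_mx (y1 *m boolmx (\matrix_(i < n, j < n) (i.+1 == j)))
         (y2 *m boolmx (jordan_code ns)).
Proof.
rewrite /boolmx /= map_block_mx mul_row_block !map_const_mx.
by rewrite (_ : const_mx _ = 0) ?[X in _ *m X](_ : const_mx _ = 0)
  ?mulmx0 ?addr0 ?add0r //; apply/matrixP=> i j; rewrite !mxE.
Qed.

Lemma socle_kernel bs (y : 'rV[K]_(sumn [seq bsize b | b <- bs]))
    (f : 'cV[K]_D) :
  foldr (fun b' P => socle b' *m f = 0 /\ P) True bs ->
  y *m boolmx (jordan_code [seq bsize b | b <- bs]) = 0 ->
  y *m block_rows bs *m f = 0.
Proof.
elim: bs y => [|b bs IH] y /=; first by rewrite mulmx0 mul0mx.
case=> bf /IH {}IH; rewrite -[y](@hsubmxK _ _ (bsize b)) mul_boolmx_jordan => /eqP.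
rewrite row_mx_eq0 => /andP[/eqP/(@jordan_ker _ _ (bgen b)) [H1 H2] /eqP/IH {}IH].
rewrite mul_row_col mulmxDl IH addr0.
case: (posnP (bsize b)) => [e0|b0].
  have n0 (k : 'I_(bsize b)) : False by case: k; rewrite e0.
  by rewrite mul_jordan_rows big1 ?mul0mx // => k; case: (n0 k).
have lt : ((bsize b).-1 < bsize b)%N by rewrite prednK.
by rewrite (H2 (Ordinal lt)) ?prednK // -scalemxAl bf scaler0.
Qed.

Lemma socle_inj bs (y : 'rV[K]_(sumn [seq bsize b | b <- bs])) :
  blocks_wf bs ->
  y *m boolmx (jordan_code [seq bsize b | b <- bs]) = 0 ->
  y *m block_rows bs = 0 -> y = 0.
Proof.
elim: bs y => [|b bs IH] y /=; first by move=> *; apply/matrixP=> i [].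
case=> -[b0 _ _ bf] hb /IH {}IH.
rewrite -[y](@hsubmxK _ _ (bsize b)) mul_boolmx_jordan => /eqP; rewrite row_mx_eq0.
case/andP=> /eqP/(@jordan_ker _ _ (bgen b)) [H1 H2] /eqP y2 /[dup].
move/(congr1 (mulmx^~ (bfun b))); rewrite mul_row_col mul0mx mulmxDl.
rewrite (socle_kernel hb y2) addr0.
have lt : ((bsize b).-1 < bsize b)%N by rewrite prednK.
rewrite (H2 (Ordinal lt)) ?prednK // -scalemxAl -/(socle b) bf.
move/matrixP/(_ 0 0); rewrite !mxE mulr1 => e.
have -> : lsubmx y = 0.
  apply/rowP => k; rewrite [RHS]mxE.
  case: (eqVneq k.+1 (bsize b)) => [ek|/H1 //].
  by rewrite -e mxE; congr (y _ (lshift _ _)); apply/val_inj/succn_inj; rewrite ek prednK.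
by rewrite e scale0r add0r => /(IH _ y2) ->; rewrite row_mx0.
Qed.

(** A linear dependency in lowest terms would involve the socles only, where
    the functionals are triangular. *)
Lemma block_rows_inj bs (y : 'rV[K]_(sumn [seq bsize b | b <- bs])) :
  blocks_wf bs -> y *m block_rows bs = 0 -> y = 0.
Proof.
move=> wf yi; set A := boolmx (jordan_code [seq bsize b | b <- bs]).
have [t]: exists t, y *m A ^+ t = 0.
  exists (sumn [seq bsize b | b <- bs]); rewrite upper_nilpotent ?mulmx0 // => i j.
  rewrite mxE; case E: (jordan_code _ i j); last by rewrite eqxx.
  by move=> _; apply: jordan_code_upper E.
elim: t y yi => [|t IH] y yi; first by rewrite expr0 mulmx1.
rewrite exprS mulmxA => /(IH (y *m A)) {}IH.
by apply: (socle_inj wf) => //; apply: IH; rewrite -mulmxA block_rows_T // mulmxA yi mul0mx.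
Qed.

End Blocks.

(** * Operators with a flag *)

Section Flags.
Variables (K : fieldType) (p : nat).

Definition flag_endo D (T : 'M[K]_D) (F : nat -> 'M[K]_D) (f : 'M[K]_D) :=
  f *m T = T *m f /\ forall j, (j <= p)%N -> (F j *m f <= F j)%MS.

(** What is left of indecomposability: by Fitting's lemma, an endomorphism of an
    indecomposable object that fixes a nonzero vector is invertible. *)
Definition flag_local D (T : 'M[K]_D) (F : nat -> 'M[K]_D) : Prop :=
  forall (f : 'M_D) (e : 'rV_D), flag_endo T F f -> e != 0 -> e *m f = e ->
  f \in unitmx.

Definition smallmx m n (A : 'M['I_4]_(m, n)) : 'M[K]_(m, n) :=
  map_mx (fun x : 'I_4 => (x : nat)%:R) A.

(** A code describes, in a basis of at most seven vectors, an operator by a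
    0-1 matrix and each step of a flag by spanning vectors whose coordinates are
    the images of 0, 1, 2, 3.  The point is that there are finitely many
    codes. *)
Definition code : finType :=
  {m : 'I_8 & ('M[bool]_m * {ffun 'I_p.+1 -> {set 'rV['I_4]_m}})%type}.

Definition has_code D (T : 'M[K]_D) (F : nat -> 'M[K]_D) (c : code) : Prop :=
  exists (i : 'M_(tag c, D)) (h : 'M_(D, tag c)),
  [/\ i *m h = 1%:M, h *m i = 1%:M, boolmx K (tagged c).1 *m i = i *m T &
      forall j : 'I_p.+1,
      (F j :=: \sum_(g in (tagged c).2 j) <<smallmx g *m i>>)%MS].

Lemma has_code_iso D D' (T : 'M_D) F (T' : 'M_D') F' c :
  has_code T F c -> has_code T' F' c ->
  exists (g : 'M_(D, D')) (g' : 'M_(D', D)),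
  [/\ g *m g' = 1%:M, g' *m g = 1%:M, g *m T' = T *m g &
      forall j, (j <= p)%N -> (F j *m g :=: F' j)%MS].
Proof.
case=> i [h [ih hi iT iF]] [i' [h' [ih' hi' iT' iF']]].
have gi : i *m (h *m i') = i' by rewrite mulmxA ih mul1mx.
exists (h *m i'), (h' *m i); split.
- by rewrite mulmxA -[h *m i' *m h']mulmxA ih' mulmx1.
- by rewrite mulmxA -[h' *m i *m h]mulmxA ih mulmx1.
- rewrite -mulmxA -iT' mulmxA -[T]mul1mx -hi -![h *m _ *m _]mulmxA -iT.
  by rewrite -(mulmxA (boolmx K (tagged c).1)) gi mulmxA.
move=> j; rewrite -ltnS => lt.
have /= e1 := eqmxMr (h *m i') (iF (Ordinal lt)); have /= e2 := iF' (Ordinal lt).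
apply/eqmxP; rewrite !e1 !e2 !sumsmxMr_gen.
have eg g : (<<smallmx g *m i>>%MS *m (h *m i') :=: <<smallmx g *m i'>>)%MS.
  apply/eqmxP; rewrite !genmxE !(eqmxMr _ (genmxE _)) -mulmxA gi.
  exact/eqmxP.
apply/eqmxP; apply: eqmx_sums => g _. apply: eqmx_trans (genmxE _) (eg _ g).
Qed.

Section Criterion.
Variables (D : nat) (T : 'M[K]_D) (F : nat -> 'M[K]_D).

Definition block_retract (bs : seq (block K D)) : 'M[K]_D :=
  \sum_(b <- bs) retract T b.

Definition small_vector (bs : seq (block K D)) (y : 'rV[K]_D) : Prop :=
  exists g, y = smallmx g *m block_rows T bs.

(** The part of the [j]th step of the flag that a code can describe. *)
Definition small_span (bs : seq (block K D)) (j : nat) : 'M[K]_D :=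
  (\sum_(g : 'rV['I_4]_(sumn [seq bsize b | b <- bs])
        | (smallmx g *m block_rows T bs <= F j)%MS)
     <<smallmx g *m block_rows T bs>>)%MS.

Lemma small_span_in bs j y :
  small_vector bs y -> (y <= F j)%MS -> (y <= small_span bs j)%MS.
Proof. by case=> g -> yF; apply: (sumsmx_sup g) => //; rewrite genmxE. Qed.

Lemma socleT b : block_wf T b -> socle T b *m T = 0.
Proof. by case=> b0 bT _ _; rewrite mul_expr_succ prednK. Qed.

Lemma mul_retract_socle b (e : 'rV_D) : (0 < bsize b)%N -> e *m T = 0 ->
  e *m retract T b = (e *m bfun b) 0 0 *: socle T b.
Proof.
move=> b0 eT; rewrite mul_retract.
have lt : ((bsize b).-1 < bsize b)%N by rewrite prednK.
rewrite (bigD1 (Ordinal lt)) //= subnn expr0 mulmx1 big1 ?addr0 // => k nk.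
have lt' : (k < (bsize b).-1)%N.
  rewrite ltn_neqAle -ltnS prednK // ltn_ord andbT.
  by apply: contraNneq nk => ek; apply/eqP/val_inj.
by rewrite -(prednK (ltac:(by rewrite subn_gt0) : 0 < (bsize b).-1 - k)%N) exprS
  -mulmxE mulmxA eT !mul0mx mxE scale0r.
Qed.

(** The vector is the socle of the last block, which the functionals of all the
    other blocks kill. *)
Lemma block_retract_fixes bs : blocks_wf T bs -> bs <> [::] ->
  exists e : 'rV_D, [/\ e != 0, e *m block_retract bs = e, e *m T = 0 &
    forall f : 'cV_D,
    foldr (fun b' P => socle T b' *m f = 0 /\ P) True bs -> e *m f = 0].
Proof.
elim: bs => // b bs IH /= [wb hb wbs] _.
case: bs IH hb wbs => [_ _ _|b' bs IH hb wbs].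
  exists (socle T b); have [b0 bT _ bf] := wb; split; last by move=> f [].
  - apply: contraTneq isT => e0; move: bf; rewrite e0 mul0mx => /matrixP/(_ 0 0).
    by rewrite !mxE => /eqP; rewrite eq_sym oner_eq0.
  - rewrite /block_retract big_seq1 mul_retract_socle ?socleT // bf mxE.
    by rewrite scale1r.
  - exact: socleT.
have [//|e [e0 eP eT ef]] := IH wbs; exists e; split=> //; last first.
  by move=> f [_ /ef].
have [b0 _ _ _] := wb.
rewrite /block_retract big_cons mulmxDr mul_retract_socle //.
by rewrite (ef _ hb) mxE scale0r add0r.
Qed.

Lemma block_retract_comm bs :
  blocks_wf T bs -> block_retract bs *m T = T *m block_retract bs.
Proof.
elim: bs => [|b bs IH] /=; first by rewrite /block_retract big_nil mul0mx mulmx0.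
case=> wb _ /IH {}IH; rewrite /block_retract big_cons mulmxDl mulmxDr.
by rewrite retract_comm // -/(block_retract bs) IH.
Qed.

Lemma retract_sub b : (retract T b <= jordan_rows T (bsize b) (bgen b))%MS.
Proof.
apply: summx_sub => k _; apply: mulmx_sub.
by rewrite -(rowK (fun k : 'I__ => bgen b *m T ^+ k)) row_sub.
Qed.

Lemma block_retract_sub bs : (block_retract bs <= block_rows T bs)%MS.
Proof.
elim: bs => [|b bs IH]; first by rewrite /block_retract big_nil sub0mx.
rewrite /block_retract big_cons /= -addsmxE addmx_sub_adds //.
exact: retract_sub.
Qed.

(** The block retraction commutes with [T], preserves the flag and fixes a
    socle vector, so it is invertible.  Hence the blocks span the space, and
    each step of the flag is spanned by the small vectors that it contains. *)
Lemma code_of_blocks bs : flag_local T F -> blocks_wf T bs -> bs <> [::] ->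
  (sumn [seq bsize b | b <- bs] < 8)%N ->
  (forall j (u : 'rV_D), (j <= p)%N -> (u <= F j)%MS ->
     (u *m block_retract bs <= small_span bs j)%MS) ->
  exists c, has_code T F c.
Proof.
move=> loc wf bs0 lt8 H; set P := block_retract bs.
have spanF j : (small_span bs j <= F j)%MS.
  by apply/sumsmx_subP => g gF; rewrite genmxE.
have PF j : (j <= p)%N -> (F j *m P <= small_span bs j)%MS.
  by move=> jp; apply/row_subP => k; rewrite row_mul H ?row_sub.
have [e [e0 eP _ _]] := block_retract_fixes wf bs0.
have uP : P \in unitmx.
  apply: (loc P e) => //; split; first exact: block_retract_comm.
  by move=> j jp; apply: submx_trans (PF j jp) (spanF j).
set i := block_rows T bs.
have full : row_full i.
  rewrite -sub1mx; apply: submx_trans (block_retract_sub bs).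
  by rewrite sub1mx row_full_unit.
have free : row_free i.
  rewrite -kermx_eq0; apply/eqP/row_matrixP => k; rewrite row0.
  apply: (block_rows_inj wf); rewrite -row_mul mulmx_ker; exact: row0.
exists (Tagged (fun m : 'I_8 => ('M[bool]_m * {ffun 'I_p.+1 -> {set 'rV['I_4]_m}})%type)
  (jordan_code [seq bsize b | b <- bs] : 'M_(Ordinal lt8), [ffun j : 'I_p.+1 =>
  [set g : 'rV_(Ordinal lt8) | (smallmx g *m i <= F j)%MS]]) : code).
exists i, (pinvmx i); split.
- exact: mulmxVp.
- exact: mulVpmx.
- exact: block_rows_T.
move=> j /=; apply/eqmxP; rewrite ffunE; set S := (\sum_(g in _) _)%MS.
have -> : S = small_span bs j by apply: eq_bigl => g; rewrite inE.
rewrite spanF andbT.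
have PFj : (F j *m P <= F j)%MS by apply: submx_trans (PF j _) (spanF j); rewrite -ltnS.
apply: submx_trans (PF j _); last by rewrite -ltnS.
move: (mxrank_leqif_sup PFj) => [_ <-]; apply/eqP/mxrankMfree.
by rewrite row_free_unit.
Qed.

End Criterion.
End Flags.

(** * Combinations of few basis vectors *)

Section SmallVectors.
Variables (K : fieldType) (D : nat) (T : 'M[K]_D).
Implicit Type bs : seq (block K D).

Definition basis_vector bs (y : 'rV[K]_D) : Prop :=
  exists k, y = row k (block_rows T bs).

Lemma basis_head b bs k : (k < bsize b)%N ->
  basis_vector (b :: bs) (bgen b *m T ^+ k).
Proof.
move=> lt; exists (lshift _ (Ordinal lt)).
by rewrite /= rowKu rowK.
Qed.

Lemma basis_tail b bs y : basis_vector bs y -> basis_vector (b :: bs) y.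
Proof. by case=> k ->; exists (rshift _ k); rewrite /= rowKd. Qed.

(** The coordinates of a sum of at most three basis vectors are at most three:
    this is where the four values of the coordinates in a code come from. *)
Lemma small_sum bs (l : seq 'I_(sumn [seq bsize b | b <- bs])) :
  (size l < 4)%N -> small_vector T bs (\sum_(k <- l) row k (block_rows T bs)).
Proof.
move=> l3; exists (\row_k inord (count_mem k l)).
have -> : smallmx K (\row_k inord (count_mem k l)) = \row_k (count_mem k l)%:R.
  apply/rowP=> k; rewrite !mxE inordK //.
  by apply: leq_ltn_trans l3; apply: count_size.
rewrite mulmx_sum_row; elim: l {l3} => [|a l IH].
  by rewrite big_nil big1 // => k _; rewrite mxE scale0r.
rewrite big_cons IH -[X in X + _](_ : \sum_k (a == k)%:R *: row k (block_rows T bs) = _).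
  by rewrite -big_split; apply: eq_bigr => k _; rewrite !mxE /= natrD scalerDl.
rewrite (bigD1 a) //= eqxx scale1r big1 ?addr0 // => k /negPf.
by rewrite eq_sym => ->; rewrite scale0r.
Qed.

Lemma small1 bs y : basis_vector bs y -> small_vector T bs y.
Proof. by case=> k ->; have := @small_sum bs [:: k] isT; rewrite big_seq1. Qed.

Lemma small2 bs y1 y2 : basis_vector bs y1 -> basis_vector bs y2 ->
  small_vector T bs (y1 + y2).
Proof.
case=> k1 -> [k2 ->]; have := @small_sum bs [:: k1; k2] isT.
by rewrite !big_cons big_nil addr0.
Qed.

Lemma small3 bs y1 y2 y3 : basis_vector bs y1 -> basis_vector bs y2 ->
  basis_vector bs y3 -> small_vector T bs (y1 + y2 + y3).
Proof.
case=> k1 -> [k2 ->] [k3 ->]; have := @small_sum bs [:: k1; k2; k3] isT.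
by rewrite !big_cons big_nil addr0 addrA.
Qed.

Lemma small_span_full (F : nat -> 'M[K]_D) bs j (u : 'rV_D) : row_full (F j) ->
  (u *m block_retract T bs <= small_span T F bs j)%MS.
Proof.
move=> full; apply: submx_trans (_ : _ <= block_rows T bs)%MS _.
  by apply: mulmx_sub; apply: block_retract_sub.
by apply/row_subP => k; apply: small_span_in (submx_full _ full); apply: small1; exists k.
Qed.

End SmallVectors.

(** * Summands with a single block *)

Lemma sub_kills (K : fieldType) m1 m2 d k (A : 'M[K]_(m1, d)) (N : 'M_(m2, d))
  (f : 'M_(d, k)) : (A <= N)%MS -> N *m f = 0 -> A *m f = 0.
Proof. by case/submxP => z ->; rewrite -mulmxA => ->; rewrite mulmx0. Qed.

Section Classification.
Variables (K : fieldType) (p D : nat) (T : 'M[K]_D) (F : nat -> 'M[K]_D).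
Hypothesis loc : flag_local p T F.
Hypothesis F0 : F 0 = 0.
Hypothesis Fp : F p = 1%:M.
Hypothesis Fmono : forall i j, (i <= j <= p)%N -> (F i <= F j)%MS.

(** Here [x T^k] lies in the step [l k] of the flag.  A functional that vanishes
    on the displayed sum but not on [x T^(n-1)] is exactly a retraction onto the
    block spanned by the [x T^k]. *)
Lemma single_block n (l : nat -> nat) (x : 'rV_D) :
  (0 < n < 8)%N -> x *m T ^+ n = 0 ->
  (forall k, (k < n)%N -> (0 < l k <= p)%N /\ (x *m T ^+ k <= F (l k))%MS) ->
  ~~ (x *m T ^+ n.-1 <= T ^+ n + \sum_(k < n) F (l k).-1 *m T ^+ (n.-1 - k))%MS ->
  exists c : code p, has_code T F c.
Proof.
case/andP=> n0 n8 xn xl /separate [f [Nf xf]].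
have Tf : T ^+ n *m f = 0.
  exact: sub_kills (addsmxSl _ _) Nf.
have Ff (k : 'I_n) : F (l k).-1 *m T ^+ (n.-1 - k) *m f = 0.
  apply: sub_kills Nf; apply: submx_trans (addsmxSr _ _).
  by apply: (sumsmx_sup k).
apply: (@code_of_blocks _ _ _ _ _ [:: Block n x f]) => //=; first by rewrite addn0.
move=> j u jp uF; rewrite /block_retract big_seq1 mul_retract /=.
apply: summx_sub => k _; have [/andP[l0 lp] xF] := xl _ (ltn_ord k).
case: (leqP (l k) j) => [lj|jl].
  apply/scalemx_sub/small_span_in; first by apply/small1/(@basis_head _ _ T (Block n x f)).
  by apply: submx_trans xF (Fmono _); rewrite lj.
have /submxP[z ->] : (u <= F (l k).-1)%MS.
  by apply: submx_trans uF (Fmono _); rewrite -ltnS prednK // jl (leq_trans (leq_pred _)).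
by rewrite -!mulmxA (mulmxA (F _)) Ff mulmx0 mxE scale0r sub0mx.
Qed.

(** * Operators of square zero with an arbitrary flag *)

(** If no block of length two splits off, then [x T] in [F j] with [x] in [F i]
    can be rewritten with [i] or [j] smaller, so that [T = 0] by induction on
    [i + j].  If no block of length one splits off either, the flag is constant,
    hence zero. *)
Lemma code_of_square_zero : (0 < D)%N -> T ^+ 2 = 0 ->
  exists c : code p, has_code T F c.
Proof.
move=> D0 T2; apply: contrapT => NC.
have step2 i j (x : 'rV_D) : (0 < i <= p)%N -> (0 < j <= p)%N ->
    (x <= F i)%MS -> (x *m T <= F j)%MS ->
    (x *m T <= F i.-1 *m T + F j.-1)%MS.
  move=> hi hj xi xj; apply/contraT => nx; case: NC.
  apply: (@single_block 2 (fun k => if k == 0 then i else j) x) => //.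
  - by rewrite T2 mulmx0.
  - by case=> [|[|//]] _; rewrite ?expr0 ?mulmx1 ?expr1.
  rewrite T2 expr1; apply: contraNN nx => /submx_trans; apply.
  by rewrite adds0mx !big_ord_recl big_ord0 /= !expr0 mulmx1 expr1 addsmx0_id.
have T0 n i j (x : 'rV_D) : (i + j <= n)%N -> (i <= p)%N -> (j <= p)%N ->
    (x <= F i)%MS -> (x *m T <= F j)%MS -> x *m T = 0.
  elim: n i j x => [|n IH] [|i] [|j] x //; rewrite ?F0.
  - by move=> _ _ _ /submx0null-> _; rewrite mul0mx.
  - by move=> _ _ _ /submx0null-> _; rewrite mul0mx.
  - by move=> _ _ _ /submx0null-> _; rewrite mul0mx.
  - by move=> _ _ _ _ /submx0null.
  move=> hn ip jp xi xj; have /sub_addsmxP[[a b] /= e] := step2 i.+1 j.+1 x ip jp xi xj.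
  have aT0 : a *m F i *m T = 0.
    apply: (IH i j.+1); rewrite ?submxMl // ?(ltnW ip) //.
    have -> : a *m F i *m T = x *m T - b *m F j by rewrite e mulmxA addrK.
    rewrite addmx_sub // eqmx_opp.
    by apply: submx_trans (submxMl _ _) (Fmono _); rewrite leqnSn.
  apply: (IH i.+1 j); rewrite ?(ltnW jp) //.
    by rewrite -ltnS -addnS.
  by rewrite e mulmxA aT0 add0r submxMl.
have {}T0 : T = 0.
  apply/row_matrixP => k; rewrite row0 rowE.
  by apply: (T0 (p + p)%N p p); rewrite // Fp submx1.
have step1 i (x : 'rV_D) : (i < p)%N -> (x <= F i.+1)%MS -> (x <= F i)%MS.
  move=> ip xi; apply/contraT => nx; case: NC.
  apply: (@single_block 1 (fun=> i.+1) x) => //.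
  - by rewrite T0 expr1 mulmx0.
  - by case=> // _; rewrite expr0 mulmx1.
  rewrite expr0 mulmx1; apply: contraNN nx => /submx_trans; apply.
  by rewrite expr1 {1}T0 adds0mx big_ord1 /= ?expr0 mulmx1.
have F_0 i : (i <= p)%N -> (F i <= F 0)%MS.
  elim: i => // i IH ip; apply: submx_trans (IH (ltnW ip)).
  by apply/row_subP => k; apply: step1; rewrite ?row_sub.
have := F_0 p (leqnn p); rewrite Fp F0 submx0 => /eqP/matrixP/(_ (Ordinal D0) (Ordinal D0)).
by rewrite !mxE eqxx => /eqP; rewrite oner_eq0.
Qed.

End Classification.

(** * Operators of cube zero with one subspace *)

Lemma addsmx_mul_eq0 (K : fieldType) m1 m2 d k (A : 'M[K]_(m1, d))
  (B : 'M_(m2, d)) (f : 'M_(d, k)) :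
  ((A + B)%MS *m f == 0) = (A *m f == 0) && (B *m f == 0).
Proof.
apply/eqP/andP => [H|[/eqP Af /eqP Bf]].
  by split; apply/eqP; apply: sub_kills H; rewrite ?addsmxSl ?addsmxSr.
apply: (@sub_kills _ _ _ _ _ _ (col_mx A B)); first by rewrite addsmxE.
by rewrite mul_col_mx Af Bf col_mx0.
Qed.

(** The space [V] has the operator [T] and one subspace [U].  The words below
    write [E] for [V T^2], [X] for [U T^2], [Y] for the intersection of [U] and
    [E], [C1] for [(U and UT) T], [C2] for [(U and VT) T], and [C3] for the
    intersection of [UT] and [E].  If the object has no code, then no family of
    blocks of the shapes considered here has functionals that make it split
    off.  As functionals are solutions of linear systems, each shape yields
    inclusions between these subspaces, and together the inclusions force
    [E = 0]. *)
Section CubeZero.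
Variables (K : fieldType) (D : nat) (T : 'M[K]_D) (F : nat -> 'M[K]_D).
Hypothesis loc : flag_local 2 T F.
Hypothesis F0 : F 0 = 0.
Hypothesis F2 : F 2 = 1%:M.
Hypothesis T3 : T ^+ 3 = 0.
Local Notation U := (F 1).
Local Notation coded := (exists c : code 2, has_code T F c).

Lemma TTT0 m (x : 'M_(m, D)) : x *m T *m T *m T = 0.
Proof. by rewrite -!mulmxA -[T *m (T *m T)]/(T ^+ 3) T3 mulmx0. Qed.

Lemma mulT2 m (x : 'M_(m, D)) : x *m T ^+ 2 = x *m T *m T.
Proof. by rewrite expr2 -mulmxE mulmxA. Qed.

Lemma mx0_scale (v : 'rV[K]_D) : (0 : 'M[K]_1) 0 0 *: v = 0.
Proof. by rewrite mxE scale0r. Qed.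

Lemma mul_retract1 u w (f : 'cV_D) :
  u *m retract T (Block 1 w f) = (u *m f) 0 0 *: w.
Proof. by rewrite mul_retract big_ord1 /= expr0 !mulmx1. Qed.

Lemma mul_retract2 u w (f : 'cV_D) : u *m retract T (Block 2 w f) =
  (u *m T *m f) 0 0 *: w + (u *m f) 0 0 *: (w *m T).
Proof.
by rewrite mul_retract big_ord_recl big_ord1 /= /bump /= !expr0 !expr1 !mulmx1.
Qed.

Lemma mul_retract3 u w (f : 'cV_D) : u *m retract T (Block 3 w f) =
  (u *m T *m T *m f) 0 0 *: w + (u *m T *m f) 0 0 *: (w *m T)
  + (u *m f) 0 0 *: (w *m T *m T).
Proof.
rewrite mul_retract !big_ord_recl big_ord0 /= /bump /=.
by rewrite !expr0 !expr1 !mulT2 !mulmx1 addr0 addrA.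
Qed.

Lemma basis3 v f bs :
  [/\ basis_vector T (Block 3 v f :: bs) v,
      basis_vector T (Block 3 v f :: bs) (v *m T) &
      basis_vector T (Block 3 v f :: bs) (v *m T *m T)].
Proof.
have H k := @basis_head _ _ T (Block 3 v f) bs k.
by split; [have := H 0 isT | have := H 1 isT | have := H 2 isT];
  rewrite /= ?expr0 ?expr1 ?mulT2 ?mulmx1.
Qed.

Lemma block3_wf v f : v *m T *m T *m f = 1%:M -> block_wf T (Block 3 v f).
Proof. by move=> vf; split; rewrite //= ?T3 ?mulmx0 ?mul0mx // /socle /= mulT2. Qed.

(** Only the step [U] of the flag needs attention. *)
Lemma code_of_blocks2 bs : blocks_wf T bs -> bs <> [::] ->
  (sumn [seq bsize b | b <- bs] < 8)%N ->
  (forall u : 'rV_D, (u <= U)%MS ->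
     (u *m block_retract T bs <= small_span T F bs 1)%MS) ->
  coded.
Proof.
move=> wf bs0 lt8 H; apply: (code_of_blocks loc wf bs0 lt8).
case=> [|[|[|//]]] u _; last 1 first.
- by move=> _; apply: small_span_full; rewrite F2 row_full_unit unitmx1.
- by rewrite F0 => /submx0null ->; rewrite mul0mx sub0mx.
- exact: H.
Qed.

Lemma in_span a bs y : small_vector T bs y -> (y <= U)%MS ->
  (a *: y <= small_span T F bs 1)%MS.
Proof. by move=> sy yU; apply/scalemx_sub/small_span_in. Qed.

Lemma in_span_or (u : 'rV_D) (f : 'cV_D) bs y :
  small_vector T bs y -> (u <= U)%MS -> (y <= U)%MS \/ U *m f = 0 ->
  ((u *m f) 0 0 *: y <= small_span T F bs 1)%MS.
Proof.
move=> sy uU [yU|Uf]; first exact: in_span.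
by rewrite (sub_kills uU Uf) mxE scale0r sub0mx.
Qed.

(** A block of size three through [v], linked to a block of size [n.+1] through
    [w] by the vector [v T + w T^n] of [U]; membership of [v], of [v T^2] and of
    the other powers of [w] in [U] is left open.  Only the functional [f] of the
    large block is to be found: on [U], that of the small block is forced to be
    [u |-> f (u T)]. *)
Lemma linked_blocks n (v w : 'rV_D) (R : 'M_D) (f : 'cV_D) :
  (n < 3)%N -> w *m T ^+ n.+1 = 0 -> (T ^+ n.+1 <= R)%MS -> (U *m T <= R)%MS ->
  (v *m T <= R)%MS -> ((v *m T + w *m T ^+ n)%R <= U)%MS ->
  (forall u : 'rV_D, (u <= U)%MS -> (u <= R)%MS -> u *m T *m f = 0) ->
  v *m T *m T *m f = 1%:M ->
  (v <= U)%MS \/ U *m (T *m T *m f) = 0 ->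
  (v *m T *m T <= U)%MS \/ U *m f = 0 ->
  (forall k, (k < n)%N ->
     (w *m T ^+ k <= U)%MS \/ (U *m T ^+ (n - k) <= R)%MS) ->
  coded.
Proof.
move=> n3 wn TR UR vR u0U Rf vf vU vU' wk.
have [z|g [Ug Rg]] := @solve_functional _ _ _ _ U R (U *m T *m f).
  by move=> zR; rewrite !mulmxA Rf // submxMl.
have gU (u : 'rV_D) : (u <= U)%MS -> u *m g = u *m T *m f.
  by case/submxP => z ->; rewrite -mulmxA Ug !mulmxA.
have wnT : w *m T ^+ n *m T = 0 by rewrite mul_expr_succ.
have wg : w *m T ^+ n *m g = 1%:M.
  have := gU _ u0U; rewrite !mulmxDl wnT mul0mx addr0 vf.
  by rewrite (sub_kills vR Rg) add0r.
have vg : v *m T *m T *m g = 0.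
  rewrite (_ : v *m T *m T = (v *m T + w *m T ^+ n) *m T).
    by apply: sub_kills Rg; apply: submx_trans UR; rewrite submxMr.
  by rewrite mulmxDl wnT addr0.
have [b0 b1 b2] := basis3 v f [::].
have bt := @basis_tail _ _ T (Block n.+1 w g) [:: Block 3 v f].
have bh k := @basis_head _ _ T (Block n.+1 w g) [:: Block 3 v f] k.
apply: (@code_of_blocks2 [:: Block n.+1 w g; Block 3 v f]) => //=.
- split; [|by rewrite /socle /= mulT2|by split=> //; apply: block3_wf].
  by split=> //=; apply: sub_kills TR Rg.
- by rewrite addn0 (leq_ltn_trans (leq_add n3 (leqnn 3))).
move=> u uU; rewrite /block_retract !big_cons big_nil addr0 mulmxDr.
rewrite mul_retract3 mul_retract /= big_ord_recr /= subnn expr0 mulmx1.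
rewrite gU //; set c := u *m T *m f; set d := u *m T *m T *m f.
rewrite [X in (X <= _)%MS](_ : _ = \sum_(k < n) (u *m T ^+ (n - k) *m g) 0 0 *: (w *m T ^+ k)
  + d 0 0 *: v + c 0 0 *: (v *m T + w *m T ^+ n) + (u *m f) 0 0 *: (v *m T *m T)).
  rewrite !addmx_sub //.
  - apply: summx_sub => k _; have lt := leq_trans (ltn_ord k) (leqnSn n).
    rewrite -[u *m _ *m g]mulmxA; apply: in_span_or => //; first exact/small1/bh.
    by case: (wk k (ltn_ord k)) => [|UT]; [left | right; rewrite mulmxA (sub_kills UT Rg)].
  - have -> : d = u *m (T *m T *m f) by rewrite !mulmxA.
    by apply: in_span_or => //; apply/small1/bt.
  - by apply: in_span => //; rewrite addrC; apply: small2; [apply: bh | apply: bt].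
  by apply: in_span_or => //; apply/small1/bt.
by rewrite scalerDr !addrA; congr (_ + _); rewrite -!addrA; congr (_ + _);
  rewrite addrC addrA.
Qed.

(** The same shape, with [U] containing [w] and a lift of the socle of the large
    block; now the two functionals agree on [U]. *)
Lemma shifted_blocks (v w : 'rV_D) (f : 'cV_D) :
  w *m T *m T = 0 -> (w <= U)%MS -> ((v *m T *m T + w *m T)%R <= U)%MS ->
  U *m T *m f = 0 ->
  (forall u : 'rV_D, (u <= U)%MS -> (u <= T ^+ 2)%MS -> u *m f = 0) ->
  v *m T *m T *m f = 1%:M ->
  (v <= U)%MS \/ U *m (T *m T *m f) = 0 -> coded.
Proof.
move=> wTT wU u0U UTf Yf vf vU.
have [z|g [Ug Tg]] := @solve_functional _ _ _ _ U (T ^+ 2) (U *m f).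
  by move=> zT; rewrite mulmxA Yf // submxMl.
have gU (u : 'rV_D) : (u <= U)%MS -> u *m g = u *m f.
  by case/submxP => z ->; rewrite -mulmxA Ug mulmxA.
have fUT (u : 'rV_D) : (u <= U)%MS -> u *m T *m f = 0.
  by case/submxP => z ->; rewrite -!mulmxA (mulmxA U) UTf mulmx0.
have vg : v *m T *m T *m g = 0 by rewrite -mulT2 -mulmxA Tg mulmx0.
have wg : w *m T *m g = 1%:M.
  by have := gU _ u0U; rewrite !mulmxDl vg vf fUT // add0r addr0.
have [b0 b1 b2] := basis3 v f [::].
have bt := @basis_tail _ _ T (Block 2 w g) [:: Block 3 v f].
have bh k := @basis_head _ _ T (Block 2 w g) [:: Block 3 v f] k.
apply: (@code_of_blocks2 [:: Block 2 w g; Block 3 v f]) => //=.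
  split; [|by rewrite /socle /= mulT2|by split=> //; apply: block3_wf].
  by split=> //=; rewrite ?mulT2 // /socle /= expr1.
move=> u uU; rewrite /block_retract !big_cons big_nil addr0 mulmxDr.
rewrite mul_retract3 mul_retract2 (gU u) // (fUT u) // mx0_scale addr0.
rewrite [X in (X <= _)%MS](_ : _ = (u *m T *m g) 0 0 *: w + (u *m T *m T *m f) 0 0 *: v
  + (u *m f) 0 0 *: (v *m T *m T + w *m T)).
  rewrite !addmx_sub //.
  - by apply: in_span => //; have := small1 (bh 0 isT); rewrite expr0 mulmx1.
  - have -> : u *m T *m T *m f = u *m (T *m T *m f) by rewrite !mulmxA.
    by apply: in_span_or => //; apply/small1/bt.
  apply: in_span => //; apply: small2; first exact: bt.
  by have := bh 1 isT; rewrite expr1.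
by rewrite scalerDr -!addrA; congr (_ + _); rewrite addrC -!addrA.
Qed.

(** For the summands with two blocks of size three: [h] separates the socle of
    the block of [v1] from the subspace that links the two blocks, and the
    functionals of the blocks are [f1] and [f1 - h]. *)
Lemma split_functional (h : 'cV_D) :
  (forall u : 'rV_D, (u <= U)%MS -> (u *m T *m T <= U)%MS -> u *m T *m T = 0) ->
  exists f1 : 'cV_D, U *m f1 = 0 /\
    forall u : 'rV_D, (u <= U)%MS -> u *m T *m T *m f1 = u *m T *m T *m h.
Proof.
move=> XU; have [z|f1 [Uf UUf]] :=
  @solve_functional _ _ _ _ (U *m T *m T) U (U *m T *m T *m h).
  by rewrite !mulmxA => /(XU _ (submxMl z U)) ->; rewrite mul0mx.
exists f1; split=> // u /submxP[z ->].
by move/(congr1 (mulmx z)): Uf; rewrite !mulmxA.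
Qed.

Section TwoBlocks.
Variables (v1 v2 : 'rV[K]_D) (h : 'cV[K]_D).
Hypothesis XU : forall u : 'rV_D,
  (u <= U)%MS -> (u *m T *m T <= U)%MS -> u *m T *m T = 0.
Hypothesis v1U : (v1 <= U)%MS.
Hypothesis v2U : (v2 *m T *m T <= U)%MS.
Hypothesis vh : (v1 + v2) *m T *m T *m h = 0.
Hypothesis v1h : v1 *m T *m T *m h = 1%:M.

(** Two blocks of length three, with [v1], [v2 T^2] and [(v1 + v2) T] in [U]. *)
Lemma two_blocks_linked :
  U *m T *m h = 0 -> (((v1 + v2) *m T)%R <= U)%MS -> coded.
Proof.
move=> UTh vTU; have [f1 [Uf1 f1h]] := split_functional h XU.
have hUT (u : 'rV_D) : (u <= U)%MS -> u *m T *m h = 0.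
  by case/submxP => z ->; rewrite -!mulmxA (mulmxA U) UTh mulmx0.
have e1f1 : v1 *m T *m T *m f1 = 1%:M by rewrite f1h.
have e2f1 : v2 *m T *m T *m f1 = 0 by rewrite (sub_kills v2U).
have e2h : v2 *m T *m T *m h = - 1%:M.
  by apply/eqP; rewrite -addr_eq0 addrC -v1h -!mulmxDl vh.
have [b0 b1 b2] := basis3 v1 f1 [::].
have bt := @basis_tail _ _ T (Block 3 v2 (f1 - h)) [:: Block 3 v1 f1].
have [c0 c1 c2] := basis3 v2 (f1 - h) [:: Block 3 v1 f1].
apply: (@code_of_blocks2 [:: Block 3 v2 (f1 - h); Block 3 v1 f1]) => //=.
  split; last by split=> //; apply: block3_wf.
    by apply: block3_wf; rewrite mulmxBr e2f1 e2h sub0r opprK.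
  by rewrite /socle /= mulT2 mulmxBr e1f1 v1h subrr.
move=> u uU; rewrite /block_retract !big_cons big_nil addr0 mulmxDr.
rewrite !mul_retract3 !mulmxBr (hUT u) // (f1h u) // subrr subr0.
rewrite (sub_kills uU Uf1) !mx0_scale add0r addr0.
rewrite [X in (X <= _)%MS](_ : _ = (u *m T *m f1) 0 0 *: ((v1 + v2) *m T)
  + (u *m T *m T *m h) 0 0 *: v1 + (0 - u *m h) 0 0 *: (v2 *m T *m T)).
  rewrite !addmx_sub //; apply: in_span => //.
  - by rewrite mulmxDl; apply: small2; [apply: bt|].
  - exact/small1/bt.
  exact/small1.
by rewrite mulmxDl scalerDr [LHS](AC (2*2)%AC (4*1*3*2)%AC).
Qed.

(** The same two blocks with a third one, of length one, that corrects the link: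
    [(v1 + v2) T + y] lies in [U]. *)
Lemma two_blocks_linked_end y : y *m T = 0 -> U *m T *m h = 0 ->
  (((v1 + v2) *m T + y)%R <= U)%MS ->
  (forall u : 'rV_D, (u <= U)%MS -> (u <= T)%MS ->
    exists2 u' : 'rV_D, (u' <= U)%MS /\ (u' *m T *m T <= U *m T)%MS &
      ((u *m T - u' *m T *m T)%R <= U)%MS) ->
  coded.
Proof.
move=> yT UTh vTU C2; have [f1 [Uf1 f1h]] := split_functional h XU.
have hUT (u : 'rV_D) : (u <= U)%MS -> u *m T *m h = 0.
  by case/submxP => z ->; rewrite -!mulmxA (mulmxA U) UTh mulmx0.
have e1f1 : v1 *m T *m T *m f1 = 1%:M by rewrite f1h.
have e2f1 : v2 *m T *m T *m f1 = 0 by rewrite (sub_kills v2U).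
have e2h : v2 *m T *m T *m h = - 1%:M.
  by apply/eqP; rewrite -addr_eq0 addrC -v1h -!mulmxDl vh.
have [z|g [Ug Tg]] := @solve_functional _ _ _ _ U T (U *m T *m f1).
  move=> zT; have [u' [u'U u'T]] := C2 _ (submxMl z U) zT.
  move/sub_kills/(_ Uf1)/eqP; rewrite mulmxBl subr_eq0 !mulmxA => /eqP ->.
  by rewrite f1h // (sub_kills u'T).
have gU (u : 'rV_D) : (u <= U)%MS -> u *m g = u *m T *m f1.
  by case/submxP => z ->; rewrite -mulmxA Ug !mulmxA.
have gT (u : 'rV_D) : u *m T *m g = 0 by rewrite -mulmxA Tg mulmx0.
have yg : y *m g = 1%:M.
  have := gU _ vTU; rewrite !mulmxDl yT !gT e1f1 e2f1 mul0mx !addr0.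
  by rewrite add0r.
have [b0 b1 b2] := basis3 v1 f1 [::].
set bs2 := [:: Block 3 v2 (f1 - h); Block 3 v1 f1].
have bt u : basis_vector T [:: Block 3 v1 f1] u ->
    basis_vector T (Block 1 y g :: bs2) u.
  by move=> bu; do 2!apply: basis_tail.
have [c0 c1 c2] := basis3 v2 (f1 - h) [:: Block 3 v1 f1].
have bt' := @basis_tail _ _ T (Block 1 y g) bs2.
have bh : basis_vector T (Block 1 y g :: bs2) y.
  by have := @basis_head _ _ T (Block 1 y g) bs2 0 isT; rewrite expr0 mulmx1.
apply: (@code_of_blocks2 (Block 1 y g :: bs2)) => //=.
  split; first by split=> //=; rewrite ?expr1 // /socle /= expr0 mulmx1.
    by rewrite /socle /= !mulT2 !gT.
  split; last by split=> //; apply: block3_wf.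
    by apply: block3_wf; rewrite mulmxBr e2f1 e2h sub0r opprK.
  by rewrite /socle /= mulT2 mulmxBr e1f1 v1h subrr.
move=> u uU; rewrite /block_retract !big_cons big_nil addr0 !mulmxDr.
rewrite mul_retract1 !mul_retract3 !mulmxBr (hUT u) // (f1h u) // subrr subr0.
rewrite (sub_kills uU Uf1) !mx0_scale add0r addr0 (gU u) //.
rewrite [X in (X <= _)%MS](_ : _ = (u *m T *m f1) 0 0 *: ((v1 + v2) *m T + y)
  + (u *m T *m T *m h) 0 0 *: v1 + (0 - u *m h) 0 0 *: (v2 *m T *m T)).
  rewrite !addmx_sub //; apply: in_span => //.
  - by rewrite mulmxDl; apply: small3 => //; [apply: bt|apply: bt'].
  - exact/small1/bt.
  exact/small1/bt'.
by rewrite mulmxDl !scalerDr [LHS](AC (1*(2*2))%AC (5*2*1*4*3)%AC).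
Qed.

(** The block of length one gives a second link: [v1 T + y] lies in [U] too. *)
Lemma two_blocks_linked_twice y : y *m T = 0 ->
  (((v1 + v2) *m T)%R <= U)%MS -> ((v1 *m T + y)%R <= U)%MS ->
  (forall u : 'rV_D, (u <= U)%MS -> (u <= T)%MS -> u *m T *m h = 0) ->
  coded.
Proof.
move=> yT vTU vyU C2; have [f1 [Uf1 f1h]] := split_functional h XU.
have e1f1 : v1 *m T *m T *m f1 = 1%:M by rewrite f1h.
have e2f1 : v2 *m T *m T *m f1 = 0 by rewrite (sub_kills v2U).
have e2h : v2 *m T *m T *m h = - 1%:M.
  by apply/eqP; rewrite -addr_eq0 addrC -v1h -!mulmxDl vh.
have [z|g [Ug Tg]] := @solve_functional _ _ _ _ U T (U *m T *m h).
  by move=> zT; rewrite !mulmxA C2 // submxMl.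
have gU (u : 'rV_D) : (u <= U)%MS -> u *m g = u *m T *m h.
  by case/submxP => z ->; rewrite -mulmxA Ug !mulmxA.
have gT (u : 'rV_D) : u *m T *m g = 0 by rewrite -mulmxA Tg mulmx0.
have yg : y *m g = 1%:M.
  by have := gU _ vyU; rewrite !mulmxDl yT mul0mx addr0 gT v1h add0r.
have [b0 b1 b2] := basis3 v1 f1 [::].
set bs2 := [:: Block 3 v2 (f1 - h); Block 3 v1 f1].
have bt u : basis_vector T [:: Block 3 v1 f1] u ->
    basis_vector T (Block 1 y g :: bs2) u.
  by move=> bu; do 2!apply: basis_tail.
have [c0 c1 c2] := basis3 v2 (f1 - h) [:: Block 3 v1 f1].
have bt' := @basis_tail _ _ T (Block 1 y g) bs2.
have bh : basis_vector T (Block 1 y g :: bs2) y.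
  by have := @basis_head _ _ T (Block 1 y g) bs2 0 isT; rewrite expr0 mulmx1.
apply: (@code_of_blocks2 (Block 1 y g :: bs2)) => //=.
  split; first by split=> //=; rewrite ?expr1 // /socle /= expr0 mulmx1.
    by rewrite /socle /= !mulT2 !gT.
  split; last by split=> //; apply: block3_wf.
    by apply: block3_wf; rewrite mulmxBr e2f1 e2h sub0r opprK.
  by rewrite /socle /= mulT2 mulmxBr e1f1 v1h subrr.
move=> u uU; rewrite /block_retract !big_cons big_nil addr0 !mulmxDr.
rewrite mul_retract1 !mul_retract3 !mulmxBr (f1h u) // subrr.
rewrite (sub_kills uU Uf1) !mx0_scale add0r addr0 (gU u) //.
rewrite [X in (X <= _)%MS](_ : _ = (u *m T *m f1 - u *m T *m h) 0 0 *: ((v1 + v2) *m T)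
  + (u *m T *m h) 0 0 *: (v1 *m T + y)
  + (u *m T *m T *m h) 0 0 *: v1 + (0 - u *m h) 0 0 *: (v2 *m T *m T)).
  rewrite !addmx_sub //; apply: in_span => //.
  - by rewrite mulmxDl; apply: small2 => //; [apply: bt|apply: bt'].
  - by apply: small2 => //; apply: bt.
  - exact/small1/bt.
  exact/small1/bt'.
have -> : (u *m T *m f1) 0 0 = (u *m T *m f1 - u *m T *m h) 0 0 + (u *m T *m h) 0 0.
  by rewrite [in RHS]mxE [X in _ + X + _]mxE subrK.
rewrite mulmxDl !scalerDr scalerDl.
by rewrite [LHS](AC (1*(2*(1*2)))%AC (5*2*(6*1)*4*3)%AC).
Qed.

End TwoBlocks.

Section Exhaustion.
Hypothesis NC : ~ coded.

Lemma Fmono2 i j : (i <= j <= 2)%N -> (F i <= F j)%MS.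
Proof.
case: i j => [|[|[|i]]] [|[|[|j]]] //=; rewrite ?andbF //=.
all: by rewrite ?F0 ?F2 ?sub0mx ?submx1 ?submx_refl.
Qed.

(** What it means that no block of length three splits off, when [x], [x T] and
    [x T^2] are placed in steps [a], [b], [c] of the flag. *)
Lemma single3 a b c (x : 'rV_D) :
  (0 < a <= 2)%N -> (0 < b <= 2)%N -> (0 < c <= 2)%N ->
  (x <= F a)%MS -> (x *m T <= F b)%MS -> (x *m T *m T <= F c)%MS ->
  (x *m T *m T <= F a.-1 *m T *m T + F b.-1 *m T + F c.-1)%MS.
Proof.
move=> ha hb hc xa xb xc; apply/contraT => nx; case: NC.
apply: (@single_block _ 2 _ _ _ loc Fmono2 3 (fun k => nth c [:: a; b] k) x) => //.
- by rewrite T3 mulmx0.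
- by case=> [|[|[|//]]] _; rewrite ?expr0 ?mulmx1 ?expr1 ?mulT2.
rewrite T3 adds0mx_id !big_ord_recl big_ord0 /= /bump /= addsmx0_id !expr0 !expr1.
rewrite !mulT2 mulmx1; apply: contraNN nx => /submx_trans; apply.
by rewrite addsmxA.
Qed.

(** What the linked blocks give when [v] is taken in [U]: the inclusions say that
    no functional as required by [linked_blocks] exists. *)
Lemma linked_in n (v w : 'rV_D) (R : 'M_D) :
  (n < 3)%N -> w *m T ^+ n.+1 = 0 -> (T ^+ n.+1 <= R)%MS -> (U *m T <= R)%MS ->
  (v *m T <= R)%MS -> ((v *m T + w *m T ^+ n)%R <= U)%MS ->
  (forall k, (k < n)%N ->
     (w *m T ^+ k <= U)%MS \/ (U *m T ^+ (n - k) <= R)%MS) ->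
  (v <= U)%MS ->
  (v *m T *m T <= (U :&: R)%MS *m T + U)%MS /\
  ((v *m T *m T <= U)%MS -> (v *m T *m T <= (U :&: R)%MS *m T)%MS).
Proof.
move=> n3 wn TR UR vR u0U wk vU; split.
  apply/contraT => /separate[f [/eqP Nf vf]]; case: NC.
  move: Nf; rewrite addsmx_mul_eq0 => /andP[/eqP Rf /eqP Uf].
  apply: (linked_blocks n3 wn TR UR vR u0U _ vf _ _ wk); [|by left|by right].
  move=> u uU uR; apply: sub_kills Rf.
  by rewrite submxMr // sub_capmx uU.
move=> vU'; apply/contraT => /separate[f [Rf vf]]; case: NC.
apply: (linked_blocks n3 wn TR UR vR u0U _ vf _ _ wk); [|by left|by left].
by move=> u uU uR; apply: sub_kills Rf; rewrite submxMr // sub_capmx uU.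
Qed.

(** The same for [v] outside [U], where the functional must also kill [X]. *)
Lemma linked_out n (v w : 'rV_D) (R : 'M_D) :
  (n < 3)%N -> w *m T ^+ n.+1 = 0 -> (T ^+ n.+1 <= R)%MS -> (U *m T <= R)%MS ->
  (v *m T <= R)%MS -> ((v *m T + w *m T ^+ n)%R <= U)%MS ->
  (forall k, (k < n)%N ->
     (w *m T ^+ k <= U)%MS \/ (U *m T ^+ (n - k) <= R)%MS) ->
  (v *m T *m T <= (U :&: R)%MS *m T + U *m T *m T + U)%MS /\
  ((v *m T *m T <= U)%MS ->
   (v *m T *m T <= (U :&: R)%MS *m T + U *m T *m T)%MS).
Proof.
move=> n3 wn TR UR vR u0U wk; split.
  apply/contraT => /separate[f [/eqP Nf vf]]; case: NC.
  move: Nf; rewrite !addsmx_mul_eq0 => /andP[/andP[/eqP Rf /eqP Uf] /eqP Uf'].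
  apply: (linked_blocks n3 wn TR UR vR u0U _ vf _ _ wk).
  - by move=> u uU uR; apply: sub_kills Rf; rewrite submxMr // sub_capmx uU.
  - by right; rewrite !mulmxA.
  by right.
move=> vU'; apply/contraT => /separate[f [/eqP Nf vf]]; case: NC.
move: Nf; rewrite !addsmx_mul_eq0 => /andP[/eqP Rf /eqP Uf].
apply: (linked_blocks n3 wn TR UR vR u0U _ vf _ _ wk).
- by move=> u uU uR; apply: sub_kills Rf; rewrite submxMr // sub_capmx uU.
- by right; rewrite !mulmxA.
by left.
Qed.

Lemma mem_mul m (A : 'M[K]_(m, D)) (B : 'M_D) (e : 'rV_D) : (e <= A *m B)%MS ->
  exists2 a : 'rV_D, (a <= A)%MS & e = a *m B.
Proof. by case/submxP=> z ->; exists (z *m A); rewrite ?submxMl ?mulmxA. Qed.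

Lemma mem_adds m1 m2 (A : 'M[K]_(m1, D)) (B : 'M_(m2, D)) (e : 'rV_D) :
  (e <= A + B)%MS ->
  exists a b : 'rV_D, [/\ (a <= A)%MS, (b <= B)%MS & e = a + b].
Proof.
by case/sub_addsmxP=> -[a b] /= ->; exists (a *m A), (b *m B); rewrite !submxMl.
Qed.

Lemma sub1F2 (x : 'rV[K]_D) : (x <= F 2)%MS.
Proof. by rewrite F2 submx1. Qed.

Let s12 x xU := @single3 1 2 2 x isT isT isT xU (sub1F2 _) (sub1F2 _).

Lemma U_UT (x : 'rV_D) : (x <= U)%MS -> (x *m T *m T <= U *m T + U)%MS.
Proof. by move/s12; rewrite /= F0 !mul0mx adds0mx_id. Qed.

Lemma E_UT (x : 'rV_D) : (x *m T *m T <= U *m T + U)%MS.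
Proof.
have := @single3 2 2 2 x isT isT isT (sub1F2 _) (sub1F2 _) (sub1F2 _).
move/submx_trans; apply; rewrite -addsmxA addsmx_sub submx_refl andbT.
by apply/row_subP => k; rewrite -mulmxA row_mul mulmxA U_UT ?row_sub.
Qed.

(** [C1 = 0]. *)
Lemma C1_0 (x : 'rV_D) : (x <= U)%MS -> (x *m T <= U)%MS -> x *m T *m T = 0.
Proof.
move=> xU xTU; have := @single3 1 1 2 x isT isT isT xU xTU (sub1F2 _).
rewrite /= F0 !mul0mx !adds0mx_id => xTTU.
have := @single3 1 1 1 x isT isT isT xU xTU xTTU.
by rewrite /= F0 !mul0mx !adds0mx_id => /submx0null.
Qed.

(** [X] and [Y] meet inside [UT], [Y] lies in [X + UT], [C2] lies in [X + U], and
    [C2] and [Y] meet inside [X]. *)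
Lemma XY_C3 (x : 'rV_D) :
  (x <= U)%MS -> (x *m T *m T <= U)%MS -> (x *m T *m T <= U *m T)%MS.
Proof.
move=> xU xTTU; have := @single3 1 2 1 x isT isT isT xU (sub1F2 _) xTTU.
by rewrite /= F0 !mul0mx adds0mx_id => /submx_trans; apply; rewrite addsmx_sub submx_refl sub0mx.
Qed.

Lemma Y_C3X (x : 'rV_D) :
  (x *m T *m T <= U)%MS -> (x *m T *m T <= U *m T *m T + U *m T)%MS.
Proof.
move=> xTTU; have := @single3 2 2 1 x isT isT isT (sub1F2 _) (sub1F2 _) xTTU.
by rewrite /= F0 => /submx_trans; apply; rewrite addsmx_sub submx_refl sub0mx.
Qed.

Lemma C2_XY (x : 'rV_D) :
  (x *m T <= U)%MS -> (x *m T *m T <= U *m T *m T + U)%MS.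
Proof.
move=> xTU; have := @single3 2 1 2 x isT isT isT (sub1F2 _) xTU (sub1F2 _).
by rewrite /= F0 mul0mx => /submx_trans; apply; rewrite addsmxS // addsmx_sub submx_refl sub0mx.
Qed.

Lemma C2Y_X (x : 'rV_D) :
  (x *m T <= U)%MS -> (x *m T *m T <= U)%MS -> (x *m T *m T <= U *m T *m T)%MS.
Proof.
move=> xTU xTTU; have := @single3 2 1 1 x isT isT isT (sub1F2 _) xTU xTTU.
by rewrite /= F0 mul0mx => /submx_trans; apply; rewrite !addsmx_sub submx_refl !sub0mx.
Qed.

Lemma T3_sub m (R : 'M_(m, D)) : (T ^+ 3 <= R)%MS.
Proof. by rewrite T3 sub0mx. Qed.

Lemma capU_0 (R : 'M_D) : (forall u : 'rV_D, (u <= U)%MS -> (u <= R)%MS ->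
  u *m T = 0) -> (U :&: R)%MS *m T = 0.
Proof.
move=> H; apply/row_matrixP => k; rewrite row_mul row0; apply: H.
  by apply: submx_trans (row_sub _ _) (capmxSl _ _).
by apply: submx_trans (row_sub _ _) (capmxSr _ _).
Qed.

(** A vector [u = a T + b T^2] of [U], with [a] and [b] in [U], links a block
    through [a] to one through [b]; if [a T^2] were not zero, [C1 = 0] would leave
    no obstruction to splitting them off. *)
Lemma theta_in (u : 'rV_D) : (u <= U)%MS ->
  (u <= U *m T + U *m T *m T)%MS -> u *m T = 0.
Proof.
move=> uU /mem_adds[_ [_ [/mem_mul[a aU ->] /mem_mul[_ /mem_mul[b bU ->] ->] e]]].
have -> : u *m T = a *m T *m T by rewrite e mulmxDl TTT0 addr0.
have C : (U :&: (U *m T))%MS *m T = 0.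
  apply: capU_0 => z zU /mem_mul[z' z'U ez]; rewrite ez in zU *.
  exact: C1_0.
have [|||||H1 H2] := @linked_in 2 a b (U *m T) isT _ (T3_sub _) _ _ _ _ aU.
- by rewrite T3 mulmx0.
- by [].
- by rewrite submxMr.
- by rewrite mulT2 -e.
- case=> [|[|//]] _; [left|right]; last by rewrite expr1.
  by rewrite expr0 mulmx1.
by move: H1 H2; rewrite C adds0mx_id => H1 /(_ H1)/submx0null.
Qed.

(** The second generator is now arbitrary, which is possible because the
    obstruction has been removed by [theta_in]. *)
Lemma theta_out (u : 'rV_D) : (u <= U)%MS ->
  (u <= U *m T + T ^+ 2)%MS -> u *m T = 0.
Proof.
move=> uU /mem_adds[_ [_ [/mem_mul[a aU ->] /submxP[z ->] e]]].
rewrite mulT2 in e.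
have -> : u *m T = a *m T *m T by rewrite e mulmxDl TTT0 addr0.
have C : (U :&: (U *m T + U *m T *m T))%MS *m T = 0 by apply: capU_0 theta_in.
have [|||||H1 H2] := @linked_in 2 a z (U *m T + U *m T *m T)%MS isT _ (T3_sub _) _ _ _ _ aU.
- by rewrite T3 mulmx0.
- exact: addsmxSl.
- by apply: submx_trans (addsmxSl _ _); rewrite submxMr.
- by rewrite mulT2 -e.
- case=> [|[|//]] _; right; rewrite /= ?expr1 ?mulT2; [exact: addsmxSr|exact: addsmxSl].
by move: H1 H2; rewrite C adds0mx_id => H1 /(_ H1)/submx0null.
Qed.

(** [X] and [C2] meet trivially, by a block of length two linked to one of length
    three. *)
Lemma XC2_0 (v z : 'rV_D) : (v <= U)%MS -> (z *m T <= U)%MS ->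
  z *m T *m T = v *m T *m T -> v *m T *m T = 0.
Proof.
move=> vU zTU e.
have C : (U :&: (U *m T + T ^+ 2))%MS *m T = 0 by apply: capU_0 theta_out.
have [||||||H1 H2] := @linked_in 1 v (z - v) (U *m T + T ^+ 2)%MS isT _ _ _ _ _ _ vU.
- by rewrite mulT2 !mulmxBl e subrr.
- exact: addsmxSr.
- exact: addsmxSl.
- by apply: submx_trans (addsmxSl _ _); rewrite submxMr.
- by rewrite expr1 mulmxBl addrC subrK.
- by case=> // _; right; rewrite expr1 addsmxSl.
by move: H1 H2; rewrite C adds0mx_id => H1 /(_ H1)/submx0null.
Qed.

(** [Y] and [C2] meet trivially. *)
Lemma YC2_0 (z : 'rV_D) : (z *m T <= U)%MS -> (z *m T *m T <= U)%MS ->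
  z *m T *m T = 0.
Proof.
move=> zTU zTTU; have /mem_mul[_ /mem_mul[v vU ->] e] := C2Y_X zTU zTTU.
by rewrite e (XC2_0 vU zTU e).
Qed.

Lemma capUT (e : 'rV_D) : (e <= (U :&: T)%MS *m T)%MS ->
  exists2 z : 'rV_D, (z *m T <= U)%MS & e = z *m T *m T.
Proof.
case/mem_mul=> u; rewrite sub_capmx => /andP[uU /submxP[z eu]] ->.
by exists z; rewrite -?eu.
Qed.

Lemma C3_in (v a : 'rV_D) : (v <= U)%MS -> (a <= U)%MS -> a *m T = v *m T *m T ->
  (v *m T *m T <= (U :&: T)%MS *m T + U)%MS /\
  ((v *m T *m T <= U)%MS -> (v *m T *m T <= (U :&: T)%MS *m T)%MS).
Proof.
move=> vU aU e; apply: (@linked_in 0 v (a - v *m T)) => //; rewrite ?submxMl //.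
- by rewrite expr1 mulmxBl e subrr.
- by rewrite expr0 mulmx1 addrC subrK.
Qed.

Lemma C3_out (v a : 'rV_D) : (a <= U)%MS -> a *m T = v *m T *m T ->
  (v *m T *m T <= (U :&: T)%MS *m T + U *m T *m T + U)%MS /\
  ((v *m T *m T <= U)%MS ->
   (v *m T *m T <= (U :&: T)%MS *m T + U *m T *m T)%MS).
Proof.
move=> aU e; apply: (@linked_out 0 v (a - v *m T)) => //; rewrite ?submxMl //.
- by rewrite expr1 mulmxBl e subrr.
- by rewrite expr0 mulmx1 addrC subrK.
Qed.

(** [X] and [Y] meet trivially: an element of both is in [C3], so the block of
    length three is linked to one of length one. *)
Lemma XY_0 (v : 'rV_D) : (v <= U)%MS -> (v *m T *m T <= U)%MS -> v *m T *m T = 0.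
Proof.
move=> vU vTTU; have /mem_mul[a aU e] := XY_C3 vU vTTU.
have [_ /(_ vTTU)/capUT[z zTU ez]] := C3_in vU aU (esym e).
exact: XC2_0 vU zTU (esym ez).
Qed.

(** Every generator [x] of a block of length three has a partner [w] as in
    [shifted_blocks]. *)
Lemma shift_w (x : 'rV_D) : exists w : 'rV_D,
  [/\ w *m T *m T = 0, (w <= U)%MS & ((x *m T *m T + w *m T)%R <= U)%MS].
Proof.
have /mem_adds[_ [u [/mem_mul[a aU ->] uU e]]] := E_UT x.
have eu : u = - a *m T + x *m T *m T by rewrite e mulNmx addKr.
exists (- a); rewrite eqmx_opp [_ + - a *m T]addrC -eu; split=> //.
have := theta_out uU; rewrite {2}eu mulmxDl TTT0 addr0; apply.
by rewrite eu -mulT2 addmx_sub_adds ?submxMl // submxMr // eqmx_opp.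
Qed.

Lemma E_dec (x : 'rV_D) : (x *m T *m T <= U *m T + U *m T *m T + (U :&: T ^+ 2))%MS.
Proof.
have [w [wTT wU xwU]] := shift_w x; apply/contraT => /separate[f [/eqP Nf xf]].
case: NC; move: Nf; rewrite !addsmx_mul_eq0 => /andP[/andP[/eqP f1 /eqP f2] /eqP f3].
apply: (shifted_blocks wTT wU xwU f1 _ xf); last by right; rewrite !mulmxA.
by move=> u uU uT; apply: sub_kills f3; rewrite sub_capmx uU.
Qed.

Lemma X_dec (x : 'rV_D) : (x <= U)%MS ->
  (x *m T *m T <= U *m T + (U :&: T ^+ 2))%MS.
Proof.
move=> xU; have [w [wTT wU xwU]] := shift_w x.
apply/contraT => /separate[f [/eqP Nf xf]].
case: NC; move: Nf; rewrite !addsmx_mul_eq0 => /andP[/eqP f1 /eqP f3].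
apply: (shifted_blocks wTT wU xwU f1 _ xf); last by left.
by move=> u uU uT; apply: sub_kills f3; rewrite sub_capmx uU.
Qed.

Lemma mem_Y (y : 'rV_D) : (y <= U :&: T ^+ 2)%MS ->
  (y <= U)%MS /\ exists z, y = z *m T *m T.
Proof. by rewrite sub_capmx => /andP[yU /submxP[z e]]; split=> //; exists z; rewrite e mulT2. Qed.

(** [E] is the sum of [X] and [Y]. *)
Lemma E_XY (x : 'rV_D) : exists b y : 'rV_D,
  [/\ (b <= U)%MS, (y <= U)%MS & x *m T *m T = b *m T *m T + y].
Proof.
have : (x *m T *m T <= U *m T + (U :&: T ^+ 2))%MS.
  apply: submx_trans (E_dec x) _; rewrite !addsmx_sub addsmxSl addsmxSr andbT /=.
  by apply/row_subP => k; rewrite -mulmxA row_mul mulmxA X_dec ?row_sub.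
case/mem_adds=> _ [y [/mem_mul[a aU ->] /mem_Y[yU [z ez]] e]].
have ea : a *m T = (x - z) *m T *m T by rewrite !mulmxBl e ez addrK.
have [+ _] := C3_out aU ea; rewrite -ea => aT.
have : (a *m T <= U *m T *m T + U)%MS.
  apply: submx_trans aT _; rewrite !addsmx_sub addsmxSl addsmxSr !andbT.
  by apply/row_subP => k; have /capUT[z' z'U ->] := row_sub k ((U :&: T)%MS *m T); apply: C2_XY.
case/mem_adds=> _ [u [/mem_mul[_ /mem_mul[b bU ->] ->] uU eu]].
by exists b, (u + y); rewrite bU addmx_sub // e eu addrA.
Qed.

(** The projection of [C2] to [X] along [Y] lies in [C3]: a functional that
    separates it from [UT] would split off two linked blocks. *)
Lemma prX_C2 (z b y : 'rV_D) : (z *m T <= U)%MS -> (b <= U)%MS -> (y <= U)%MS ->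
  z *m T *m T = b *m T *m T + y -> (b *m T *m T <= U *m T)%MS.
Proof.
move=> zTU bU yU e; apply/contraT => /separate[h [UTh bh]]; case: NC.
apply: (@two_blocks_linked b (z - b) h XY_0 bU _ _ bh UTh); rewrite ?[b + _]addrC ?subrK //.
  by rewrite !mulmxBl e [_ + y]addrC addrK.
by apply: sub_kills UTh; rewrite submxMr.
Qed.

(** The projection of [C3] to [X] along [Y] lies in [C3]. *)
Lemma prX_C3 (z a b y : 'rV_D) : (a <= U)%MS -> a *m T = z *m T *m T ->
  (b <= U)%MS -> (y <= U)%MS ->
  z *m T *m T = b *m T *m T + y -> (b *m T *m T <= U *m T)%MS.
Proof.
move=> aU ea bU yU e; apply/contraT => /separate[h [UTh bh]]; case: NC.
apply: (@two_blocks_linked_end b (z - b) h XY_0 bU _ _ bh (a - z *m T)) => //.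
- by rewrite !mulmxBl e [_ + y]addrC addrK.
- by rewrite [b + _]addrC subrK -ea; apply: sub_kills UTh; rewrite submxMr.
- by rewrite mulmxBl ea subrr.
- by rewrite [b + _]addrC subrK [_ *m T + _]addrC subrK.
move=> u uU /submxP[z' eu]; have [b' [y' [b'U y'U e']]] := E_XY z'.
exists b'; first by split=> //; apply: (prX_C2 _ b'U y'U e'); rewrite -eu.
by rewrite eu e' addrC addKr.
Qed.

(** An element of [X] is a sum of elements of [C3] and [Y], hence is the projection
    of an element of [C3]. *)
Lemma X_UT (b : 'rV_D) : (b <= U)%MS -> (b *m T *m T <= U *m T)%MS.
Proof.
move=> bU; have /mem_adds[_ [y [/mem_mul[a aU ->] /mem_Y[yU [z ez]] e]]] := X_dec bU.
have ea : a *m T = (b - z) *m T *m T by rewrite !mulmxBl e ez addrK.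
apply: (prX_C3 aU ea bU (_ : (- y <= U)%MS)); first by rewrite eqmx_opp.
by rewrite !mulmxBl ez.
Qed.

(** [C2 = 0]: now that [X] lies in [UT], the blocks linked twice are available,
    and the projection of [C2] to [X] must lie in [C2]. *)
Lemma C2_0 (z : 'rV_D) : (z *m T <= U)%MS -> z *m T *m T = 0.
Proof.
move=> zTU; have [b [y [bU yU e]]] := E_XY z.
have bC2 : (b *m T *m T <= (U :&: T)%MS *m T)%MS.
  apply/contraT => /separate[h [Ch bh]]; case: NC.
  have /mem_mul[a aU ea] := X_UT bU.
  apply: (@two_blocks_linked_twice b (z - b) h XY_0 bU _ _ bh (a - b *m T)).
  - by rewrite !mulmxBl e [_ + y]addrC addrK.
  - rewrite [b + _]addrC subrK; apply: sub_kills Ch.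
    by rewrite submxMr // sub_capmx zTU submxMl.
  - by rewrite mulmxBl ea subrr.
  - by rewrite [b + _]addrC subrK.
  - by rewrite [_ *m T + _]addrC subrK.
  by move=> u uU uT; apply: sub_kills Ch; rewrite submxMr // sub_capmx uU.
have [z' z'TU e'] := capUT bC2.
rewrite (XC2_0 bU z'TU (esym e')) add0r in e.
by apply: YC2_0 zTU _; rewrite e.
Qed.

Lemma capUT_0 : (U :&: T)%MS *m T = 0.
Proof. by apply: capU_0 => u uU /submxP[z ez]; rewrite ez in uU *; apply: C2_0. Qed.

Lemma X_0 (b : 'rV_D) : (b <= U)%MS -> b *m T *m T = 0.
Proof.
move=> bU; have /mem_mul[a aU ea] := X_UT bU.
by have [H _] := C3_in bU aU (esym ea); rewrite capUT_0 adds0mx_id in H; apply: XY_0.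
Qed.

(** The blocks linked to one of length one, with [C2 = 0], give [X = 0] and then
    [Y = 0]; but [E] is their sum. *)
Lemma T2_0 : T ^+ 2 = 0.
Proof.
have UTT : U *m T *m T = 0.
  by apply/row_matrixP => k; rewrite row0 -mulmxA row_mul mulmxA X_0 ?row_sub.
apply/row_matrixP => k; rewrite row0 rowE mulT2; move: (delta_mx _ _) => x.
have [b [y [bU yU e]]] := E_XY x; rewrite (X_0 bU) add0r in e; rewrite -e in yU.
have := Y_C3X yU; rewrite UTT adds0mx_id => /mem_mul[a aU ea].
have [_ /(_ yU)] := C3_out aU (esym ea).
by rewrite UTT capUT_0 adds0mx_id => /submx0null.
Qed.

End Exhaustion.

Lemma code_of_cube_zero : (0 < D)%N -> coded.
Proof.
move=> D0; apply: contrapT => NC.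
by case: (NC); apply: (code_of_square_zero loc F0 F2 Fmono2 D0 (T2_0 NC)).
Qed.

End CubeZero.

(** * Chains of spaces with an operator on the last one *)

Section Chains.
Variables (K : fieldType) (q : nat).

(** The spaces [V_0, ..., V_q] are the images of the idempotents [E i] of their
    sum, [S] contains all the maps from [V_i] to [V_i.+1], and [T] acts on
    [V_q]. *)
Record chain d (E : nat -> 'M[K]_d) (S T : 'M[K]_d) : Prop := Chain {
  chainE : forall i j, E i *m E j = if i == j then E i else 0;
  chain_big : forall i, (q < i)%N -> E i = 0;
  chain_sum : \sum_(i < q.+1) E i = 1%:M;
  chainS : forall i, E i *m S = S *m E i.+1;
  chainS0 : S *m E 0 = 0;
  chainTl : E q *m T = T;
  chainTr : T *m E q = T }.

Definition chain_hom d d' (E : nat -> 'M[K]_d) S T (E' : nat -> 'M[K]_d') S' T'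
    (f : 'M_(d, d')) : Prop :=
  [/\ forall i, E i *m f = f *m E' i, S *m f = f *m S' & T *m f = f *m T'].

(** As for flags: what is left of indecomposability. *)
Definition chain_local d (E : nat -> 'M[K]_d) S T : Prop :=
  forall (f : 'M_d) (e : 'rV_d), chain_hom E S T E S T f -> e != 0 ->
  e *m f = e -> f \in unitmx.

Section Theory.
Variables (d : nat) (E : nat -> 'M[K]_d) (S T : 'M[K]_d).
Hypothesis ch : chain E S T.

Lemma chain_idem i : E i *m E i = E i.
Proof. by rewrite (chainE ch) eqxx. Qed.

Lemma chain_Sn i n : E i *m S ^+ n = S ^+ n *m E (i + n)%N.
Proof.
elim: n => [|n IH]; first by rewrite expr0 mulmx1 mul1mx addn0.
by rewrite exprSr -mulmxE mulmxA IH -mulmxA (chainS ch) mulmxA addnS.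
Qed.

Lemma chain_Sn0 i n : (i < n)%N -> S ^+ n *m E i = 0.
Proof.
elim: n i => // n IH [|i]; rewrite ltnS => lt.
  by rewrite exprSr -mulmxE -mulmxA (chainS0 ch) mulmx0.
by rewrite exprSr -mulmxE -mulmxA -(chainS ch) mulmxA IH ?mul0mx.
Qed.

Lemma chain_Sn_sub i n : (n <= i)%N -> S ^+ n *m E i = E (i - n)%N *m S ^+ n.
Proof. by move=> le; rewrite chain_Sn subnK. Qed.

Lemma chain_ext d' (A B : 'M_(d, d')) :
  (forall j, (j <= q)%N -> E j *m A = E j *m B) -> A = B.
Proof.
move=> H; rewrite -[A]mul1mx -[B]mul1mx -(chain_sum ch) !mulmx_suml.
by apply: eq_bigr => j _; apply: H; rewrite -ltnS.
Qed.

Lemma chain_S_nilp : S ^+ q.+1 = 0.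
Proof.
apply: chain_ext => j jq; rewrite mulmx0 chain_Sn (chain_big ch) ?mulmx0 //.
by rewrite addnS ltnS leq_addl.
Qed.

(** All the maps of the chain are injective. *)
Definition chain_inj : Prop := forall z : 'rV_d, z *m S = 0 -> z *m E q = z.

Lemma chain_inj_pow n j (A : 'M_(n, d)) : chain_inj -> (j <= q)%N ->
  A *m E j = A -> A *m S ^+ (q - j)%N = 0 -> A = 0.
Proof.
move=> inj jq; move em : (q - j)%N => m.
elim: m j jq em A => [|m IH] j jq em A AE AS; first by rewrite expr0 mulmx1 in AS.
have lt : (j < q)%N by rewrite -subn_gt0 em.
have AS1 : A *m S = 0.
  apply: (IH j.+1) => //; first by rewrite subnS em.
    by rewrite -mulmxA -(chainS ch) mulmxA AE.
  by rewrite -mulmxA mulmxE -exprS.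
apply/row_matrixP => k; rewrite row0.
have /inj : row k A *m S = 0 by rewrite -row_mul AS1 row0.
by rewrite -{1}AE row_mul -mulmxA (chainE ch) (ltn_eqF lt) mulmx0 => <-.
Qed.

End Theory.

(** * The summands that do not reach the last space *)

(** The vectors [x S^k] form a basis, with [x] in [V_i], and [T] vanishes. *)
Definition interval_code d (E : nat -> 'M[K]_d) (S T : 'M[K]_d) (i m : nat) :=
  exists (x : 'rV_d) (h : 'M_(d, m.+1)), let B := jordan_rows S m.+1 x in
  [/\ B *m h = 1%:M /\ h *m B = 1%:M, x *m S ^+ m.+1 = 0, x *m E i = x &
      B *m T = 0].

Lemma jordan_rows_E d (E : nat -> 'M[K]_d) S T i n l (x : 'rV_d) :
  chain E S T -> x *m E i = x ->
  jordan_rows S n x *m E l =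
  diag_mx (\row_(k < n) (i + k == l)%:R) *m jordan_rows S n x.
Proof.
move=> ch xE; apply/row_matrixP => k; rewrite !row_mul rowK.
rewrite row_diag_mx -scalemxAl -rowE rowK mxE.
rewrite -{1}xE -!mulmxA [E i *m _]mulmxA (chain_Sn ch) -mulmxA (chainE ch).
case: eqP => [e|_]; last by rewrite !mulmx0 scale0r.
by rewrite scale1r -(chain_Sn ch) mulmxA xE.
Qed.

Lemma hom_of_bases m d d' (B : 'M[K]_(m, d)) (h : 'M_(d, m)) (B' : 'M_(m, d'))
    (M : 'M_m) (X : 'M_d) (X' : 'M_d') :
  B *m h = 1%:M -> h *m B = 1%:M -> B *m X = M *m B -> B' *m X' = M *m B' ->
  X *m (h *m B') = (h *m B') *m X'.
Proof.
move=> Bh hB BX BX'; rewrite -[X]mul1mx -hB -!mulmxA BX' [B *m _]mulmxA BX.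
by rewrite -!mulmxA [B *m (h *m _)]mulmxA Bh mul1mx.
Qed.

Lemma interval_code_iso d d' (E : nat -> 'M[K]_d) S T (E' : nat -> 'M[K]_d')
    S' T' i m : chain E S T -> chain E' S' T' ->
  interval_code E S T i m -> interval_code E' S' T' i m ->
  exists (g : 'M_(d, d')) (g' : 'M_(d', d)),
  [/\ g *m g' = 1%:M, g' *m g = 1%:M & chain_hom E S T E' S' T' g].
Proof.
move=> ch ch' [x [h [[Bh hB] xS xE BT]]] [x' [h' [[Bh' hB'] xS' xE' BT']]].
exists (h *m jordan_rows S' m.+1 x'), (h' *m jordan_rows S m.+1 x); split.
- by rewrite mulmxA -[_ *m _ *m h']mulmxA Bh' mulmx1.
- by rewrite mulmxA -[_ *m _ *m h]mulmxA Bh mulmx1.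
split=> [l||].
- apply: hom_of_bases Bh hB _ (jordan_rows_E _ _ ch' xE').
  exact: jordan_rows_E ch xE.
- apply: hom_of_bases Bh hB (esym (jordan_rows_T xS)) _.
  exact: esym (jordan_rows_T xS').
by apply: (@hom_of_bases _ _ _ _ _ _ 0) Bh hB _ _; rewrite mul0mx.
Qed.

(** A vector of [V_j], [j < q], that [S] kills is the end of a Jordan block of
    [S]; if the block is as long as possible, it splits off. *)
Lemma chain_interval d (E : nat -> 'M[K]_d) S T :
  chain E S T -> chain_local E S T -> ~ chain_inj E S ->
  exists i m, [/\ (i <= q)%N, (m <= q)%N & interval_code E S T i m].
Proof.
move=> ch loc ninj.
have [z [zS [j [jq zE]]]] : exists z : 'rV_d, z *m S = 0 /\
    exists j, (j < q)%N /\ z *m E j != 0.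
  apply: contrapT => H; case: ninj => z zS.
  rewrite -[RHS]mulmx1 -(chain_sum ch) big_ord_recr mulmxDr /= mulmx_sumr big1 ?add0r //.
  move=> k _; apply/eqP/negPn/negP => nz; case: H; exists z; split=> //.
  by exists k.
set y := z *m E j in zE.
have yE : y *m E j = y by rewrite -mulmxA (chain_idem ch).
have yS : y *m S = 0 by rewrite -mulmxA (chainS ch) mulmxA zS mul0mx.
have ex0 : exists m, (y <= S ^+ m)%MS by exists 0; rewrite expr0 submx1.
have ub m : (y <= S ^+ m)%MS -> (m <= q)%N.
  move=> ym; rewrite leqNgt; apply/negP => qm; case/negP: zE; apply/eqP.
  by move: ym; rewrite -(subnK qm) exprD (chain_S_nilp ch) mulr0 => /submx0null.
case: (ex_maxnP ex0 ub) => m ym ymax.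
have {ymax} nym : ~~ (y <= S ^+ m.+1)%MS.
  by apply/negP => /ymax; rewrite ltnn.
have mq := ub _ ym.
have mj : (m <= j)%N.
  rewrite leqNgt; apply/negP => jm; case/negP: zE; apply/eqP.
  by case/submxP: ym => w ew; rewrite -yE ew -mulmxA (chain_Sn0 ch) ?mulmx0.
have [w ew] := submxP ym.
pose x := w *m E (j - m)%N.
have xS : x *m S ^+ m = y by rewrite -mulmxA -(chain_Sn_sub ch) // mulmxA -ew.
have xE : x *m E (j - m)%N = x by rewrite -mulmxA (chain_idem ch).
have xSm : x *m S ^+ m.+1 = 0 by rewrite -mul_expr_succ xS.
have [f0 [Sf0 yf0]] := separate nym.
pose f := E j *m f0.
have Ef l : E l *m f = if l == j then f else 0.
  by rewrite mulmxA (chainE ch); case: eqP => [->|_]; rewrite ?mul0mx.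
have yf : y *m f = 1%:M by rewrite mulmxA yE.
have Sf : S ^+ m.+1 *m f = 0.
  rewrite mulmxA; case: (leqP m.+1 j) => [le|lt]; last by rewrite (chain_Sn0 ch) ?mul0mx.
  by rewrite (chain_Sn_sub ch) // -mulmxA Sf0 mulmx0.
pose b := Block m.+1 x f.
have wb : block_wf S b by split=> //; rewrite /socle /= xS.
have xSk k l : x *m S ^+ k *m E l = if (j - m + k)%N == l then x *m S ^+ k else 0.
  have -> : x *m S ^+ k = x *m (S ^+ k *m E (j - m + k)%N).
    by rewrite -(chain_Sn ch) mulmxA xE.
  by rewrite -!mulmxA (chainE ch); case: eqP => _; rewrite ?mulmx0.
have ESf k l : E l *m (S ^+ k *m f) = if (l + k)%N == j then S ^+ k *m f else 0.
  by rewrite mulmxA (chain_Sn ch) -mulmxA Ef; case: eqP; rewrite ?mulmx0.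
have jlt k : (k <= m)%N -> (j - m + k < q)%N.
  by move=> km; apply: leq_ltn_trans jq; rewrite -{2}(subnK mj) leq_add2l.
have xT k : (k <= m)%N -> x *m S ^+ k *m T = 0.
  move=> km; rewrite -(chainTl ch) mulmxA xSk.
  by rewrite (ltn_eqF (jlt _ km)) mul0mx.
have Tf k : T *m (S ^+ k *m f) = 0.
  rewrite -(chainTr ch) -mulmxA ESf gtn_eqF ?mulmx0 //.
  by rewrite (leq_trans jq) ?leq_addr.
have fit : chain_hom E S T E S T (retract S b).
  split; [move=> l | exact: esym (retract_comm wb) |].
    rewrite mulmx_sumr mulmx_suml; apply: eq_bigr => k _ /=.
    have km : (k <= m)%N by rewrite -ltnS.
    rewrite mulmxA ESf -[RHS]mulmxA xSk.
    have -> : (l + (m - k) == j)%N = (j - m + k == l)%N.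
      rewrite -(eqn_add2r k) -addnA subnK // -(eqn_add2r m (j - m + k)).
      by rewrite addnAC subnK // eq_sym.
    by case: eqP => _; rewrite ?mulmx0 ?mul0mx.
  rewrite mulmx_sumr mulmx_suml; apply: eq_bigr => k _ /=.
  by rewrite mulmxA Tf mul0mx -[RHS]mulmxA xT ?mulmx0 // -ltnS.
have uf : retract S b \in unitmx.
  by apply: (loc _ y fit zE); rewrite mul_retract_socle // yf mxE scale1r /socle /= xS.
set B := jordan_rows S m.+1 x.
have full : row_full B.
  by rewrite -sub1mx (submx_trans _ (retract_sub S b)) // sub1mx row_full_unit.
have free : row_free B.
  rewrite -kermx_eq0; apply/eqP/row_matrixP => k; rewrite row0.
  have := @block_rows_inj _ _ S [:: b] (row_mx (row k (kermx B)) 0).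
  rewrite /= mul_row_col mul0mx addr0 -/B -row_mul mulmx_ker row0.
  move=> H; have /eqP : row_mx (row k (kermx B)) 0 = 0 :> 'rV[K]_(m.+1 + 0) by apply: H.
  by rewrite row_mx_eq0 => /andP[/eqP].
exists (j - m)%N, m; split=> //; first exact: leq_trans (leq_subr _ _) (ltnW jq).
exists x, (pinvmx B); split=> //; first by rewrite mulmxVp // mulVpmx.
by apply/row_matrixP => k; rewrite row_mul rowK row0 xT // -ltnS.
Qed.

End Chains.

(** * Chains of injections as flags on the last space *)

Section ChainFlags.
Variables (K : fieldType) (q : nat).

(** The image of [V_j] in [V_q]. *)
Definition chain_top d (E : nat -> 'M[K]_d) (S : 'M[K]_d) j := E j *m S ^+ (q - j).

(** In a chain of injections, the value of a homomorphism on [V_q] determines it,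
    and every linear map between the last spaces that respects [T] and the
    images of the [V_j] extends. *)
Lemma chain_hom_ext d d' (E : nat -> 'M[K]_d) S T (E' : nat -> 'M[K]_d') S' T'
    (f g : 'M_(d, d')) : chain q E S T -> chain q E' S' T' ->
  chain_inj q E' S' ->
  chain_hom E S T E' S' T' f -> chain_hom E S T E' S' T' g ->
  E q *m f = E q *m g -> f = g.
Proof.
move=> ch ch' inj [fE fS _] [gE gS _] e.
have powS (h : 'M_(d, d')) n : S *m h = h *m S' -> S ^+ n *m h = h *m S' ^+ n.
  move=> hS; elim: n => [|n IH]; first by rewrite !expr0 mulmx1 mul1mx.
  by rewrite exprSr -mulmxE -mulmxA hS mulmxA IH -mulmxA mulmxE -exprSr.
apply: (chain_ext ch) => j jq; apply/eqP; rewrite -subr_eq0; apply/eqP.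
apply: (chain_inj_pow ch' inj jq).
  by rewrite mulmxBl -!mulmxA -fE -gE !mulmxA (chain_idem ch).
rewrite mulmxBl -!mulmxA -!powS // !mulmxA (chain_Sn ch) subnKC //.
by rewrite -!mulmxA e subrr.
Qed.

Lemma chain_hom_comp d1 d2 d3 (E1 : nat -> 'M[K]_d1) S1 T1 (E2 : nat -> 'M[K]_d2)
    S2 T2 (E3 : nat -> 'M[K]_d3) S3 T3 (f : 'M_(d1, d2)) (g : 'M_(d2, d3)) :
  chain_hom E1 S1 T1 E2 S2 T2 f -> chain_hom E2 S2 T2 E3 S3 T3 g ->
  chain_hom E1 S1 T1 E3 S3 T3 (f *m g).
Proof.
case=> fE fS fT [gE gS gT]; split=> [i||];
  by rewrite mulmxA ?fE ?fS ?fT -mulmxA ?gE ?gS ?gT mulmxA.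
Qed.

Lemma chain_hom1 d (E : nat -> 'M[K]_d) S T : chain_hom E S T E S T 1%:M.
Proof. by split=> [i||]; rewrite mulmx1 mul1mx. Qed.

Lemma chain_lift d d' (E : nat -> 'M[K]_d) S T (E' : nat -> 'M[K]_d') S' T'
    (f : 'M_(d, d')) : chain q E S T -> chain q E' S' T' ->
  chain_inj q E' S' -> E q *m f = f -> f *m E' q = f -> T *m f = f *m T' ->
  (forall j, (j <= q)%N -> (chain_top E S j *m f <= chain_top E' S' j)%MS) ->
  exists2 g, chain_hom E S T E' S' T' g & E q *m g = f.
Proof.
move=> ch ch' inj fl fr fT fF.
pose g_ j := chain_top E S j *m f *m pinvmx (chain_top E' S' j) *m E' j.
have gS j : (j <= q)%N -> g_ j *m S' ^+ (q - j) = chain_top E S j *m f.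
  by move=> jq; rewrite -mulmxA mulmxKpV // fF.
have gl j : E j *m g_ j = g_ j.
  by rewrite /g_ /chain_top !mulmxA (chain_idem ch).
have gr j : g_ j *m E' j = g_ j by rewrite /g_ -mulmxA (chain_idem ch').
have gq : g_ q = f.
  rewrite /g_ /chain_top subnn !expr0 !mulmx1 fl.
  by rewrite mulmxKpV // -fr submxMl.
clearbody g_; pose g := \sum_(j < q.+1) g_ j.
have Eg j : (j <= q)%N -> E j *m g = g_ j.
  move=> jq; rewrite mulmx_sumr (bigD1 (inord j)) //= inordK // gl big1 ?addr0 //.
  move=> k nk; rewrite -gl mulmxA (chainE ch); case: eqP => [e|]; last by rewrite mul0mx.
  by case/eqP: nk; apply/val_inj; rewrite /= inordK.
have gE j : (j <= q)%N -> g *m E' j = g_ j.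
  move=> jq; rewrite mulmx_suml (bigD1 (inord j)) //= inordK // gr big1 ?addr0 //.
  move=> k nk; rewrite -gr -mulmxA (chainE ch'); case: eqP => [e|]; last by rewrite mulmx0.
  by case/eqP: nk; apply/val_inj; rewrite /= inordK.
exists g; last by rewrite Eg // gq.
split.
- move=> j; case: (leqP j q) => [jq|qj]; first by rewrite Eg // gE.
  by rewrite (chain_big ch qj) (chain_big ch' qj) mul0mx mulmx0.
- apply: (chain_ext ch) => j jq; rewrite !mulmxA (chainS ch) Eg // -mulmxA.
  case: (ltnP j q) => [lt|ge]; last first.
    have -> : j = q by apply/eqP; rewrite eqn_leq jq ge.
    rewrite (chain_big ch) // mul0mx mulmx0 gq -fr -mulmxA (chainS ch').
    by rewrite (chain_big ch') // !mulmx0.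
  rewrite Eg //; apply/eqP; rewrite -subr_eq0; apply/eqP.
  apply: (chain_inj_pow ch' inj lt).
    by rewrite mulmxBl -!mulmxA gr -(chainS ch') mulmxA gr.
  have powS n (X : 'M[K]_n) : X *m X ^+ (q - j.+1) = X ^+ (q - j).
    by rewrite mulmxE -exprS -subSn // subSS.
  rewrite mulmxBl -!mulmxA gS // powS gS // /chain_top !mulmxA -(chainS ch).
  by rewrite -[E j *m S *m _]mulmxA powS subrr.
rewrite -(chainTr ch) -mulmxA Eg // gq -(chainTl ch') mulmxA gE // gq.
by rewrite -fT -{2}(chainTr ch) -mulmxA fl.
Qed.

Lemma idempotent_split d (e : 'M[K]_d) : e *m e = e ->
  exists (B : 'M_(\rank e, d)) (C : 'M_(d, \rank e)),
  C *m B = e /\ B *m C = 1%:M.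
Proof.
move=> ee; exists (row_base e), (col_base e); split; first exact: mulmx_base.
apply: (row_free_inj (row_base_free e)); rewrite /mulmxr mul1mx.
apply: (row_full_inj (col_base_full e)).
by rewrite -[_ *m _ *m row_base e]mulmxA mulmx_base mulmxA mulmx_base ee.
Qed.

Section Top.
Variables (d : nat) (E : nat -> 'M[K]_d) (S T : 'M[K]_d).
Hypothesis ch : chain q E S T.
Hypothesis inj : chain_inj q E S.

Variables (r : nat) (B : 'M[K]_(r, d)) (C : 'M[K]_(d, r)).
Hypotheses (CB : C *m B = E q) (BC : B *m C = 1%:M).

(** The operator and the flag on [V_q], in coordinates; the flag starts at step
    one with the image of [V_0]. *)
Definition top_op : 'M_r := B *m T *m C.

Definition top_flag (j : nat) : 'M_r :=
  if j is j'.+1 then <<chain_top E S j' *m C>>%MS else 0.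

Lemma B_Eq : B *m E q = B. Proof. by rewrite -CB mulmxA BC mul1mx. Qed.
Lemma Eq_C : E q *m C = C. Proof. by rewrite -CB -mulmxA BC mulmx1. Qed.

Lemma top_opC : C *m top_op = T *m C.
Proof. by rewrite /top_op !mulmxA CB (chainTl ch). Qed.

Lemma top_opB : top_op *m B = B *m T.
Proof. by rewrite /top_op -!mulmxA CB (chainTr ch). Qed.

Lemma chain_top_q j : (j <= q)%N -> chain_top E S j *m E q = chain_top E S j.
Proof.
by move=> jq; rewrite /chain_top (chain_Sn ch) subnKC // -mulmxA (chain_idem ch).
Qed.

Lemma top_op_pow n : top_op ^+ n *m B = B *m T ^+ n.
Proof.
elim: n => [|n IH]; first by rewrite !expr0 mul1mx mulmx1.
by rewrite exprSr -mulmxE -mulmxA top_opB mulmxA IH -mulmxA mulmxE -exprSr.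
Qed.

Lemma top_nilp n : T ^+ n = 0 -> top_op ^+ n = 0.
Proof.
by move=> Tn; rewrite -[LHS]mulmx1 -BC mulmxA top_op_pow Tn mulmx0 mul0mx.
Qed.

Lemma top_flag_last : top_flag q.+1 = 1%:M.
Proof.
rewrite /= /chain_top subnn expr0 mulmx1 Eq_C -[RHS]genmx1.
by apply/eq_genmx/eqmxP; rewrite submx1 -BC submxMl.
Qed.

Lemma top_flag_mono i j : (i <= j <= q.+1)%N -> (top_flag i <= top_flag j)%MS.
Proof.
case/andP=> ij jq; have step l : (l < q.+1)%N -> (top_flag l <= top_flag l.+1)%MS.
  case: l => [|l]; first by rewrite sub0mx.
  rewrite ltnS => lq; rewrite !genmxE submxMr // /chain_top.
  by rewrite -(subnSK lq) exprS -mulmxE mulmxA (chainS ch) -mulmxA submxMl.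
elim: j ij jq => [|j IH]; first by rewrite leqn0 => /eqP ->.
rewrite leq_eqVlt => /orP[/eqP -> //|ij jq].
by apply: submx_trans (IH ij (ltnW jq)) (step _ jq).
Qed.

Lemma top_local : chain_local E S T -> flag_local q.+1 top_op top_flag.
Proof.
move=> loc f e [fT fF] e0 ef.
have [|||j jq|g gh gq] := @chain_lift _ _ E S T E S T (C *m f *m B) ch ch inj.
- by rewrite !mulmxA Eq_C.
- by rewrite -mulmxA B_Eq.
- rewrite !mulmxA -top_opC -[C *m f *m B *m T]mulmxA -top_opB.
  by rewrite -[C *m _ *m f]mulmxA -fT (mulmxA C) (mulmxA (C *m f)).
- have := fF j.+1 jq; rewrite /= (eqmxMr _ (genmxE _)) genmxE => h.
  rewrite (mulmxA _ (C *m f)) (mulmxA _ C).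
  by have := submxMr B h; rewrite -[_ *m C *m B]mulmxA CB chain_top_q.
have ug : g \in unitmx.
  apply: (loc g (e *m B) gh).
    apply: contraNneq e0 => eB; apply/eqP; rewrite -[e]mulmx1 -BC mulmxA eB.
    by rewrite mul0mx.
  by rewrite -{1}B_Eq -!mulmxA gq !mulmxA -(mulmxA e) BC mulmx1 ef.
have [gE _ _] := gh.
have fE : f *m B = B *m g by rewrite -[in RHS]B_Eq -mulmxA gq !mulmxA BC mul1mx.
apply: (@mulmx1_unit _ _ _ (B *m invmx g *m C) _).1.
by rewrite !mulmxA fE mulmxK.
Qed.

End Top.

(** An interval is given by its first vertex and its length minus one. *)
Definition chain_code : finType := ('I_q.+1 * 'I_q.+1 + code q.+1)%type.

Definition has_chain_code d (E : nat -> 'M[K]_d) (S T : 'M[K]_d)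
    (c : chain_code) : Prop :=
  match c with
  | inl im => interval_code E S T im.1 im.2
  | inr c' => chain_inj q E S /\ exists r (B : 'M_(r, d)) (C : 'M_(d, r)),
      [/\ C *m B = E q, B *m C = 1%:M &
          has_code (top_op T B C) (top_flag E S C) c']
  end.

Lemma chain_code_lift d d' (E : nat -> 'M[K]_d) S T (E' : nat -> 'M[K]_d') S' T'
    r r' (B : 'M_(r, d)) (C : 'M_(d, r)) (B' : 'M_(r', d')) (C' : 'M_(d', r'))
    (g : 'M_(r, r')) : chain q E S T -> chain q E' S' T' ->
  C *m B = E q -> B *m C = 1%:M -> C' *m B' = E' q -> B' *m C' = 1%:M ->
  chain_inj q E' S' -> g *m top_op T' B' C' = top_op T B C *m g ->
  (forall j, (j <= q.+1)%N ->
     (top_flag E S C j *m g :=: top_flag E' S' C' j)%MS) ->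
  exists2 f, chain_hom E S T E' S' T' f & E q *m f = C *m g *m B'.
Proof.
move=> ch ch' CB BC CB' BC' inj gT gF.
apply: chain_lift => //.
- by rewrite !mulmxA (Eq_C CB BC).
- by rewrite -mulmxA (B_Eq CB' BC').
- rewrite !mulmxA -(top_opC ch CB) -[C *m g *m B' *m T']mulmxA.
  rewrite -(top_opB ch' CB') -[C *m _ *m g]mulmxA -gT (mulmxA C).
  by rewrite (mulmxA (C *m g)).
move=> j jq; have /eqmxP := gF j.+1 jq.
rewrite /= (eqmxMr _ (genmxE _)) !genmxE => /andP[h _].
rewrite (mulmxA _ (C *m g)) (mulmxA _ C).
by have := submxMr B' h; rewrite -[_ *m C' *m B']mulmxA CB' (chain_top_q ch').
Qed.

Lemma chain_code_iso d d' (E : nat -> 'M[K]_d) S T (E' : nat -> 'M[K]_d') S' T'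
    c : chain q E S T -> chain q E' S' T' ->
  has_chain_code E S T c -> has_chain_code E' S' T' c ->
  exists (f : 'M_(d, d')) (f' : 'M_(d', d)),
  [/\ f *m f' = 1%:M, f' *m f = 1%:M & chain_hom E S T E' S' T' f].
Proof.
move=> ch ch'; case: c => [im|c] /=; first exact: (interval_code_iso ch ch').
case=> inj [r [B [C [CB BC hc]]]] [inj' [r' [B' [C' [CB' BC' hc']]]]].
have [g [g' [gg' g'g gT gF]]] := has_code_iso hc hc'.
have gT' : g' *m top_op T B C = top_op T' B' C' *m g'.
  by rewrite -[LHS]mulmx1 -gg' mulmxA -(mulmxA g') -gT (mulmxA g') g'g mul1mx.
have gF' j : (j <= q.+1)%N ->
    (top_flag E' S' C' j *m g' :=: top_flag E S C j)%MS.
  move=> jq; apply: eqmx_trans (eqmxMr _ (eqmx_sym (gF j jq))) _.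
  by rewrite -mulmxA gg' mulmx1; apply/eqmxP; rewrite !submx_refl.
have [f fh fq] := chain_code_lift ch ch' CB BC CB' BC' inj' gT gF.
have [f' fh' fq'] := chain_code_lift ch' ch CB' BC' CB BC inj gT' gF'.
exists f, f'; split=> //.
  have ff' := chain_hom_comp fh fh'.
  apply: (chain_hom_ext ch ch inj ff' (chain_hom1 _ _ _)).
  rewrite mulmxA fq -(B_Eq CB' BC') -!mulmxA fq' !mulmxA -(mulmxA _ B') BC' mulmx1.
  by rewrite -(mulmxA C) gg' mulmx1 CB mulmx1.
have f'f := chain_hom_comp fh' fh.
apply: (chain_hom_ext ch' ch' inj' f'f (chain_hom1 _ _ _)).
rewrite mulmxA fq' -(B_Eq CB BC) -!mulmxA fq !mulmxA -(mulmxA _ B) BC mulmx1.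
by rewrite -(mulmxA C') g'g mulmx1 CB' mulmx1.
Qed.

Lemma chain_code_exists d (E : nat -> 'M[K]_d) S T :
  chain q E S T -> chain_local E S T -> (0 < d)%N ->
  T ^+ 2 = 0 \/ q = 1 /\ T ^+ 3 = 0 ->
  exists c, has_chain_code E S T c.
Proof.
move=> ch loc d0 Tn; case: (pselect (chain_inj q E S)) => [inj|ninj]; last first.
  have [i [m [iq mq h]]] := chain_interval ch loc ninj.
  by exists (inl (Ordinal (iq : i < q.+1)%N, Ordinal (mq : m < q.+1)%N)).
have [B [C [CB BC]]] := idempotent_split (chain_idem ch q).
have r0 : (0 < \rank (E q))%N.
  rewrite lt0n mxrank_eq0; apply: contraTneq d0 => Eq0.
  have one0 : (1%:M : 'M[K]_d) = 0.
    apply: (chain_hom_ext ch ch inj); rewrite ?Eq0 ?mul0mx //.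
      exact: chain_hom1.
    by split=> [i||]; rewrite mulmx0 mul0mx.
  case: d E S T {ch loc Tn inj B C CB BC Eq0} one0 => // n _ _ _ /matrixP/(_ 0 0).
  by rewrite !mxE eqxx => /eqP; rewrite oner_eq0.
have floc := top_local ch inj CB BC loc.
suff [c hc] : exists c : code q.+1, has_code (top_op T B C) (top_flag E S C) c.
  by exists (inr c); split=> //; exists _, B, C.
have lastF : top_flag E S C q.+1 = 1%:M by apply: top_flag_last CB BC.
case: Tn => [T2|[q1 T3]].
  apply: (code_of_square_zero floc) => //; first by move=> i j; apply: (top_flag_mono ch).
  exact: (top_nilp ch CB BC T2).
have cube p D (U : 'M[K]_D) F : p = 2 -> flag_local p U F -> F 0 = 0 ->
    F p = 1%:M -> U ^+ 3 = 0 -> (0 < D)%N -> exists c : code p, has_code U F c.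
  by move=> -> *; apply: code_of_cube_zero.
apply: cube floc _ lastF _ r0 => //; first by rewrite q1.
exact: (top_nilp ch CB BC T3).
Qed.

End ChainFlags.

(** * Modules as matrix representations *)

(** Fitting's lemma.  Some polynomial in [f] is the idempotent that projects onto
    the part where [f] is bijective; it is not zero if [f] fixes a vector. *)
Lemma fitting (K : fieldType) d (f : 'M[K]_d) (e : 'rV_d) :
  (forall g : 'M_d, (forall h : 'M_d, comm_mx f h -> comm_mx g h) ->
     g *m g = g -> g = 0 \/ g = 1%:M) ->
  e != 0 -> e *m f = e -> f \in unitmx.
Proof.
case: d f e => [|n] f e H e0 ef.
  by case/negP: e0; apply/eqP/matrixP=> i [].
have [k [g [g0 mg]]] : exists k g, ~~ root g 0 /\ 'X * char_poly f = g * 'X ^+ k.+1.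
  have /= [m [g [rg eg]]] := multiplicity_XsubC (char_poly f) 0.
  exists m, g; rewrite monic_neq0 ?char_poly_monic //= in rg; split=> //.
  by rewrite eg subr0 mulrC -mulrA -exprSr.
have cop : coprimep ('X ^+ k.+1) g.
  by rewrite coprimep_expl // coprimep_sym -['X]subr0 -polyC0 coprimep_XsubC.
have /Bezout_eq1_coprimepP[[u v] /= uv] := cop.
have hF : horner_mx f (g * 'X ^+ k.+1) = 0 by rewrite -mg rmorphM /= Cayley_Hamilton mulr0.
have eF P : e *m horner_mx f P = P.[1] *: e.
  elim/poly_ind: P => [|P c IH]; first by rewrite rmorph0 mulmx0 horner0 scale0r.
  rewrite rmorphD rmorphM /= horner_mx_X horner_mx_C mulmxDr -mulmxE mulmxA IH.
  by rewrite -scalemxAl ef mul_mx_scalar !hornerE scalerDl.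
pose p := horner_mx f (u * 'X ^+ k.+1).
have pp : p *m p = p.
  have : p *m (1 - p) = 0.
    have -> : 1 - p = horner_mx f (v * g) by rewrite -(rmorph1 (horner_mx f)) -uv rmorphD addrC addKr.
    rewrite mulmxE -rmorphM /=.
    have -> : u * 'X ^+ k.+1 * (v * g) = u * v * (g * 'X ^+ k.+1).
      by rewrite -!mulrA; congr (_ * _); rewrite mulrC -!mulrA.
    by rewrite rmorphM /= hF mulr0.
  by rewrite mulmxBr mulmx1 => /eqP; rewrite subr_eq0 => /eqP <-.
have [h fh||p0|p1] := H p.
- exact: comm_horner_mx.
- exact: pp.
- have eg : g.[1] = 0.
    have /eqP : e *m horner_mx f (g * 'X ^+ k.+1) = 0 by rewrite hF mulmx0.
    by rewrite eF scaler_eq0 (negPf e0) orbF !hornerE expr1n mulr1 => /eqP.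
  have /eqP : e *m p = 0 by rewrite p0 mulmx0.
  rewrite eF scaler_eq0 (negPf e0) orbF !hornerE expr1n mulr1 => /eqP u1.
  have := congr1 (fun P => P.[1]) uv; rewrite !hornerE u1 eg mulr0 mul0r addr0.
  by move/eqP; rewrite eq_sym oner_eq0.
move: p1; rewrite /p exprSr mulrA rmorphM /= horner_mx_X => p1.
by have [] := mulmx1_unit p1.
Qed.

Section MatrixModules.
Variables (K : fieldType) (A : algType K).

Record mxrep (d : nat) := MxRep {
  mxrep_fun :> A -> 'M[K]_d;
  mxrepD : forall a b, mxrep_fun (a + b) = mxrep_fun a + mxrep_fun b;
  mxrepZ : forall c a, mxrep_fun (c *: a) = c *: mxrep_fun a;
  mxrep1 : mxrep_fun 1 = 1%:M;
  mxrepM : forall a b, mxrep_fun (a * b) = mxrep_fun a *m mxrep_fun b }.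

Definition mxmod d (r : mxrep d) := 'rV[K]_d.

Section Mxmod.
Variables (d : nat) (r : mxrep d).
HB.instance Definition _ := GRing.Zmodule.on (mxmod r).
Definition mxmod_act (a : A^c) (v : mxmod r) : mxmod r := (v : 'rV_d) *m r a.

Fact mxmod_actA (a b : A^c) v : mxmod_act a (mxmod_act b v) = mxmod_act (a * b) v.
Proof. by rewrite /mxmod_act -mulmxA -mxrepM. Qed.
Fact mxmod_act1 : left_id 1 mxmod_act.
Proof. by move=> v; rewrite /mxmod_act mxrep1 mulmx1. Qed.
Fact mxmod_actDr : right_distributive mxmod_act +%R.
Proof. by move=> a u v; rewrite /mxmod_act mulmxDl. Qed.
Fact mxmod_actDl v : {morph mxmod_act^~ v : a b / a + b}.
Proof. by move=> a b; rewrite /mxmod_act mxrepD mulmxDr. Qed.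
HB.instance Definition _ := GRing.Zmodule_isLmodule.Build [the pzRingType of A^c]
  (mxmod r) mxmod_actA mxmod_act1 mxmod_actDr mxmod_actDl.
End Mxmod.

Lemma mxmod_scaleE d (r : mxrep d) (a : A) (v : mxmod r) :
  (a : A^c) *: v = (v : 'rV_d) *m r a.
Proof. by []. Qed.

Lemma rmod_isoI (V W : rmodType A) (f : V -> W) (g : W -> V) :
  {morph f : u v / u + v} -> (forall (a : A) v, f ((a : A^c) *: v) = (a : A^c) *: f v) ->
  cancel f g -> cancel g f -> rmod_iso V W.
Proof.
move=> fD fZ fg gf.
have fB : zmod_morphism f.
  move=> u v; have := fD (u - v) v; rewrite subrK => ->; by rewrite addrK.
pose h1 := GRing.isZmodMorphism.Build V W f fB.
pose h2 := GRing.isScalable.Build _ V W *:%R f fZ.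
pose h : {linear V -> W} := HB.pack f h1 h2.
by exists h; exists g.
Qed.

Lemma rmod_iso_sym (V W : rmodType A) : rmod_iso V W -> rmod_iso W V.
Proof.
case=> f [g fg gf]; apply: (@rmod_isoI W V g f) => //.
  by move=> u v; apply: (can_inj fg); rewrite raddfD /= !gf.
by move=> a v; apply: (can_inj fg); rewrite linearZ /= !gf.
Qed.

Lemma rmod_iso_trans (U V W : rmodType A) :
  rmod_iso U V -> rmod_iso V W -> rmod_iso U W.
Proof.
case=> f [g fg gf] [f' [g' fg' gf']].
apply: (@rmod_isoI U W (f' \o f) (g \o g')).
- by move=> u v; rewrite /= !raddfD.
- by move=> a v; rewrite /= linearZ /= linearZ.
- by move=> u; rewrite /= fg' fg.
by move=> u; rewrite /= gf gf'.
Qed.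

Lemma rmod_iso_prod (U V U' V' : rmodType A) :
  rmod_iso U U' -> rmod_iso V V' -> rmod_iso (U * V)%type (U' * V')%type.
Proof.
case=> f [g fg gf] [f' [g' fg' gf']].
apply: (@rmod_isoI (U * V)%type (U' * V')%type (fun u => (f u.1, f' u.2)) (fun u => (g u.1, g' u.2))).
- by move=> u v; rewrite /= !raddfD.
- by move=> a [u v]; rewrite /= !linearZ /=.
- by case=> u v; rewrite /= fg fg'.
by case=> u v; rewrite /= gf gf'.
Qed.

Lemma mxmod_iso d d' (r : mxrep d) (r' : mxrep d') (f : 'M_(d, d')) (g : 'M_(d', d)) :
  f *m g = 1%:M -> g *m f = 1%:M -> (forall a, r a *m f = f *m r' a) ->
  rmod_iso (mxmod r) (mxmod r').
Proof.
move=> fg gf fr; apply: (@rmod_isoI (mxmod r) (mxmod r')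
  (fun v => (v : 'rV_d) *m f) (fun v => (v : 'rV_d') *m g)).
- by move=> u v; rewrite mulmxDl.
- by move=> a v; rewrite !mxmod_scaleE -!mulmxA fr.
- by move=> u; rewrite -mulmxA fg mulmx1.
by move=> u; rewrite -mulmxA gf mulmx1.
Qed.

Definition spans (V : rmodType A) n (e : 'I_n -> V) : Prop := forall v : V,
  exists c : 'I_n -> K, v = \sum_(i < n) ((c i)%:A : A^c) *: e i.

Lemma scaleK_D (V : rmodType A) (a b : K) (v : V) :
  ((a + b)%:A : A^c) *: v = (a%:A : A^c) *: v + (b%:A : A^c) *: v.
Proof. by rewrite -[RHS]scalerDl; congr (_ *: _); rewrite scalerDl. Qed.

Lemma scaleK_M (V : rmodType A) (a b : K) (v : V) :
  ((a * b)%:A : A^c) *: v = (a%:A : A^c) *: ((b%:A : A^c) *: v).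
Proof.
rewrite scalerA; congr (_ *: _); rewrite -[RHS]/(b%:A * a%:A : A).
by rewrite -scalerAl mul1r scalerA mulrC.
Qed.

Lemma scaleK_0 (V : rmodType A) (v : V) : ((0 : K)%:A : A^c) *: v = 0.
Proof. by rewrite scale0r -[RHS](scale0r v). Qed.

Lemma scaleK_1 (V : rmodType A) (v : V) : ((1 : K)%:A : A^c) *: v = v.
Proof. by rewrite scale1r -[RHS](scale1r v). Qed.

Lemma spans_drop (V : rmodType A) n (e : 'I_n.+1 -> V) (c : 'I_n.+1 -> K) i :
  spans e -> \sum_(j < n.+1) ((c j)%:A : A^c) *: e j = 0 -> c i != 0 ->
  spans (fun j => e (lift i j)).
Proof.
move=> eV ce ci v; have [b ->] := eV v.
pose t := b i / c i; pose b' j := b j - t * c j.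
exists (fun j => b' (lift i j)).
have -> : \sum_(j < n.+1) ((b j)%:A : A^c) *: e j =
          \sum_(j < n.+1) ((b' j)%:A : A^c) *: e j.
  have te : \sum_(j < n.+1) (t%:A : A^c) *: (((c j)%:A : A^c) *: e j) = 0.
    by rewrite -scaler_sumr ce scaler0.
  rewrite -[RHS]addr0 -[X in _ = _ + X]te -big_split; apply: eq_bigr => j _ /=.
  by rewrite -scaleK_M -scaleK_D subrK.
rewrite (bigD1_ord i) //= {1}/b' /t divfK // subrr scaleK_0 add0r.
by [].
Qed.

(** A minimal spanning family is a basis, by [spans_drop]. *)
Lemma fin_dim_mxmod (V : rmodType A) : fin_dim V ->
  exists d (r : mxrep d), rmod_iso V (mxmod r).
Proof.
move=> fV; have exn : exists n, `[< exists e : 'I_n -> V, spans e >].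
  by case: fV => n [e eV]; exists n; apply/asboolP; exists e.
case: (ex_minnP exn) => d /asboolP[e eV] dmin.
pose phi (c : 'rV[K]_d) : V := \sum_(i < d) ((c 0 i)%:A : A^c) *: e i.
have phiD : {morph phi : u v / u + v}.
  move=> u v; rewrite /phi -big_split; apply: eq_bigr => i _ /=.
  by rewrite mxE scaleK_D.
have phiZ k v : phi (k *: v) = (k%:A : A^c) *: phi v.
  by rewrite /phi scaler_sumr; apply: eq_bigr => i _; rewrite mxE scaleK_M.
have phi_inj0 c : phi c = 0 -> c = 0.
  case: d e eV dmin @phi phiD phiZ c => [|d] e eV dmin phi _ _ c c0.
    by apply/rowP => -[].
  apply/rowP => i; rewrite mxE; apply/eqP/negPn/negP => ci.
  suff : (d.+1 <= d)%N by rewrite ltnn.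
  by apply: dmin; apply/asboolP; exists (fun j => e (lift i j)); apply: spans_drop c0 ci.
have phiN v : phi (- v) = - phi v.
  by apply/eqP; rewrite -addr_eq0 -phiD addNr /phi big1 // => i _; rewrite mxE scaleK_0.
have phi_inj : injective phi.
  move=> u v uv; apply/eqP; rewrite -subr_eq0; apply/eqP/phi_inj0.
  by rewrite phiD phiN uv subrr.
have surj v : {c | phi c = v}.
  by apply: cid; have [c ->] := eV v; exists (\row_i c i); apply: eq_bigr => i _; rewrite mxE.
pose co v := sval (surj v).
have coK v : phi (co v) = v := svalP (surj v).
have phiK c : co (phi c) = c by apply: phi_inj; rewrite coK.
pose r (a : A) : 'M[K]_d := \matrix_i co ((a : A^c) *: e i).
have phi_sum I (s : seq I) (F : I -> 'rV[K]_d) :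
    phi (\sum_(i <- s) F i) = \sum_(i <- s) phi (F i).
  by apply: (big_morph phi phiD); rewrite /phi big1 // => i _; rewrite mxE scaleK_0.
have rE (a : A) c : phi (c *m r a) = (a : A^c) *: phi c.
  rewrite mulmx_sum_row phi_sum /phi scaler_sumr; apply: eq_bigr => i _.
  rewrite -/(phi _) phiZ rowK coK !scalerA; congr (_ *: _).
  rewrite -[LHS]/(a * (c 0 i)%:A : A) -[RHS]/((c 0 i)%:A * a : A).
  by rewrite -scalerAr mulr1 -scalerAl mul1r.
have eq_mx (M N : 'M[K]_d) : (forall c : 'rV_d, phi (c *m M) = phi (c *m N)) -> M = N.
  by move=> MN; apply/row_matrixP => i; rewrite !rowE; apply/phi_inj/MN.
have rD a b : r (a + b) = r a + r b.
  by apply: eq_mx => c; rewrite mulmxDr phiD !rE scalerDl.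
have rZ k a : r (k *: a) = k *: r a.
  apply: eq_mx => c; rewrite -scalemxAr phiZ !rE scalerA; congr (_ *: _).
  by rewrite -[RHS]/(a * k%:A : A) -scalerAr mulr1.
have r1 : r 1 = 1%:M.
  by apply: eq_mx => c; rewrite mulmx1 rE scale1r.
have rM a b : r (a * b) = r a *m r b.
  by apply: eq_mx => c; rewrite mulmxA !rE scalerA.
exists d, (MxRep rD rZ r1 rM); apply: rmod_iso_sym.
by apply: (@rmod_isoI (mxmod (MxRep rD rZ r1 rM)) V phi co).
Qed.

(** An idempotent endomorphism splits the representation into its image and the
    image of the complementary idempotent. *)
Lemma indecomposable_idem (V : rmodType A) d (r : mxrep d) (p : 'M[K]_d) :
  indecomposable V -> rmod_iso V (mxmod r) ->
  (forall a, r a *m p = p *m r a) -> p *m p = p -> p = 0 \/ p = 1%:M.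
Proof.
case=> _ Vind Vr pr pp; have pp' : (1%:M - p) *m (1%:M - p) = 1%:M - p.
  by rewrite mulmxBr mulmx1 mulmxBl mul1mx pp subrr subr0.
have pr' a : r a *m (1%:M - p) = (1%:M - p) *m r a.
  by rewrite mulmxBr mulmxBl mulmx1 mul1mx pr.
have part e : e *m e = e -> (forall a, r a *m e = e *m r a) ->
    exists k (B : 'M_(k, d)) (C : 'M_(d, k)) (s : mxrep k),
    [/\ C *m B = e, B *m C = 1%:M & forall a, s a = B *m r a *m C].
  move=> ee er; have := idempotent_split ee.
  move: (\rank e) => k [B [C [CB BC]]]; have eC : e *m C = C by rewrite -CB -mulmxA BC mulmx1.
  pose s a := B *m r a *m C.
  have sD a b : s (a + b) = s a + s b by rewrite /s mxrepD mulmxDr mulmxDl.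
  have sZ z a : s (z *: a) = z *: s a by rewrite /s mxrepZ -scalemxAr -scalemxAl.
  have s1 : s 1 = 1%:M by rewrite /s mxrep1 mulmx1.
  have sM a b : s (a * b) = s a *m s b.
    by rewrite /s mxrepM -!mulmxA (mulmxA C B) CB (mulmxA e) -er -!mulmxA eC.
  by exists k, B, C, (MxRep sD sZ s1 sM).
have [k [B [C [s [CB BC sE]]]]] := part p pp pr.
have [k' [B' [C' [s' [CB' BC' sE']]]]] := part _ pp' pr'.
have Bp : B *m p = B by rewrite -CB mulmxA BC mul1mx.
have pC : p *m C = C by rewrite -CB -mulmxA BC mulmx1.
have Bp' : B' *m (1%:M - p) = B' by rewrite -CB' mulmxA BC' mul1mx.
have pC' : (1%:M - p) *m C' = C' by rewrite -CB' -mulmxA BC' mulmx1.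
have BC0 : B *m C' = 0.
  rewrite -Bp -pC' -mulmxA (mulmxA p) mulmxBr mulmx1 pp subrr.
  by rewrite mul0mx mulmx0.
have BC0' : B' *m C = 0.
  rewrite -Bp' -pC -mulmxA (mulmxA (_ - _)) mulmxBl mul1mx pp subrr.
  by rewrite mul0mx mulmx0.
have iso : rmod_iso (mxmod r) (mxmod s * mxmod s')%type.
  apply: (@rmod_isoI (mxmod r) (mxmod s * mxmod s')%type
    (fun v => ((v : 'rV_d) *m C, (v : 'rV_d) *m C') : (mxmod s * mxmod s')%type)
    (fun u => (u.1 : 'rV_k) *m B + (u.2 : 'rV_k') *m B')).
  - by move=> u v; rewrite !mulmxDl.
  - move=> a v; congr pair; rewrite !mxmod_scaleE ?sE ?sE' !mulmxA.
      by rewrite -(mulmxA v C) CB -(mulmxA v p) -pr -!mulmxA pC.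
    by rewrite -(mulmxA v C') CB' -(mulmxA v (_ - _)) -pr' -!mulmxA pC'.
  - by move=> v /=; rewrite -!mulmxA CB CB' -mulmxDr addrC subrK mulmx1.
  - by case=> u u' /=; rewrite !mulmxDl -!mulmxA BC BC' BC0 BC0' !mulmx1 !mulmx0 addr0 add0r.
have C_0 m (D : 'M[K]_(d, m)) : (forall u : 'rV[K]_m, u = 0) -> D = 0.
  by move=> H; apply/row_matrixP => i; rewrite row0; apply: H.
case: (Vind _ _ (rmod_iso_trans Vr iso)) => H; [left | right].
  by rewrite -CB (C_0 _ C H) mul0mx.
by apply/eqP; rewrite eq_sym -subr_eq0 -CB' (C_0 _ C' H) mul0mx.
Qed.

Lemma indecomposable_local (V : rmodType A) d (r : mxrep d) (f : 'M[K]_d) (e : 'rV_d) :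
  indecomposable V -> rmod_iso V (mxmod r) -> (forall a, f *m r a = r a *m f) ->
  e != 0 -> e *m f = e -> f \in unitmx.
Proof.
move=> Vind Vr fr e0 ef; apply: (fitting _ e0 ef) => g gf gg.
by apply: (indecomposable_idem Vind Vr) => // a; rewrite (gf (r a)) //; apply: fr.
Qed.

Lemma indecomposable_dim (V : rmodType A) d (r : mxrep d) :
  indecomposable V -> rmod_iso V (mxmod r) -> (0 < d)%N.
Proof.
case=> -[v v0] _ [f [g fg gf]]; rewrite lt0n; apply: contraNneq v0 => d0.
have u0 (u : 'rV[K]_d) : u = 0 by apply/rowP => i; have := ltn_ord i; rewrite {2}d0.
by apply/eqP/(can_inj fg); rewrite raddf0; apply: u0.
Qed.

(** It is enough to attach to each indecomposable module a code in a finite type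
    that determines it. *)
Lemma finite_rep_of_codes (C : finType) (R : rmodType A -> C -> Prop) :
  (forall V, fin_dim V -> indecomposable V -> exists c, R V c) ->
  (forall V V' c, R V c -> R V' c -> rmod_iso V V') -> finite_rep_type A.
Proof.
move=> ex iso; pose W c : rmodType A :=
  if pselect (exists V, R V c) is left h then sval (cid h) else (A^c)^o.
have WR c V : R V c -> R (W c) c.
  rewrite /W => Vc; case: pselect => [h|[]]; last by exists V.
  by case: (cid h).
exists #|C|, (fun i => W (enum_val i)) => V fV iV.
have [c Vc] := ex V fV iV; exists (enum_rank c); rewrite enum_rankK.
exact: iso Vc (WR _ _ Vc).
Qed.

End MatrixModules.

(** * Generators of path algebras *)

Section PathGenerators.
Variables (K : fieldType) (Q : quiver).

Fact arrow_walk (a : arrow Q) : walk (source a) [:: a].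
Proof. by rewrite /= eqxx. Qed.

Definition arrow_path (a : arrow Q) : qpath Q := @QPath Q (source a, [:: a]) (arrow_walk a).

Lemma pbasisM (p r : qpath Q) : pbasis K p * pbasis K r = pbasis_mul K p r.
Proof. exact: pa_mul_basis. Qed.

Lemma path_alg_ind (P : path_alg K Q -> Prop) :
  (forall f g, P f -> P g -> P (f + g)) -> (forall c f, P f -> P (c *: f)) ->
  (forall f g, P f -> P g -> P (f * g)) ->
  (forall v, P (pbasis K (trivial_path v))) ->
  (forall a, P (pbasis K (arrow_path a))) -> forall f, P f.
Proof.
move=> PD PZ PM Pv Pa f; rewrite [f]pa_decomp.
have P0 : P 0.
  rewrite -(scale0r (pbasis K (trivial_path (vertex0 Q)))); exact: PZ.
elim/big_ind: _ => // q _; apply: PZ; case: q => -[v s] w.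
elim: s v w => [|a s IH] v w.
  by rewrite (_ : QPath w = trivial_path v) //; apply: val_inj.
have /andP[/eqP sa w'] : walk v (a :: s) := w.
have -> : pbasis K (QPath w) = pbasis K (arrow_path a) * pbasis K (@QPath Q (target a, s) w').
  rewrite pbasisM /pbasis_mul.
  have -> // : pcat (arrow_path a) (@QPath Q (target a, s) w') = Some (QPath w).
  by apply/pcatP; split.
by apply: PM.
Qed.

End PathGenerators.

Section QuotientGenerators.
Variables (K : fieldType) (A : algType K) (I : ideal A).
Definition qpi (a : A) : quot_alg I := \pi_(Quotient.quot I) a.
Lemma qpiD a b : qpi (a + b) = qpi a + qpi b. Proof. exact: qa_piD. Qed.
Lemma qpiM a b : qpi (a * b) = qpi a * qpi b. Proof. exact: qa_piM. Qed.
Lemma qpiZ c a : qpi (c *: a) = c *: qpi a. Proof. exact: qa_piZ. Qed.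
Lemma qpi1 : qpi 1 = 1. Proof. by []. Qed.
Lemma qpi0 : qpi 0 = 0. Proof. by rewrite -(scale0r 0) qpiZ scale0r. Qed.
Lemma qpiX a n : qpi (a ^+ n) = qpi a ^+ n.
Proof. by elim: n => [|n IH]; rewrite ?expr0 ?qpi1 // !exprS qpiM IH. Qed.
Lemma qpi_sum J (s : seq J) (F : J -> A) :
  qpi (\sum_(j <- s) F j) = \sum_(j <- s) qpi (F j).
Proof. exact: (big_morph qpi qpiD qpi0). Qed.
Lemma qpi_eq0 a : a \in I -> qpi a = 0.
Proof. by move=> aI; rewrite -qpi0; apply/qa_piP; rewrite subr0. Qed.
Lemma qpi_surj (b : quot_alg I) : exists a, b = qpi a.
Proof. by exists (repr b); rewrite /qpi reprK. Qed.
End QuotientGenerators.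

(** * The algebras K Q_p / I_x *)

Section QpGenerators.
Variables (K : fieldType) (p x : nat) (hx : (0 < x)%N).
Local Notation A := (KQp_quot K p hx).
Local Notation q := p.-1.

Definition gen_v (v : 'I_q.+1) : A := qpi (Ix K p hx) (pbasis K (trivial_path (v : vertex (Qp p)))).
Definition gen_a (a : option 'I_q) : A := qpi (Ix K p hx) (pbasis K (arrow_path (a : arrow (Qp p)))).

Lemma gen_vv v w : gen_v v * gen_v w = if v == w then gen_v v else 0.
Proof.
rewrite -qpiM pbasisM /pbasis_mul pcat_triv_l /=.
by case: eqP => [->|_] //; rewrite qpi0.
Qed.

Lemma gen_v_sum : \sum_v gen_v v = 1.
Proof. by rewrite -qpi_sum -qpi1. Qed.

Lemma gen_va v a : gen_v v * gen_a a =
  if v == @source (Qp p) a then gen_a a else 0.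
Proof.
rewrite -qpiM pbasisM /pbasis_mul pcat_triv_l /=.
by case: eqP => _ //; rewrite qpi0.
Qed.

Lemma gen_av v a : gen_a a * gen_v v =
  if v == @target (Qp p) a then gen_a a else 0.
Proof.
rewrite -qpiM pbasisM /pbasis_mul pcat_triv_r /=.
by case: eqP => _ //; rewrite qpi0.
Qed.

Lemma gen_loop : gen_a None ^+ x = 0.
Proof.
rewrite -qpiX qpi_eq0 //; apply/asboolP; exists [:: (1, 1)].
by rewrite big_seq1 mul1r mulr1; congr (pbasis K _ ^+ _); apply: val_inj.
Qed.

Lemma gen_ind (P : A -> Prop) :
  (forall f g, P f -> P g -> P (f + g)) -> (forall c f, P f -> P (c *: f)) ->
  (forall f g, P f -> P g -> P (f * g)) ->
  (forall v, P (gen_v v)) -> (forall a, P (gen_a a)) -> forall f, P f.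
Proof.
move=> PD PZ PM Pv Pa f; have [b ->] := qpi_surj f.
elim/path_alg_ind: b => // [b c Pb Pc|c b Pb|b c Pb Pc].
- by rewrite qpiD; apply: PD.
- by rewrite qpiZ; apply: PZ.
- by rewrite qpiM; apply: PM.
Qed.

(** * Modules as chains *)

Section ChainOfRep.
Variables (d : nat) (r : mxrep A d).

Definition rep_E (i : nat) : 'M[K]_d := if insub i is Some v then r (gen_v v) else 0.
Definition rep_S : 'M[K]_d := \sum_(a < q) r (gen_a (Some a)).
Definition rep_T : 'M[K]_d := r (gen_a None).

Lemma mxrep0 : r 0 = 0.
Proof. by rewrite -(scale0r 1) mxrepZ scale0r. Qed.

Lemma rep_E_ord (v : 'I_q.+1) : rep_E v = r (gen_v v).
Proof. by rewrite /rep_E valK. Qed.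

Lemma rep_E_big i : (q < i)%N -> rep_E i = 0.
Proof. by move=> lt; rewrite /rep_E insubF // ltnNge lt. Qed.

Lemma rep_ES i : rep_E i *m rep_S = if insub i is Some a then r (gen_a (Some a)) else 0.
Proof.
rewrite mulmx_sumr; case: (ltnP i q.+1) => iq; last first.
  rewrite insubF; last by rewrite ltnNge (ltnW iq).
  by rewrite big1 // => a _; rewrite rep_E_big // mul0mx.
have e := rep_E_ord (Ordinal iq); rewrite /= in e; rewrite e.
case: insubP => [a _ ea|ni].
  rewrite (bigD1 a) //= -mxrepM gen_va -val_eqE /= ea eqxx big1 ?addr0 // => b nb.
  rewrite -mxrepM gen_va -val_eqE /= -ea; case: eqP => [eb|]; last by rewrite mxrep0.
  by case/eqP: nb; apply: val_inj.
rewrite big1 // => b _; rewrite -mxrepM gen_va -val_eqE /=.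
case: eqP => [eb|]; last by rewrite mxrep0.
by rewrite eb ltn_ord in ni.
Qed.

Lemma rep_SE i : rep_S *m rep_E i.+1 = if insub i is Some a then r (gen_a (Some a)) else 0.
Proof.
rewrite mulmx_suml; case: (ltnP i q) => iq; last first.
  rewrite insubF; last by rewrite ltnNge iq.
  by rewrite big1 // => a _; rewrite rep_E_big // mulmx0.
have e := rep_E_ord (Ordinal (iq : i.+1 < q.+1)%N); rewrite /= in e; rewrite e.
rewrite insubT (bigD1 (Ordinal iq)) //= -mxrepM gen_av -val_eqE /= /bump /= add1n.
rewrite eqxx big1 ?addr0 // => b nb.
rewrite -mxrepM gen_av -val_eqE /= /bump /= add1n eqSS.
case: eqP => [eb|]; last by rewrite mxrep0.
by case/eqP: nb; apply: val_inj.
Qed.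

Lemma rep_chain : chain q rep_E rep_S rep_T.
Proof.
have Eq : rep_E q = r (gen_v ord_max) by rewrite -rep_E_ord.
split.
- move=> i j; case: (leqP i q) => iq; last first.
    by rewrite rep_E_big // mul0mx; case: eqP.
  case: (leqP j q) => jq; last first.
    by rewrite [rep_E j]rep_E_big // mulmx0 ltn_eqF // (leq_ltn_trans iq).
  have ei := rep_E_ord (Ordinal (iq : i < q.+1)%N).
  have ej := rep_E_ord (Ordinal (jq : j < q.+1)%N).
  rewrite /= in ei ej; rewrite ei ej -mxrepM gen_vv -val_eqE /=.
  by case: eqP => _ //; rewrite mxrep0.
- exact: rep_E_big.
- rewrite -(mxrep1 r) -gen_v_sum (big_morph r (mxrepD r) mxrep0).
  by apply: eq_bigr => v _; rewrite rep_E_ord.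
- by move=> i; rewrite rep_ES rep_SE.
- rewrite mulmx_suml big1 // => a _.
  have := rep_E_ord ord0; rewrite /= => ->; rewrite -mxrepM gen_av.
  by rewrite -val_eqE /= mxrep0.
- by rewrite Eq -mxrepM gen_va eqxx.
- by rewrite Eq -mxrepM gen_av eqxx.
Qed.

Lemma rep_T_nilp n : (x <= n)%N -> rep_T ^+ n = 0.
Proof.
move=> xn; have H m : rep_T ^+ m = r (gen_a None ^+ m).
  by elim: m => [|m IH]; rewrite ?expr0 ?mxrep1 // !exprS mxrepM IH.
by rewrite H -(subnK xn) exprD gen_loop mulr0 mxrep0.
Qed.

End ChainOfRep.

Lemma chain_hom_rep d d' (r : mxrep A d) (r' : mxrep A d') (f : 'M_(d, d')) :
  chain_hom (rep_E r) (rep_S r) (rep_T r) (rep_E r') (rep_S r') (rep_T r') f ->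
  forall a, r a *m f = f *m r' a.
Proof.
case=> fE fS fT; apply: gen_ind.
- by move=> a b ea eb; rewrite !mxrepD mulmxDl mulmxDr ea eb.
- by move=> c a ea; rewrite !mxrepZ -scalemxAl -scalemxAr ea.
- by move=> a b ea eb; rewrite !mxrepM -mulmxA eb mulmxA ea mulmxA.
- by move=> v; rewrite -!rep_E_ord.
case=> [a|]; last exact: fT.
have e d1 (r1 : mxrep A d1) : r1 (gen_a (Some a)) = rep_E r1 a *m rep_S r1.
  by rewrite rep_ES valK.
by rewrite !e -mulmxA fS mulmxA fE mulmxA.
Qed.

Lemma rep_local (V : rmodType A) d (r : mxrep A d) : indecomposable V ->
  rmod_iso V (mxmod r) -> chain_local (rep_E r) (rep_S r) (rep_T r).
Proof.
move=> iV Vr f e fh; apply: (indecomposable_local iV Vr) => a.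
by rewrite (chain_hom_rep fh).
Qed.

(** The finite cases: a chain with its operator is determined by its code. *)
Theorem finite_case : (x <= 2)%N || (x == 3) && (p == 2) -> finite_rep_type A.
Proof.
move=> xp; pose R (V : rmodType A) (c : chain_code q) := exists d (r : mxrep A d),
  rmod_iso V (mxmod r) /\ has_chain_code (rep_E r) (rep_S r) (rep_T r) c.
apply: (@finite_rep_of_codes _ _ _ R) => [V fV iV|V V' c].
  have [d [r Vr]] := fin_dim_mxmod fV.
  have [|c hc] := chain_code_exists (rep_chain r) (rep_local iV Vr) (indecomposable_dim iV Vr).
    case/orP: xp => [x2|/andP[/eqP x3 /eqP p2]]; [left | right].
      exact: rep_T_nilp.
    by split; [rewrite p2 | apply: rep_T_nilp; rewrite x3].
  by exists c, d, r.
case=> d [r [Vr hc]] [d' [r' [Vr' hc']]].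
have [f [f' [ff' f'f fh]]] := chain_code_iso (rep_chain r) (rep_chain r') hc hc'.
apply: rmod_iso_trans Vr (rmod_iso_trans _ (rmod_iso_sym Vr')).
exact: mxmod_iso ff' f'f (chain_hom_rep fh).
Qed.

End QpGenerators.

(** * Finitely many modules of bounded dimension *)

Section Bounded.
Variables (K : fieldType) (A : algType K).

(** Splitting off direct summands ends, because a proper summand is spanned by
    fewer vectors. *)
Lemma finite_bounded n : finite_rep_type A ->
  exists (C : finType) (Z : C -> rmodType A), forall (V : rmodType A) (e : 'I_n -> V),
  spans e -> exists c, rmod_iso V (Z c).
Proof.
case=> m [W HW]; elim: n => [|n [C [Z HZ]]].
  exists unit, (fun=> 'rV[A^c]_0 : rmodType A) => V e eV; exists tt.
  have V0 (v : V) : v = 0 by have [c ->] := eV v; rewrite big_ord0.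
  apply: (@rmod_isoI _ _ V ('rV[A^c]_0 : rmodType A) (fun=> 0) (fun=> 0)).
  - by move=> u v; rewrite addr0.
  - by move=> a v; rewrite scaler0.
  - by move=> u; rewrite [u]V0.
  by move=> u; apply/rowP => -[].
pose C' : finType := (unit + 'I_m + C * C)%type.
pose Z' (c : C') : rmodType A := match c with
  | inl (inl _) => 'rV[A^c]_0 : rmodType A
  | inl (inr i) => W i
  | inr (c1, c2) => (Z c1 * Z c2)%type : rmodType A
  end.
exists C', Z' => V e eV.
case: (pselect (forall v : V, v = 0)) => [V0|V0].
  exists (inl (inl tt)).
  apply: (@rmod_isoI _ _ V ('rV[A^c]_0 : rmodType A) (fun=> 0) (fun=> 0)).
  - by move=> u v; rewrite addr0.
  - by move=> a v; rewrite scaler0.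
  - by move=> u; rewrite [u]V0.
  by move=> u; apply/rowP => -[].
case: (pselect (indecomposable V)) => [iV|niV].
  have [|i Vi] := HW V _ iV; first by exists n.+1, e.
  by exists (inl (inr i)).
have {}V0 : exists v : V, v != 0.
  by apply: contrapT => H; apply: V0 => v; apply/eqP/negPn/negP => v0; apply: H; exists v.
have [U1 [U2 [VU U1n U2n]]] : exists U1 U2 : rmodType A, [/\ rmod_iso V (U1 * U2)%type,
    ~ (forall u : U1, u = 0) & ~ (forall u : U2, u = 0)].
  apply: contrapT => H; apply: niV; split=> // U1 U2 VU.
  apply: contrapT => /not_orP[n1 n2]; apply: H.
  by exists U1, U2.
have nz (U : rmodType A) : ~ (forall u : U, u = 0) -> exists u : U, u != 0.
  by move=> Un; apply: contrapT => H; apply: Un => v; apply/eqP/negPn/negP => v0; apply: H; exists v.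
have [f [g fg gf]] := VU.
have fsum (c : 'I_n.+1 -> K) : f (\sum_(i < n.+1) ((c i)%:A : A^c) *: e i) =
    \sum_(i < n.+1) ((c i)%:A : A^c) *: f (e i).
  by rewrite raddf_sum; apply: eq_bigr => i _; rewrite /= linearZ.
have fstsum (c : 'I_n.+1 -> K) (h : 'I_n.+1 -> (U1 * U2)%type) :
   (\sum_(i < n.+1) ((c i)%:A : A^c) *: h i).1 = \sum_(i < n.+1) ((c i)%:A : A^c) *: (h i).1.
  by rewrite (raddf_sum (@fst U1 U2)).
have sndsum (c : 'I_n.+1 -> K) (h : 'I_n.+1 -> (U1 * U2)%type) :
   (\sum_(i < n.+1) ((c i)%:A : A^c) *: h i).2 = \sum_(i < n.+1) ((c i)%:A : A^c) *: (h i).2.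
  by rewrite (raddf_sum (@snd U1 U2)).
have s1 : spans (fun i => (f (e i)).1).
  by move=> u; have [c ec] := eV (g (u, 0)); exists c; rewrite -fstsum -fsum -ec gf.
have s2 : spans (fun i => (f (e i)).2).
  by move=> u; have [c ec] := eV (g (0, u)); exists c; rewrite -sndsum -fsum -ec gf.
have nzc (c : 'I_n.+1 -> K) : \sum_(i < n.+1) ((c i)%:A : A^c) *: e i != 0 ->
    exists i, c i != 0.
  move=> ne; apply: contrapT => H; case/eqP: ne; apply: big1 => i _.
  have -> : c i = 0 by apply/eqP/negPn/negP => ci; apply: H; exists i.
  exact: scaleK_0.
have gnz u : u != 0 -> g u != 0.
  by apply: contraNneq => gu; apply/eqP; rewrite -[u]gf gu raddf0.
have [c1 Z1] : exists c, rmod_iso U1 (Z c).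
  have [u u0] := nz _ U2n; have [c ec] := eV (g (0, u)).
  have [|i ci] := nzc c.
    by rewrite -ec gnz // xpair_eqE negb_and u0 orbT.
  apply: (HZ U1 (fun j => (f (e (lift i j))).1)); apply: spans_drop s1 _ ci.
  by rewrite -fstsum -fsum -ec gf.
have [c2 Z2] : exists c, rmod_iso U2 (Z c).
  have [u u0] := nz _ U1n; have [c ec] := eV (g (u, 0)).
  have [|i ci] := nzc c.
    by rewrite -ec gnz // xpair_eqE negb_and u0.
  apply: (HZ U2 (fun j => (f (e (lift i j))).2)); apply: spans_drop s2 _ ci.
  by rewrite -sndsum -fsum -ec gf.
exists (inr (c1, c2)); apply: rmod_iso_trans VU _.
exact: rmod_iso_prod.
Qed.

End Bounded.

(** * Pure tensors *)

Section PureTensors.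
Variables (K : fieldType) (F A : algType K) (N : rmodType F) (M : bimodule F A).

Definition tens (n : N) (m : M) : tensor N M :=
  \pi_(Quotient.quot (gen_subgroup (@tensor_rel K F A N M))) << (n, m) >>.

Lemma tens_rel g : tensor_rel g ->
  \pi_(Quotient.quot (gen_subgroup (@tensor_rel K F A N M))) g = 0 :> tensor N M.
Proof.
move=> rg; rewrite -(raddf0 \pi_(Quotient.quot (gen_subgroup (@tensor_rel K F A N M)))).
by apply/tensor_piP; rewrite subr0; apply/asboolP/GenSubgroupIn.
Qed.

Lemma tensDl n n' m : tens (n + n') m = tens n m + tens n' m.
Proof.
have := tens_rel (TensorDl n n' m); rewrite !raddfB /= => /eqP.
by rewrite subr_eq0 subr_eq => /eqP e; rewrite [RHS]addrC; exact: e.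
Qed.

Lemma tensDr n m m' : tens n (m + m') = tens n m + tens n m'.
Proof.
have := tens_rel (TensorDr n m m'); rewrite !raddfB /= => /eqP.
by rewrite subr_eq0 subr_eq => /eqP e; rewrite [RHS]addrC; exact: e.
Qed.

Lemma tens_mid n (f : F) m : tens ((f : F^c) *: n) m = tens n (f *: m).
Proof.
have := tens_rel (TensorMid n f m); rewrite !raddfB /= => /eqP.
by rewrite subr_eq0 => /eqP e; exact: e.
Qed.

Lemma tens_act n m (a : A) : (a : A^c) *: tens n m = tens n (bact m a).
Proof. by rewrite [LHS]tensor_act_pi free_actU. Qed.

Lemma tens_ind (P : tensor N M -> Prop) :
  (forall n m, P (tens n m)) -> P 0 ->
  (forall t u, P t -> P u -> P (t - u)) -> forall t, P t.
Proof. exact: tensor_ind. Qed.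

Lemma tensr0 n : tens n 0 = 0.
Proof. by apply: (addrI (tens n 0)); rewrite -tensDr !addr0. Qed.

Lemma tens0l m : tens 0 m = 0.
Proof. by apply: (addrI (tens 0 m)); rewrite -tensDl !addr0. Qed.

Lemma tens_sumr I (s : seq I) (G : I -> M) n :
  tens n (\sum_(i <- s) G i) = \sum_(i <- s) tens n (G i).
Proof. exact: (big_morph (tens n) (tensDr n) (tensr0 n)). Qed.

Lemma tens_scale (c : K) n m :
  (c%:A : A^c) *: tens n m = tens ((c%:A : F^c) *: n) m.
Proof. by rewrite tens_act bactZ -tens_mid. Qed.

Lemma bact0 (m : M) : bact m 0 = 0.
Proof. by apply: (addrI (bact m 0)); rewrite -bactDr !addr0. Qed.

Lemma bact_sumr I (s : seq I) (a : I -> A) (m : M) :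
  bact m (\sum_(i <- s) a i) = \sum_(i <- s) bact m (a i).
Proof. exact: (big_morph (bact m) (bactDr m) (bact0 m)). Qed.

Lemma bactZr (c : K) a (m : M) : bact m (c *: a) = (c%:A : F) *: bact m a.
Proof. by rewrite -{1}[a]mul1r scalerAl bactM bactZ bact_left. Qed.

End PureTensors.

(** If [N] is a line, [N (x) M] is spanned by vectors whose number depends only
    on [M]. *)
Lemma tensor_line_spans (K : fieldType) (F A : algType K) (M : bimodule F A) :
  (exists n (b : 'I_n -> A), forall a, exists c, a = \sum_(i < n) c i *: b i) ->
  bimod_fin_gen M ->
  exists r, forall (N : rmodType F) (e : 'I_1 -> N), spans e ->
  exists e' : 'I_r -> tensor N M, spans e'.
Proof.
case=> k [b bA] [l [g gM]]; pose J : finType := ('I_l * 'I_k)%type.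
exists #|J| => N e eN; pose w (j : J) : tensor N M := tens (e ord0) (bact (g j.1) (b j.2)).
suff H (t : tensor N M) : exists c : J -> K, t = \sum_j ((c j)%:A : A^c) *: w j.
  exists (fun i => w (enum_val i)) => t; have [c ->] := H t.
  exists (fun i => c (enum_val i)); rewrite (reindex_onto enum_val enum_rank) /=.
    by apply: eq_bigl => i; rewrite enum_valK eqxx.
  by move=> j _; rewrite enum_rankK.
pose S (t : tensor N M) := exists c : J -> K, t = \sum_j ((c j)%:A : A^c) *: w j.
have SB u v : S u -> S v -> S (u - v).
  move=> [c ->] [d ->]; exists (fun j => c j - d j); rewrite -sumrB.
  by apply: eq_bigr => j _; apply/eqP; rewrite subr_eq -scaleK_D subrK eqxx.
have S0 : S 0 by exists (fun=> 0); rewrite big1 // => j _; rewrite scaleK_0.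
have SD u v : S u -> S v -> S (u + v).
  by move=> Su Sv; rewrite -[v]opprK -[- v]sub0r; apply/SB/SB.
have SZ c u : S u -> S ((c%:A : A^c) *: u).
  move=> [d ->]; exists (fun j => c * d j); rewrite scaler_sumr.
  by apply: eq_bigr => j _; rewrite scaleK_M.
have Sw j : S (w j).
  exists (fun j' => (j' == j)%:R); rewrite (bigD1 j) //= eqxx scaleK_1 big1 ?addr0 //.
  by move=> j' /negPf ->; rewrite scaleK_0.
have Ssum I (s : seq I) (G : I -> tensor N M) : (forall i, S (G i)) -> S (\sum_(i <- s) G i).
  by move=> SG; elim/big_ind: _ => // ? ? ? ?; apply: SD.
elim/tens_ind: t => // n m; rewrite -/(S _); have [s ->] := gM m.
rewrite tens_sumr; apply: (Ssum) => -[[f i] a] /=.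
rewrite bact_left -tens_mid; have [c] := eN ((f : F^c) *: n).
rewrite big_ord1 => ->; rewrite -tens_scale; apply: (SZ).
have [d ->] := bA a; rewrite bact_sumr tens_sumr; apply: (Ssum) => j.
rewrite bactZr -tens_mid -tens_scale; apply: (SZ); exact: (Sw (i, j)).
Qed.

(** * The free algebra *)

Section FreeAlgebraTheory.
Variable K : fieldType.
Local Notation F := (free_alg2 K).

Definition letter (b : bool) : F := << fmu b >>.

Lemma free_alg2_ind (P : F -> Prop) :
  (forall f g, P f -> P g -> P (f + g)) -> (forall c f, P f -> P (c *: f)) ->
  (forall f g, P f -> P g -> P (f * g)) -> P 1 -> (forall b, P (letter b)) ->
  forall f, P f.
Proof.
move=> PD PZ PM P1 Pl f; have P0 : P 0 by rewrite -(scale0r 1); apply: (PZ).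
rewrite [f]monalgE; elim/big_ind: _ => // m _.
have -> : << f@_m *g m >> = f@_m *: << m >> :> F.
  by apply/malgP => k; rewrite mcoeffZ !mcoeffU mulr_natr.
apply: (PZ); case: m => s; elim: s => [|b s IH].
  have -> : FMonom [::] = mone :> {fmonom bool} by apply: val_inj; rewrite /= fm1.
  exact: P1.
have -> : FMonom (b :: s) = mmul (fmu b) (FMonom s) :> {fmonom bool}.
  by apply: val_inj; rewrite /= fmM fmU.
have -> : << mmul (fmu b) (FMonom s) >> = letter b * << FMonom s >> :> F.
  by rewrite malgM_def fgmulUU mul1r.
exact: PM.
Qed.

(** A one-parameter family of pairwise non-isomorphic modules on a line. *)
Section Line.
Variable l : K.

Definition line_monom (m : {fmonom bool}) : K := \prod_(b <- (m : seq bool)) (if b then l else 0).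

Fact line_monom_morph : mmorphism line_monom.
Proof.
by split=> [m m'|]; rewrite /line_monom ?fmM ?big_cat // fm1 big_nil.
Qed.
HB.instance Definition _ := isMultiplicative.Build {fmonom bool} K line_monom
  line_monom_morph.

Definition line_fun (f : F) : 'M[K]_1 := (mmap idfun line_monom f)%:M.

Lemma line_rep : mxrep F 1.
Proof.
apply: (@MxRep _ _ _ line_fun) => [f g|c f||f g]; rewrite /line_fun.
- by rewrite mmapD raddfD.
- by rewrite mmapZ scale_scalar_mx.
- by rewrite mmap1.
by rewrite [mmap _ _ _](rmorphM (mmap idfun line_monom)) scalar_mxM.
Defined.

Definition line : rmodType F := mxmod line_rep.

Lemma line_letter (v : line) :
  (letter true : F^c) *: v = (l *: (v : 'rV_1) : 'rV_1) :> line.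
Proof.
rewrite mxmod_scaleE /= /line_fun /letter mmapU /= /line_monom fmU big_seq1 mul1r.
by rewrite mul_mx_scalar.
Qed.

Lemma line_scale c (v : line) :
  (c%:A : F^c) *: v = (c *: (v : 'rV_1) : 'rV_1) :> line.
Proof. by rewrite mxmod_scaleE mxrepZ mxrep1 scalemx1 mul_mx_scalar. Qed.

Lemma line_spans : spans (fun _ : 'I_1 => const_mx 1 : line).
Proof.
move=> v; exists (fun=> (v : 'rV_1) 0 0); rewrite big_ord1 line_scale.
by apply/rowP => i; rewrite !mxE mulr1 ord1.
Qed.

End Line.

Lemma line_inj l l' : rmod_iso (line l) (line l') -> l = l'.
Proof.
case=> f [g fg gf]; pose u : line l := const_mx 1.
have u0 : f u != 0.
  apply/eqP => fu; have : u = 0 by apply: (can_inj fg); rewrite fu raddf0.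
  by move/rowP/(_ 0); rewrite !mxE => /eqP; rewrite oner_eq0.
have : f ((letter true : F^c) *: u) = f ((l%:A : F^c) *: u).
  by rewrite line_letter line_scale.
rewrite !linearZ /= line_letter line_scale => /eqP.
rewrite -subr_eq0 -[_ - _](scalerBl (l' : K) l (f u : 'rV_1)) scaler_eq0 subr_eq0.
by case/orP=> [/eqP //|fu]; case/negP: u0.
Qed.

End FreeAlgebraTheory.

(** The lines give infinitely many modules over the free algebra.  Their tensor
    products with the bimodule are pairwise non-isomorphic, but have bounded
    dimension, and a finite type leaves room for finitely many such modules
    only. *)
Theorem wild_not_finite (K : fieldType) (A : algType K) :
  injective (fun n : nat => n%:R : K) ->
  (exists n (b : 'I_n -> A), forall a, exists c, a = \sum_(i < n) c i *: b i) ->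
  wild_rep_type A -> ~ finite_rep_type A.
Proof.
move=> K0 fA [M [Mfg _ wild]] fin.
have [r Hr] := tensor_line_spans fA Mfg.
have [C [Z HZ]] := finite_bounded r fin.
have cl (n : nat) : {c | rmod_iso (tensor (line (n%:R : K)) M) (Z c)}.
  apply: cid; have [e' eV] := Hr _ _ (@line_spans K n%:R); exact: HZ eV.
pose h (i : 'I_#|C|.+1) := sval (cl i).
have /injectivePn[i [j ij hij]] : ~~ injectiveb h.
  apply/negP => /injectiveP/leq_card; rewrite card_ord ltnn //.
have fl n : fin_dim (line (n%:R : K)) by exists 1, (fun=> const_mx 1); apply: (@line_spans K n%:R).
apply: (wild _ _ (fl i) (fl j)).
  by move/line_inj/K0/val_inj => eij; rewrite eij eqxx in ij.
apply: rmod_iso_trans (svalP (cl i)) _; apply: rmod_iso_sym.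
by have := svalP (cl j); rewrite -/(h j) -hij.
Qed.

(** * The algebras are finite-dimensional *)

Section FiniteDim.
Variables (K : fieldType) (p x : nat) (hx : (0 < x)%N).
Local Notation A := (KQp_quot K p hx).
Local Notation q := p.-1.

Let qb (r : qpath (Qp p)) : A := qpi (Ix K p hx) (pbasis K r).

Lemma qb_cons (v : vertex (Qp p)) a s (w : walk v (a :: s)) (w' : walk (target a) s) :
  qb (QPath (w : walk (v, a :: s).1 (v, a :: s).2)) =
  gen_a K hx a * qb (@QPath (Qp p) (target a, s) w').
Proof.
have /andP[/eqP sa _] := w.
rewrite /gen_a -qpiM pbasisM /pbasis_mul.
have -> // : pcat (arrow_path a) (@QPath (Qp p) (target a, s) w') = Some (QPath (w : walk (v, a :: s).1 (v, a :: s).2)).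
by apply/pcatP; split.
Qed.

Lemma qb_loops s (w : walk (ord_max : vertex (Qp p)) s) :
  qb (@QPath (Qp p) (ord_max : vertex (Qp p), s) w) = gen_a K hx None ^+ size s * gen_v K hx ord_max.
Proof.
elim: s w => [|a s IH] w.
  by rewrite expr0 mul1r /qb /gen_v; congr (qpi _ (pbasis K _)); apply: val_inj.
case: a w => [i|] w.
  have /andP[/eqP/(congr1 val) /= ei _] := w.
  by have := ltn_ord i; rewrite ei ltnn.
have /andP[_ w'] := w.
by rewrite (qb_cons _ w') IH exprS mulrA.
Qed.

(** A long path runs through the loop at least [x] times. *)
Lemma qb_long (v : vertex (Qp p)) s (w : walk v s) :
  (q - v + x <= size s)%N -> qb (@QPath (Qp p) (v, s) w) = 0.
Proof.
elim: s v w => [|a s IH] v w.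
  by rewrite leqn0 addn_eq0 [x == _]gtn_eqF ?andbF.
case: a w => [i|] w le; have /andP[/eqP sa w'] := w; last first.
  have sa' : ord_max = v := sa; subst v.
  rewrite qb_loops; rewrite subnn add0n in le.
  by rewrite -(subnK le) exprD gen_loop mulr0 mul0r.
rewrite (qb_cons _ w') IH ?mulr0 //=.
have vi : v = i :> nat by rewrite -sa.
move: le; rewrite vi /= /bump /= add1n => le.
by rewrite -ltnS; apply: leq_trans le; rewrite -addSn subnSK.
Qed.

Lemma KQp_finite_dim :
  exists n (b : 'I_n -> A), forall a, exists c, a = \sum_(i < n) c i *: b i.
Proof.
pose L := (q + x)%N; pose J : finType := ('I_q.+1 * L.-bseq (option 'I_q))%type.
pose e (j : J) : A := if insub (j.1 : vertex (Qp p), j.2 : seq (arrow (Qp p))) is Some r then qb r else 0.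
suff H a : exists c : J -> K, a = \sum_j c j *: e j.
  exists #|J|, (fun i => e (enum_val i)) => a; have [c ->] := H a.
  exists (fun i => c (enum_val i)); rewrite (reindex_onto enum_val enum_rank) /=.
    by apply: eq_bigl => i; rewrite enum_valK eqxx.
  by move=> j _; rewrite enum_rankK.
have [b ->] := qpi_surj a; rewrite [b]pa_decomp qpi_sum.
elim/big_ind: _ => [|_ _ [c ->] [d ->]|r _].
- by exists (fun=> 0); rewrite big1 // => j _; rewrite scale0r.
- exists (fun j => c j + d j); rewrite -big_split; apply: eq_bigr => j _.
  by rewrite scalerDl.
case: r => -[v s] w; case: (leqP L (size s)) => [le|lt].
  exists (fun=> 0); rewrite big1 => [|j _]; last by rewrite scale0r.
  rewrite qpiZ -/(qb _) qb_long ?scaler0 //.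
  by apply: leq_trans le; rewrite leq_add2r leq_subr.
pose j0 : J := (v, Bseq (ltnW lt)).
exists (fun j => if j == j0 then b@_(QPath w) else 0).
rewrite (bigD1 j0) //= eqxx big1 ?addr0 => [|j /negPf ->]; last by rewrite scale0r.
rewrite qpiZ; congr (_ *: _); rewrite /e /=.
by have := valK (QPath w); rewrite /= => ->.
Qed.

End FiniteDim.

(** * Bimodules given by matrices over an algebra *)

Section Bimodules.
Variables (K : fieldType) (F : algType K) (p x : nat) (hx : (0 < x)%N).
Local Notation A := (KQp_quot K p hx).
Local Notation PA := (path_alg K (Qp p)).
Local Notation q := p.-1.
Local Notation arr := (option 'I_q).
Local Notation src := (@source (Qp p)).
Local Notation tgt := (@target (Qp p)).

(** The rows of a free module are indexed by [I]; each row belongs to a vertex,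
    and row [j] of the image under the arrow [a] is the combination [coef a j]
    of the rows of the argument. *)
Variables (I : finType) (vert : I -> 'I_q.+1) (coef : arr -> I -> seq (I * F)).

Hypothesis coef_tgt : forall a j, coef a j != [::] -> vert j = tgt a.
Hypothesis coef_src : forall a j u, u \in coef a j -> vert u.1 = src a.

Definition vertex_op (V : zmodType) (v : 'I_q.+1) (m : {ffun I -> V}) : {ffun I -> V} :=
  [ffun i => if vert i == v then m i else 0].

Definition arrow_op (N : rmodType F) (a : arr) (m : {ffun I -> N}) : {ffun I -> N} :=
  [ffun j => \sum_(u <- coef a j) (u.2 : F^c) *: m u.1].

Definition free_mod := {ffun I -> F^o}.
HB.instance Definition _ := GRing.Lmodule.on free_mod.

Definition free_vertex v (m : free_mod) : free_mod := vertex_op v m.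

Definition free_arrow (a : arr) (m : free_mod) : free_mod :=
  [ffun j => \sum_(u <- coef a j) m u.1 * u.2].

Hypothesis loop_nilp : forall m, iter x (free_arrow None) m = 0.

Lemma free_vertexD v : {morph free_vertex v : m n / m + n}.
Proof. by move=> m n; apply/ffunP => i; rewrite !ffunE; case: ifP; rewrite ?addr0. Qed.

Lemma free_vertexZ v (f : F) m : free_vertex v (f *: m) = f *: free_vertex v m.
Proof. by apply/ffunP => i; rewrite !ffunE; case: ifP; rewrite ?scaler0. Qed.

Lemma free_arrowD a : {morph free_arrow a : m n / m + n}.
Proof.
move=> m n; apply/ffunP => i; rewrite !ffunE -big_split; apply: eq_bigr => u _.
by rewrite ffunE mulrDl.
Qed.

Lemma free_arrowZ a (f : F) m : free_arrow a (f *: m) = f *: free_arrow a m.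
Proof.
apply/ffunP => i; rewrite !ffunE scaler_sumr; apply: eq_bigr => u _.
by rewrite ffunE -[RHS]/(f * (m u.1 * u.2)) mulrA.
Qed.

Lemma free_vertex_vertex v w m :
  free_vertex w (free_vertex v m) = if v == w then free_vertex v m else 0.
Proof.
apply/ffunP => i; rewrite !ffunE (fun_if (fun f : free_mod => f i)) !ffunE.
case: (eqVneq v w) => [->|nvw]; first by case: (vert i == w).
case: (eqVneq (vert i) w) => [->|] //.
by rewrite eq_sym (negPf nvw).
Qed.

Lemma free_vertex_sum m : \sum_v free_vertex v m = m.
Proof.
apply/ffunP => i; rewrite sum_ffunE (bigD1 (vert i)) //= ffunE eqxx.
by rewrite big1 ?addr0 // => v /negPf nv; rewrite ffunE eq_sym nv.
Qed.

Lemma free_vertex_arrow v a m :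
  free_vertex v (free_arrow a m) = if v == tgt a then free_arrow a m else 0.
Proof.
apply/ffunP => j; rewrite ffunE (fun_if (fun f : free_mod => f j)) !ffunE.
case: (eqVneq (coef a j) [::]) => [->|/coef_tgt ->]; last by rewrite eq_sym.
by rewrite big_nil !if_same.
Qed.

Lemma free_arrow_vertex v a m :
  free_arrow a (free_vertex v m) = if v == src a then free_arrow a m else 0.
Proof.
apply/ffunP => j; rewrite (fun_if (fun f : free_mod => f j)) !ffunE.
case: ifP => [/eqP ->|nv].
  by rewrite !big_seq; apply: eq_bigr => u /coef_src us; rewrite ffunE us eqxx.
rewrite big_seq big1 // => u /coef_src us.
by rewrite ffunE us eq_sym nv mul0r.
Qed.

Definition path_act (r : qpath (Qp p)) (m : free_mod) : free_mod :=
  foldl (fun n a => free_arrow a n) (free_vertex (pstart r) m) (parrows r).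

Lemma path_actD r : {morph path_act r : m n / m + n}.
Proof.
move=> m n; rewrite /path_act free_vertexD.
elim: (parrows r) (free_vertex _ m) (free_vertex _ n) => //= a s IH u v.
by rewrite free_arrowD IH.
Qed.

Lemma path_actZ r (f : F) m : path_act r (f *: m) = f *: path_act r m.
Proof.
rewrite /path_act free_vertexZ.
by elim: (parrows r) (free_vertex _ m) => //= a s IH u; rewrite free_arrowZ IH.
Qed.

Lemma vertex_path_act v r m :
  free_vertex v (path_act r m) = if v == pend r then path_act r m else 0.
Proof.
case: r => -[w s] ws; rewrite /path_act /pend /pstart /parrows /=.
elim/last_ind: s ws => [|s a IH] ws /=.
  by rewrite free_vertex_vertex eq_sym; case: eqP => // ->.
by rewrite foldl_rcons map_rcons last_rcons free_vertex_arrow.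
Qed.

Lemma path_act_cat r s m : path_act s (path_act r m) =
  if pcat r s is Some t then path_act t m else 0.
Proof.
rewrite {1}/path_act vertex_path_act; case: (eqVneq (pstart s) (pend r)) => [e|ne].
  have [t et] := pcat_some (esym e); rewrite et.
  case/pcatP: et => _ e1 e2; rewrite /path_act e1 e2 foldl_cat; by [].
rewrite /pcat eq_sym (negPf ne).
have z a : free_arrow a 0 = 0.
  by rewrite -(scale0r (0 : free_mod)) free_arrowZ !scale0r.
by elim: (parrows s) => //= a l IH; rewrite z.
Qed.

Definition alg_act (m : free_mod) (f : PA) : free_mod :=
  \sum_(r <- msupp f) (f@_r)%:A *: path_act r m.

Lemma alg_actw (d : {fset qpath (Qp p)}) m (f : PA) : (msupp f `<=` d)%fset ->
  alg_act m f = \sum_(r <- d) (f@_r)%:A *: path_act r m.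
Proof.
move=> le; apply: big_fset_incl => // k _ /mcoeff_outdom ->.
by rewrite !scale0r.
Qed.

Lemma alg_actDr m : {morph alg_act m : f g / f + g}.
Proof.
move=> f g; set d := (msupp f `|` msupp g)%fset.
rewrite (@alg_actw d) ?msuppD_le // (@alg_actw d _ f) ?fsubsetUl //.
rewrite (@alg_actw d _ g) ?fsubsetUr // -big_split; apply: eq_bigr => r _.
by rewrite mcoeffD !scalerDl.
Qed.

Lemma alg_actZr m c (f : PA) : alg_act m (c *: f) = (c%:A : F) *: alg_act m f.
Proof.
rewrite (@alg_actw (msupp f)) ?msuppZ_le // scaler_sumr; apply: eq_bigr => r _.
by rewrite mcoeffZ scalerA; congr (_ *: _); rewrite -scalerAl mul1r scalerA.
Qed.

Lemma alg_act_basis m r : alg_act m (pbasis K r) = path_act r m.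
Proof.
rewrite (@alg_actw [fset r]%fset); last by rewrite pbasis.unlock; exact: msuppU_le.
by rewrite big_seq_fset1 mcoeff_pbasis eqxx scale1r scale1r.
Qed.

Lemma alg_act0r m : alg_act m 0 = 0.
Proof. by rewrite -(scale0r (0 : PA)) alg_actZr !scale0r. Qed.

Lemma alg_actDl f : {morph alg_act^~ f : m n / m + n}.
Proof.
move=> m n; rewrite -big_split; apply: eq_bigr => r _.
by rewrite path_actD scalerDr.
Qed.

Lemma alg_actZl (g : F) m f : alg_act (g *: m) f = g *: alg_act m f.
Proof.
rewrite scaler_sumr; apply: eq_bigr => r _; rewrite path_actZ !scalerA.
by congr (_ *: _); rewrite -scalerAl mul1r -scalerAr mulr1.
Qed.

Lemma alg_act0l f : alg_act 0 f = 0.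
Proof. by rewrite -(scale0r (0 : free_mod)) alg_actZl !scale0r. Qed.

Lemma alg_act_sumr m J (s : seq J) (f : J -> PA) :
  alg_act m (\sum_(j <- s) f j) = \sum_(j <- s) alg_act m (f j).
Proof. exact: (big_morph _ (alg_actDr m) (alg_act0r m)). Qed.

Lemma alg_act1 m : alg_act m 1 = m.
Proof.
rewrite [1]/(pa_one _ _) /pa_one alg_act_sumr -[RHS]free_vertex_sum.
by apply: eq_bigr => v _; rewrite alg_act_basis.
Qed.

Lemma alg_actM m f g : alg_act m (f * g) = alg_act (alg_act m f) g.
Proof.
have H r : alg_act m (pbasis K r * g) = alg_act (path_act r m) g.
  rewrite [g]pa_decomp mulr_sumr !alg_act_sumr; apply: eq_bigr => s _.
  rewrite -scalerAr !alg_actZr; congr (_ *: _).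
  rewrite pbasisM alg_act_basis path_act_cat /pbasis_mul.
  by case: pcat => [t|]; rewrite ?alg_act_basis ?alg_act0r.
rewrite {1}[f]pa_decomp mulr_suml alg_act_sumr.
rewrite (big_morph (alg_act^~ g) (alg_actDl g) (alg_act0l g)).
by apply: eq_bigr => r _; rewrite -scalerAl alg_actZr alg_actZl H.
Qed.

Lemma alg_act_loop m : alg_act m (alpha K p ^+ x) = 0.
Proof.
have H n : alg_act m (alpha K p ^+ n) = iter n (free_arrow None) m.
  elim: n => [|n IH]; first by rewrite expr0 alg_act1.
  rewrite exprSr alg_actM IH iterS alg_act_basis /path_act /=.
  by rewrite free_arrow_vertex eqxx.
by rewrite H loop_nilp.
Qed.

Lemma alg_act_ideal m f : f \in Ix K p hx -> alg_act m f = 0.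
Proof.
move=> /asboolP[s ->]; rewrite alg_act_sumr big1 // => u _.
by rewrite !alg_actM alg_act_loop alg_act0l.
Qed.

Definition quot_act (m : free_mod) (a : A) : free_mod := alg_act m (repr a).

Lemma quot_act_pi m f : quot_act m (qpi (Ix K p hx) f) = alg_act m f.
Proof.
rewrite /quot_act -[repr _](subrK f) alg_actDr alg_act_ideal ?add0r //.
exact: qa_repr.
Qed.

Fact quot_actDl a : {morph quot_act^~ a : m n / m + n}.
Proof. exact: alg_actDl. Qed.
Fact quot_actDr m : {morph quot_act m : a b / a + b}.
Proof.
move=> a b; have [f ->] := qpi_surj a; have [g ->] := qpi_surj b.
by rewrite -qpiD !quot_act_pi alg_actDr.
Qed.
Fact quot_act1 m : quot_act m 1 = m.
Proof. by rewrite -(qpi1 (Ix K p hx)) quot_act_pi alg_act1. Qed.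
Fact quot_actM m a b : quot_act m (a * b) = quot_act (quot_act m a) b.
Proof.
have [f ->] := qpi_surj a; have [g ->] := qpi_surj b.
by rewrite -qpiM !quot_act_pi alg_actM.
Qed.
Fact quot_act_left (f : F) m a : quot_act (f *: m) a = f *: quot_act m a.
Proof. exact: alg_actZl. Qed.
Fact quot_actZ m (c : K) : quot_act m c%:A = (c%:A : F) *: m.
Proof. by rewrite -(qpi1 (Ix K p hx)) -qpiZ quot_act_pi alg_actZr alg_act1. Qed.

Definition free_bimod : bimodule F A :=
  Bimodule quot_actDl quot_actDr quot_act1 quot_actM quot_act_left quot_actZ.

Lemma quot_act_v m v : quot_act m (gen_v K hx v) = free_vertex v m.
Proof. by rewrite quot_act_pi alg_act_basis. Qed.

Lemma quot_act_a m a : quot_act m (gen_a K hx a) = free_arrow a m.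
Proof.
by rewrite quot_act_pi alg_act_basis /path_act /= free_arrow_vertex eqxx.
Qed.

Definition unit_row (i : I) : free_mod := [ffun j => (j == i)%:R].

Lemma free_mod_sum (m : free_mod) : m = \sum_i (m i : F) *: unit_row i.
Proof.
apply/ffunP => j; rewrite sum_ffunE (bigD1 j) //= !ffunE eqxx.
rewrite -[_ *: _]/(m j * 1) mulr1 big1 ?addr0 // => i ni.
by rewrite !ffunE eq_sym (negPf ni) scaler0.
Qed.

Lemma free_bimod_fin_gen : bimod_fin_gen free_bimod.
Proof.
exists #|I|, (fun i => unit_row (enum_val i)) => m.
exists [seq (m i : F, enum_rank i, 1 : A) | i <- enum I].
rewrite big_map big_enum /= {1}[m]free_mod_sum; apply: eq_bigr => i _ /=.
by rewrite enum_rankK; apply: esym; apply: quot_act1.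
Qed.

Lemma free_bimod_free : left_free free_bimod.
Proof.
pose h (f : {malg F[I]}) : free_mod := [ffun i => f@_i].
have hB : zmod_morphism h.
  by move=> f g; apply/ffunP => i; rewrite !ffunE mcoeffB.
have hZ : scalable h.
  by move=> c f; apply/ffunP => i; rewrite !ffunE mcoeffZ.
pose h1 := GRing.isZmodMorphism.Build {malg F[I]} free_mod h hB.
pose h2 := GRing.isScalable.Build F {malg F[I]} free_mod *:%R h hZ.
pose hl : {linear {malg F[I]} -> free_mod} := HB.pack h h1 h2.
have gE (m : free_mod) k : (\sum_i << (m i : F) *g i >> : {malg F[I]})@_k = m k.
  rewrite raddf_sum (bigD1 k) //= mcoeffUU big1 ?addr0 // => i /negPf ni.
  by rewrite mcoeffU ni.
have hbij : bijective h.
  exists (fun m : free_mod => (\sum_i << (m i : F) *g i >> : {malg F[I]})).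
    by move=> f; apply/malgP => k; rewrite gE ffunE.
  by move=> m; apply/ffunP => k; rewrite ffunE gE.
by exists I, hl.
Qed.

End Bimodules.

(** * Tensor products with these bimodules *)

Section TensorFree.
Variables (K : fieldType) (F : algType K) (p x : nat) (hx : (0 < x)%N).
Local Notation A := (KQp_quot K p hx).
Local Notation q := p.-1.
Local Notation arr := (option 'I_q).
Variables (I : finType) (vert : I -> 'I_q.+1) (coef : arr -> I -> seq (I * F)).
Hypothesis coef_tgt : forall a j, coef a j != [::] -> vert j = @target (Qp p) a.
Hypothesis coef_src : forall a j u, u \in coef a j -> vert u.1 = @source (Qp p) a.
Hypothesis loop_nilp : forall m, iter x (free_arrow coef None) m = 0.
Local Notation M := (free_bimod hx coef_tgt coef_src loop_nilp).

Section OneModule.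
Variable N : rmodType F.
Local Notation NI := {ffun I -> N}.

(** The tensor product of [N] with the free module on [I] is a power of [N]: the
    tensor [n (x) m] has the coordinates [n . m_i]. *)
Definition pair_coords (k : N * free_mod F I) : NI :=
  [ffun i => (k.2 i : F^c) *: k.1].

Definition sum_coords (g : {malg int[(N * M)%type]}) : NI :=
  \sum_(k <- msupp g) pair_coords k *~ g@_k.

Lemma sum_coordsw (d : {fset N * M}) g : (msupp g `<=` d)%fset ->
  sum_coords g = \sum_(k <- d) pair_coords k *~ g@_k.
Proof.
move=> le; apply: big_fset_incl => // k _ /mcoeff_outdom ->.
by rewrite mulr0z.
Qed.

Lemma sum_coordsB g h : sum_coords (g - h) = sum_coords g - sum_coords h.
Proof.
set d := (msupp g `|` msupp h)%fset.
rewrite (@sum_coordsw d) ?msuppB_le // (@sum_coordsw d g) ?fsubsetUl //.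
rewrite (@sum_coordsw d h) ?fsubsetUr // -sumrB.
by apply: eq_bigr => k _; rewrite mcoeffB mulrzBr.
Qed.

Lemma sum_coords1 k : sum_coords << k >> = pair_coords k.
Proof.
by rewrite (@sum_coordsw [fset k]%fset) ?msuppU_le // big_seq_fset1 mcoeffUU mulr1z.
Qed.

Lemma sum_coords1B k l : sum_coords (<< k >> - << l >>) = pair_coords k - pair_coords l.
Proof. by rewrite sum_coordsB !sum_coords1. Qed.

Lemma sum_coords1BB k l m : sum_coords (<< k >> - << l >> - << m >>) =
  pair_coords k - pair_coords l - pair_coords m.
Proof. by rewrite sum_coordsB sum_coords1B sum_coords1. Qed.

Lemma sum_coords0 : sum_coords 0 = 0.
Proof. by rewrite -(subrr (0 : {malg int[(N * M)%type]})) sum_coordsB subrr. Qed.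

Lemma sum_coords_rel g : g \in gen_subgroup (@tensor_rel K F A N M) -> sum_coords g = 0.
Proof.
move=> /asboolP gR; elim: {g} gR => [_ [n n' m|n m m'|n f m]||].
- rewrite sum_coords1BB; apply/ffunP => i; rewrite !ffunE /=.
  by rewrite scalerDr addrAC addrK subrr.
- rewrite sum_coords1BB; apply/ffunP => i; rewrite !ffunE /=.
  by rewrite [X in X - _ - _](scalerDl n (m i : F^c) (m' i)) addrAC addrK subrr.
- rewrite sum_coords1B; apply/ffunP => i; rewrite !ffunE /=.
  by rewrite scalerA subrr.
- exact: sum_coords0.
by move=> g h _ g0 _ h0; rewrite sum_coordsB g0 h0 subrr.
Qed.

Definition coords (t : tensor N M) : NI := sum_coords (repr t).

Lemma coords_pi g :
  coords (\pi_(Quotient.quot (gen_subgroup (@tensor_rel K F A N M))) g) = sum_coords g.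
Proof.
apply/eqP; rewrite -subr_eq0 -sum_coordsB; apply/eqP/sum_coords_rel.
by apply/tensor_piP; rewrite reprK.
Qed.

Lemma coords_tens n (m : M) : coords (tens n m) = pair_coords (n, m).
Proof. by rewrite [LHS]coords_pi sum_coords1. Qed.

Lemma coordsB t u : coords (t - u) = coords t - coords u.
Proof.
rewrite -[t]reprK -[u]reprK.
rewrite -(raddfB \pi_(Quotient.quot (gen_subgroup (@tensor_rel K F A N M)))).
by rewrite !coords_pi sum_coordsB.
Qed.

Lemma coords0 : coords 0 = 0.
Proof. by rewrite -(subrr 0) coordsB subrr. Qed.

Lemma coordsD t u : coords (t + u) = coords t + coords u.
Proof. by rewrite -{1}[u]opprK -[- u]sub0r !coordsB coords0 sub0r opprK. Qed.

Definition of_coords (n : NI) : tensor N M := \sum_i tens (n i) (unit_row F i : M).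

Lemma of_coordsD m n : of_coords (m + n) = of_coords m + of_coords n.
Proof. by rewrite -big_split; apply: eq_bigr => i _; rewrite ffunE tensDl. Qed.

Lemma of_coordsK : cancel of_coords coords.
Proof.
move=> n; rewrite /of_coords (big_morph coords coordsD coords0).
apply/ffunP => j; rewrite sum_ffunE (bigD1 j) //= coords_tens ffunE /= ffunE eqxx.
rewrite [_ *: _]scale1r big1 ?addr0 // => i /negPf nij.
by rewrite coords_tens !ffunE /= eq_sym nij; exact: scale0r.
Qed.

Lemma coordsK : cancel coords of_coords.
Proof.
elim/tens_ind => [n m||t u tK uK].
- rewrite coords_tens {2}[m](@free_mod_sum K F I m) tens_sumr; apply: eq_bigr => i _.
  by rewrite ffunE /= tens_mid.
- by rewrite coords0 /of_coords big1 // => i _; rewrite ffunE tens0l.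
have ofN n : of_coords (- n) = - of_coords n.
  by rewrite /of_coords -sumrN; apply: eq_bigr => i _; rewrite ffunE; apply/eqP;
     rewrite -subr_eq0 opprK -tensDl addNr tens0l.
by rewrite coordsB of_coordsD ofN tK uK.
Qed.

Lemma coords_v v t : coords ((gen_v K hx v : A^c) *: t) = vertex_op vert v (coords t).
Proof.
elim/tens_ind: t => [n m||t u tK uK].
- rewrite tens_act coords_tens [bact _ _](quot_act_v hx coef_tgt coef_src loop_nilp) coords_tens.
  apply/ffunP => i; rewrite !ffunE /=; case: ifP => // _; exact: scale0r.
- by rewrite scaler0 coords0; apply/ffunP => i; rewrite !ffunE if_same.
rewrite scalerBr 2!coordsB tK uK; move: (coords t) (coords u) => {tK uK} {}t {}u.
apply/ffunP => i; rewrite !ffunE.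
by case: ifP; rewrite ?subr0.
Qed.

Lemma coords_a a t : coords ((gen_a K hx a : A^c) *: t) = arrow_op coef a (coords t).
Proof.
elim/tens_ind: t => [n m||t u tK uK].
- rewrite tens_act coords_tens [bact _ _](quot_act_a hx coef_tgt coef_src loop_nilp) coords_tens.
  apply/ffunP => i; rewrite !ffunE /=. 
  rewrite [LHS](scaler_suml (V := N)).
  by apply: eq_bigr => u _; rewrite ffunE /= scalerA.
- by rewrite scaler0 coords0; apply/ffunP => i; rewrite !ffunE big1 // => u _; rewrite ffunE scaler0.
rewrite scalerBr 2!coordsB tK uK; move: (coords t) (coords u) => {tK uK} {}t {}u.
apply/ffunP => i; rewrite !ffunE -sumrB.
by apply: eq_bigr => w _; rewrite !ffunE scalerBr.
Qed.

Lemma coords_scale c t :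
  coords ((c%:A : A^c) *: t) = [ffun i => (c%:A : F^c) *: coords t i].
Proof.
elim/tens_ind: t => [n m||t u tK uK].
- rewrite tens_scale 2!coords_tens; apply/ffunP => i; rewrite !ffunE /= !scalerA.
  congr (_ *: _); rewrite -[LHS]/((c%:A : F) * (m i : F)).
  by rewrite -[RHS]/((m i : F) * (c%:A : F)) -scalerAl mul1r -scalerAr mulr1.
- by rewrite scaler0 coords0; apply/ffunP => i; rewrite !ffunE scaler0.
rewrite scalerBr 2!coordsB tK uK; move: (coords t) (coords u) => {tK uK} {}t {}u.
by apply/ffunP => i; rewrite !ffunE scalerBr.
Qed.

End OneModule.

(** Maps of the systems of spaces underlying the tensor products; they are linear
    over the base field only. *)
Definition coords_hom (N N' : rmodType F) (g : {ffun I -> N} -> {ffun I -> N'}) :=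
  [/\ {morph g : m n / m + n},
    forall c (m : {ffun I -> N}),
      g [ffun i => (c%:A : F^c) *: m i] = [ffun i => (c%:A : F^c) *: g m i],
    forall v m, g (vertex_op vert v m) = vertex_op vert v (g m) &
    forall a m, g (arrow_op coef a m) = arrow_op coef a (g m)].

Lemma tensor_iso_coords (N N' : rmodType F) :
  rmod_iso (tensor N M) (tensor N' M) ->
  exists (g : {ffun I -> N} -> {ffun I -> N'}) (g' : {ffun I -> N'} -> {ffun I -> N}),
  [/\ cancel g g', cancel g' g, coords_hom g & coords_hom g'].
Proof.
case=> f [f' fK f'K].
have conj (L L' : rmodType F) (h : {linear tensor L M -> tensor L' M}) :
    coords_hom (fun m => coords (h (of_coords m))).
  have conj (r : {ffun I -> L} -> {ffun I -> L}) (r' : {ffun I -> L'} -> {ffun I -> L'})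
      (a : A) : (forall t : tensor L M, coords ((a : A^c) *: t) = r (coords t)) ->
      (forall t : tensor L' M, coords ((a : A^c) *: t) = r' (coords t)) ->
      forall m, coords (h (of_coords (r m))) = r' (coords (h (of_coords m))).
    move=> e e' m; rewrite -e' -linearZ /=; congr (coords (h _)).
    by apply: (can_inj (@coordsK _)); rewrite e !of_coordsK.
  split.
  - by move=> m n; rewrite of_coordsD raddfD coordsD.
  - move=> c; apply: (conj _ (fun m => [ffun i => (c%:A : F^c) *: m i]) c%:A) => t;
    exact: coords_scale.
  - by move=> v; apply: (conj _ _ (gen_v K hx v)) => t; rewrite coords_v.
  by move=> a; apply: (conj _ _ (gen_a K hx a)) => t; rewrite coords_a.
have f'Z : scalable f'.
  by move=> a t; apply: (can_inj fK); rewrite linearZ /= !f'K.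
have [fl flE] : exists fl : {linear tensor N' M -> tensor N M}, fl =1 f'.
  have f'B : zmod_morphism f'.
    by move=> t u; apply: (can_inj fK); rewrite raddfB /= !f'K.
  pose h1 := GRing.isZmodMorphism.Build _ _ f' f'B.
  pose h2 := GRing.isScalable.Build _ _ _ *:%R f' f'Z.
  by exists (HB.pack f' h1 h2 : {linear tensor N' M -> tensor N M}).
exists (fun m => coords (f (of_coords m))), (fun m => coords (fl (of_coords m))).
split; [ | | exact: conj | exact: conj].
  by move=> m; rewrite coordsK flE fK of_coordsK.
by move=> m; rewrite coordsK flE f'K of_coordsK.
Qed.

End TensorFree.

(** * A criterion for wildness *)

Lemma graded_nilp (K : fieldType) (F : algType K) (p x : nat) (I : finType)
    (coef : option 'I_p.-1 -> I -> seq (I * F)) (lvl : I -> nat) :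
  (forall j, (lvl j < x)%N) ->
  (forall j u, u \in coef None j -> (lvl u.1 < lvl j)%N) ->
  forall m, iter x (free_arrow coef None) m = 0.
Proof.
move=> lx up m; suff H n j : (lvl j < n)%N -> iter n (free_arrow coef None) m j = 0.
  by apply/ffunP => j; rewrite H ?ffunE.
elim: n j => // n IH j jn; rewrite iterS ffunE big_seq big1 // => u uj.
by rewrite IH ?mul0r //; apply: leq_trans (up _ _ uj) jn.
Qed.

(** The witness [w] is a copy of the module inside its system of spaces; if every
    map of systems preserves it and commutes there with the two letters, then
    the system determines the module. *)
Lemma wild_of_witness (K : fieldType) (p x : nat) (hx : (0 < x)%N) (I : finType)
    (vert : I -> 'I_p.-1.+1)
    (coef : option 'I_p.-1 -> I -> seq (I * free_alg2 K))
    (w : forall N : rmodType (free_alg2 K), N -> {ffun I -> N}) (j0 : I) :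
  (forall a j, coef a j != [::] -> vert j = @target (Qp p) a) ->
  (forall a j u, u \in coef a j -> vert u.1 = @source (Qp p) a) ->
  (forall m, iter x (free_arrow coef None) m = 0) ->
  (forall (N : rmodType (free_alg2 K)) n, @w N n j0 = n) ->
  (forall (N : rmodType (free_alg2 K)), {morph @w N : m n / m + n}) ->
  (forall (N : rmodType (free_alg2 K)) (c : K) n, @w N ((c%:A : (free_alg2 K)^c) *: n) =
    [ffun j => (c%:A : (free_alg2 K)^c) *: w N n j]) ->
  (forall (N N' : rmodType (free_alg2 K)) (g : {ffun I -> N} -> {ffun I -> N'}), coords_hom vert coef g ->
    forall n, exists n', g (w N n) = w N' n' /\
    forall b, g (w N ((letter K b : (free_alg2 K)^c) *: n)) =
              w N' ((letter K b : (free_alg2 K)^c) *: n')) ->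
  wild_rep_type (KQp_quot K p hx).
Proof.
move=> ct cs nilp wj wD wZ rigid.
exists (free_bimod hx ct cs nilp); split.
- exact: free_bimod_fin_gen.
- exact: free_bimod_free.
move=> N N' _ _; apply: contra_not => /tensor_iso_coords[g [g' [gK g'K gh g'h]]].
have wI (L : rmodType (free_alg2 K)) (m n : L) : w L m = w L n -> m = n.
  by move=> e; rewrite -[m]wj -[n]wj e.
have lin (L L' : rmodType (free_alg2 K)) (h : {ffun I -> L} -> {ffun I -> L'}) :
    coords_hom vert coef h -> exists a : L -> L', [/\ {morph a : m n / m + n},
      forall f n, a ((f : (free_alg2 K)^c) *: n) = (f : (free_alg2 K)^c) *: a n &
      forall n, h (w L n) = w L' (a n)].
  move=> hh; have [a ha] := choice (rigid _ _ _ hh).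
  have {}hw n : h (w L n) = w L' (a n) by case: (ha n).
  have aD : {morph a : m n / m + n}.
    by case: hh => hD _ _ _ m n; apply: (wI L'); rewrite -hw wD hD !hw wD.
  exists a; split=> //; elim/free_alg2_ind => [f f' Hf Hf'|c f Hf|f f' Hf Hf'||b] n.
  - by rewrite (scalerDl n (f : (free_alg2 K)^c) f') aD Hf Hf' -scalerDl.
  - have e (L1 : rmodType (free_alg2 K)) (n1 : L1) : (c *: f : (free_alg2 K)^c) *: n1 =
      (f : (free_alg2 K)^c) *: ((c%:A : (free_alg2 K)^c) *: n1).
      rewrite scalerA; congr (_ *: _); rewrite -[RHS]/((c%:A : free_alg2 K) * f).
      by rewrite -scalerAl mul1r.
    rewrite e Hf e.
    apply: (congr1 (fun n2 : L' => (f : (free_alg2 K)^c) *: n2)).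
    apply: (wI L').
    by case: hh => _ hZ _ _; rewrite -hw !wZ hZ hw.
  - have e (L1 : rmodType (free_alg2 K)) (n1 : L1) : (f * f' : (free_alg2 K)^c) *: n1 =
      (f' : (free_alg2 K)^c) *: ((f : (free_alg2 K)^c) *: n1) by rewrite scalerA.
    by rewrite !e Hf' Hf.
  - by rewrite [LHS](_ : _ = a n) ?[RHS](_ : _ = a n) //; [|congr a]; exact: scale1r.
  by apply: (wI L'); case: (ha n) => _ <-; rewrite hw.
have [a [aD aZ ga]] := lin _ _ _ gh; have [a' [_ _ g'a']] := lin _ _ _ g'h.
apply: (rmod_isoI (f := a) (g := a') aD aZ) => n; apply: wI.
  by rewrite -g'a' -ga gK.
by rewrite -ga -g'a' g'K.
Qed.

(** * Pairs with an operator that encodes two operators *)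

Section Pencil.
Variables (K : fieldType) (F : algType K) (X : bool -> F).

Definition pencil (N : rmodType F) (n : N * N) : N * N :=
  ((X true : F^c) *: n.1 + (X false : F^c) *: n.2, n.1).

Definition pick (T : Type) (t : T * T) (b : bool) : T := if b then t.2 else t.1.

Lemma pickE (T : Type) (t t' : T * T) : (forall b, pick t b = pick t' b) -> t = t'.
Proof.
by case: t t' => [a b] [a' b'] e; rewrite (e false : a = a') (e true : b = b').
Qed.

(** Write [X] and [Y] for [X true] and [X false], and [k (n, 0) = (a n, 0)].
    Applying [k] to [pencil (n, 0) = (X n, n)] gives
    [k (0, n) = (X (a n) - a (X n), a n)]; applying it to
    [pencil (0, n) = (Y n, 0)] then shows that [a] commutes with [X] and [Y]. *)
Lemma pencil_rigid (N N' : rmodType F) (k : N * N -> N' * N') :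
  {morph k : m n / m + n} -> (forall n, k (pencil n) = pencil (k n)) ->
  (forall n, exists n', k (n, 0) = (n', 0)) ->
  forall n, exists n', k (n, 0) = (n', 0) /\
  forall b, k ((X b : F^c) *: n, 0) = ((X b : F^c) *: n', 0).
Proof.
move=> kD kP kL n; have [a ea] := kL n; exists a; split=> //.
have [c ec] := kL ((X true : F^c) *: n); have [d ed] := kL ((X false : F^c) *: n).
have k0n : k (0, n) = ((X true : F^c) *: a - c, a).
  have e : ((X true : F^c) *: n, 0) + (0, n) = pencil (n, 0).
    by rewrite /pencil /= scaler0; congr pair; rewrite ?addr0 ?add0r.
  have := kD ((X true : F^c) *: n, 0) (0, n); rewrite e kP ea ec => e'.
  apply: (addrI ((c, 0) : N' * N')); rewrite -e' /pencil /= scaler0 addr0.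
  by congr pair; rewrite /= ?add0r // addrC subrK.
have := kP (0, n); rewrite k0n /pencil /= scaler0 add0r ed => -[ed' /esym/eqP].
rewrite subr_eq0 => /eqP ac; rewrite ed' ac subrr scaler0 add0r in ec ed *.
by case; [rewrite ec ac | rewrite ed].
Qed.

End Pencil.

(** * The case of a loop of order four *)

Section LoopFour.
Variables (K : fieldType) (F : algType K) (X : bool -> F).
Variables (p : nat) (i0 : 'I_p.-1) (i0E : i0.+1 = p.-1).

(** The rows at the last vertex, of degree 0 to 3, and at the vertex before. *)
Definition row4 : finType :=
  (bool + (bool * bool) + (bool * bool) + (bool * bool) +
   (unit + bool + bool + bool))%type.
Local Notation v0 b := (inl (inl (inl (inl b)))).
Local Notation v1 l := (inl (inl (inl (inr l)))).
Local Notation v2 l := (inl (inl (inr l))).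
Local Notation v3 l := (inl (inr l)).
Local Notation u0 := (inr (inl (inl (inl tt)))).
Local Notation u1 b := (inr (inl (inl (inr b)))).
Local Notation u2 b := (inr (inl (inr b))).
Local Notation u3 b := (inr (inr b)).

Definition vert4 (j : row4) : 'I_p.-1.+1 :=
  if j is inl _ then ord_max else widen_ord (leqnSn _) i0.

(** A vector [v] of degree zero enters degree one as [(v, pencil v)]; the lower
    space consists of the line [N * 0] in degree zero, the two summands of
    degrees one and two, and the diagonal of degree three. *)
Definition coef4 (a : option 'I_p.-1) (j : row4) : seq (row4 * F) :=
  match a with
  | None => match j with
    | v1 (false, b) => [:: (v0 b, 1)]
    | v1 (true, false) => [:: (v0 false, X true); (v0 true, X false)]
    | v1 (true, true) => [:: (v0 false, 1)]
    | v2 l => [:: (v1 l, 1)]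
    | v3 l => [:: (v2 l, 1)]
    | _ => [::]
    end
  | Some i => if i == i0 then match j with
    | v0 false => [:: (u0, 1)]
    | v1 (false, b) => [:: (u1 b, 1)]
    | v2 (true, b) => [:: (u2 b, 1)]
    | v3 (_, b) => [:: (u3 b, 1)]
    | _ => [::]
    end else [::]
  end.

Definition lvl4 (j : row4) : nat :=
  match j with v1 _ => 1 | v2 _ => 2 | v3 _ => 3 | _ => 0 end.

Lemma coef4_nilp x : (3 < x)%N -> forall m, iter x (free_arrow coef4 None) m = 0.
Proof.
move=> x4; apply: (@graded_nilp _ _ _ _ _ _ lvl4) => [j|j u].
  by apply: leq_ltn_trans x4; case: j => [[[[?|?]|?]|?]|?].
case: j => [[[[?|[[][]]]|?]|?]|?] //=; rewrite !inE;
  by [move=> /eqP -> | case/orP=> /eqP ->].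
Qed.

Lemma coef4_tgt a j : coef4 a j != [::] -> vert4 j = @target (Qp p) a.
Proof.
case: a => [i|] /=; last by case: j.
case: (eqVneq i i0) => [->|_] //; case: j => // j _; apply: val_inj.
by rewrite /= /bump add1n i0E.
Qed.

Lemma coef4_src a j u : u \in coef4 a j -> vert4 u.1 = @source (Qp p) a.
Proof.
case: a => [i|] /=.
  case: (eqVneq i i0) => [->|_] //; case: j => [[[[[]|[[] []]]|[[] []]]|[[] []]]|?] //=;
  by rewrite inE => /eqP ->.
case: j => [[[[?|[[][]]]|?]|?]|?] //=; rewrite !inE;
  by [move=> /eqP -> | case/orP=> /eqP ->].
Qed.

Section Elements.
Variable N : rmodType F.
Local Notation P := (N * N)%type.

Definition elt4 (v : P) (e1 e2 e3 : P * P) : {ffun row4 -> N} :=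
  [ffun j => match j with
    | v0 b => pick v b
    | v1 l => pick (pick e1 l.1) l.2
    | v2 l => pick (pick e2 l.1) l.2
    | v3 l => pick (pick e3 l.1) l.2
    | _ => 0 end].

Definition sub4 (n : N) (q1 q2 q3 : P) : {ffun row4 -> N} :=
  [ffun j => match j with
    | u0 => n
    | u1 b => pick q1 b
    | u2 b => pick q2 b
    | u3 b => pick q3 b
    | _ => 0 end].

Lemma elt4_inj v e1 e2 e3 v' e1' e2' e3' :
  elt4 v e1 e2 e3 = elt4 v' e1' e2' e3' -> [/\ v = v', e1 = e1', e2 = e2' & e3 = e3'].
Proof.
move/ffunP=> H.
split; first by apply: pickE => b; have := H (v0 b); rewrite !ffunE.
- by apply: pickE => c; apply: pickE => b; have := H (v1 (c, b)); rewrite !ffunE.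
- by apply: pickE => c; apply: pickE => b; have := H (v2 (c, b)); rewrite !ffunE.
by apply: pickE => c; apply: pickE => b; have := H (v3 (c, b)); rewrite !ffunE.
Qed.

Lemma vert_elt4 m : exists v e1 e2 e3, vertex_op vert4 ord_max m = elt4 v e1 e2 e3.
Proof.
exists (m (v0 false), m (v0 true)).
exists ((m (v1 (false, false)), m (v1 (false, true))), (m (v1 (true, false)), m (v1 (true, true)))).
exists ((m (v2 (false, false)), m (v2 (false, true))), (m (v2 (true, false)), m (v2 (true, true)))).
exists ((m (v3 (false, false)), m (v3 (false, true))), (m (v3 (true, false)), m (v3 (true, true)))).
apply/ffunP => j; rewrite !ffunE.
case: j => [[[[[]|[[] []]]|[[] []]]|[[] []]]|j] /=; rewrite ?eqxx //.
by rewrite -val_eqE /= ltn_eqF // -i0E.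
Qed.

Lemma elt4_vert v e1 e2 e3 : vertex_op vert4 ord_max (elt4 v e1 e2 e3) = elt4 v e1 e2 e3.
Proof. by apply/ffunP => j; rewrite !ffunE; case: j => j /=; rewrite ?eqxx ?if_same. Qed.

Lemma vert_sub4 m : exists n q1 q2 q3,
  vertex_op vert4 (widen_ord (leqnSn _) i0) m = sub4 n q1 q2 q3.
Proof.
exists (m u0), (m (u1 false), m (u1 true)), (m (u2 false), m (u2 true)), (m (u3 false), m (u3 true)).
apply/ffunP => j; rewrite !ffunE.
case: j => [j|[[[[]|[]]|[]]|[]]] /=; rewrite ?eqxx //.
by rewrite -val_eqE /= gtn_eqF // -i0E.
Qed.

Lemma sub4_vert n q1 q2 q3 :
  vertex_op vert4 (widen_ord (leqnSn _) i0) (sub4 n q1 q2 q3) = sub4 n q1 q2 q3.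
Proof. by apply/ffunP => j; rewrite !ffunE; case: j => j /=; rewrite ?eqxx ?if_same. Qed.

Definition graph (v : P) : P * P := (v, pencil X v).

Lemma loop_elt4 v e1 e2 e3 :
  arrow_op coef4 None (elt4 v e1 e2 e3) = elt4 0 (graph v) e1 e2.
Proof.
apply/ffunP => j; rewrite !ffunE.
case: j => [[[[[]|[[] []]]|[[] []]]|[[] []]]|j] /=;
  by rewrite ?big_cons big_nil ?ffunE ?addr0 //; exact: scale1r.
Qed.

Lemma arrow_sub4 n q1 q2 q3 :
  arrow_op coef4 (Some i0) (sub4 n q1 q2 q3) = elt4 (n, 0) (q1, 0) (0, q2) (q3, q3).
Proof.
apply/ffunP => j; rewrite !ffunE /= eqxx.
case: j => [[[[[]|[[] []]]|[[] []]]|[[] []]]|j] /=;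
  by rewrite ?big_cons big_nil ?ffunE ?addr0 //; exact: scale1r.
Qed.

Lemma elt4_0 : elt4 0 0 0 0 = 0.
Proof. by apply/ffunP => j; rewrite !ffunE; case: j => [[[[[]|[[] []]]|[[] []]]|[[] []]]|j]. Qed.

Lemma elt4_D e f : elt4 0 0 0 (e + f) = elt4 0 0 0 e + elt4 0 0 0 f.
Proof.
apply/ffunP => j; rewrite !ffunE.
by case: j => [[[[[]|[[] []]]|[[] []]]|[[] []]]|j] /=; rewrite ?addr0.
Qed.

End Elements.

Definition wit4 (N : rmodType F) (n : N) : {ffun row4 -> N} := elt4 0 0 0 (graph (n, 0)).

Lemma wit4D (N : rmodType F) : {morph @wit4 N : m n / m + n}.
Proof.
move=> m n; apply/ffunP => j; rewrite !ffunE.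
case: j => [[[[[]|[[] []]]|[[] []]]|[[] []]]|j] /=;
  by rewrite ?addr0 ?scaler0 ?addr0 ?scalerDr.
Qed.

Lemma wit4Z (N : rmodType F) (c : K) (n : N) :
  wit4 ((c%:A : F^c) *: n) = [ffun j => (c%:A : F^c) *: wit4 n j].
Proof.
apply/ffunP => j; rewrite !ffunE.
case: j => [[[[[]|[[] []]]|[[] []]]|[[] []]]|j] /=; rewrite ?scaler0 ?addr0 //.
rewrite !scalerA; congr (_ *: _).
by rewrite -[LHS]/(c%:A * X true) -[RHS]/(X true * c%:A) -scalerAl mul1r -scalerAr mulr1.
Qed.

Lemma graph0 (N : rmodType F) : graph (0 : N * N) = 0.
Proof. by rewrite /graph /pencil /= !scaler0 addr0. Qed.

(** A map of systems preserves the kernel of the loop, a copy of a sum of two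
    copies of [N * N], and in it the images under powers of the loop of
    whatever the next power kills: here the graph of the pencil, the line
    [N * 0], the two summands and the diagonal. *)
Lemma rigid4 (N N' : rmodType F) (g : {ffun row4 -> N} -> {ffun row4 -> N'}) :
  coords_hom vert4 coef4 g -> forall n, exists n', g (wit4 n) = wit4 n' /\
  forall b, g (wit4 ((X b : F^c) *: n)) = wit4 ((X b : F^c) *: n').
Proof.
case=> gD _ gV gA.
have g0 : g 0 = 0 by apply: (addrI (g 0)); rewrite -gD !addr0.
have gelt v e1 e2 e3 : exists v' e1' e2' e3',
    g (elt4 v e1 e2 e3) = elt4 v' e1' e2' e3'.
  by rewrite -elt4_vert gV; apply: vert_elt4.
have gsub n q1 q2 q3 : exists n' q1' q2' q3', g (sub4 n q1 q2 q3) = sub4 n' q1' q2' q3'.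
  by rewrite -sub4_vert gV; apply: vert_sub4.
have /choice[h hE] e : exists f, g (elt4 0 0 0 e) = elt4 0 0 0 f.
  have [v [a [b [c E]]]] := gelt 0 0 0 e; exists c.
  have := gA None (elt4 0 0 0 e).
  rewrite E !loop_elt4 graph0 elt4_0 g0 -elt4_0 => /elt4_inj[_ gr a0 b0].
  by case: gr => vz _; rewrite -a0 -b0 -vz.
have loop2 (L : rmodType F) (v : L * L) e1 e2 e3 :
    arrow_op coef4 None (arrow_op coef4 None (elt4 v e1 e2 e3)) =
    elt4 0 0 (graph v) e1.
  by rewrite !loop_elt4 graph0.
have loop3 (L : rmodType F) (v : L * L) e1 e2 e3 :
    arrow_op coef4 None (arrow_op coef4 None (arrow_op coef4 None (elt4 v e1 e2 e3))) =
    elt4 0 0 0 (graph v).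
  by rewrite !loop_elt4 graph0.
have hD : {morph h : e f / e + f}.
  move=> e f; have := gD (elt4 0 0 0 e) (elt4 0 0 0 f).
  by rewrite -elt4_D !hE -elt4_D => /elt4_inj[].
have hgraph v : exists v', h (graph v) = graph v'.
  have [v' [a [b [c E]]]] := gelt v 0 0 0; exists v'.
  have := hE (graph v); rewrite -(loop3 _ v 0 0 0) !gA E loop3.
  by case/elt4_inj.
have hline n : exists n', h (graph (n, 0)) = graph (n', 0).
  have [n' [q1 [q2 [q3 E]]]] := gsub n 0 0 0; exists n'.
  have := hE (graph (n, 0)); rewrite -(loop3 _ (n, 0) (0, 0) (0, 0) (0, 0)).
  by rewrite -arrow_sub4 !gA E arrow_sub4 loop3 => /elt4_inj[].
(* Three steps of the loop kill this part of the lower space, so two steps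
   send it to the kernel of the loop. *)
have h1 q : exists q', h (q, 0) = (q', 0).
  have [n' [q1 [q2 [q3 E]]]] := gsub 0 q 0 0; exists q1.
  have := loop2 _ (0, 0) (q, 0) (0, 0) (0, 0); rewrite graph0 -arrow_sub4.
  move/(congr1 g); rewrite hE !gA E arrow_sub4 loop2.
  by case/elt4_inj.
have h2 q : exists q', h (0, q) = (0, q').
  have [n' [q1 [q2 [q3 E]]]] := gsub 0 0 q 0; exists q2.
  have := loop_elt4 (0, 0) (0, 0) (0, q) (0, 0); rewrite graph0 -arrow_sub4.
  move/(congr1 g); rewrite hE !gA E arrow_sub4 loop_elt4.
  by case/elt4_inj.
have h3 q : exists q', h (q, q) = (q', q').
  have [n' [q1 [q2 [q3 E]]]] := gsub 0 0 0 q; exists q3.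
  have := congr1 g (arrow_sub4 0 0 0 q); rewrite hE !gA E arrow_sub4.
  by case/elt4_inj.
have [k kE] := choice h1.
have hk q r : h (q, r) = (k q, k r).
  have e s t : h (s, t) = h (s, 0) + h (0, t).
    by rewrite -hD; congr h; congr pair; rewrite ?addr0 ?add0r.
  have k2 s : h (0, s) = (0, k s).
    have [s2 E2] := h2 s; have [s3] := h3 s; rewrite e kE E2 => -[].
    by rewrite addr0 add0r => -> ->.
  by rewrite e kE k2; congr pair; rewrite ?addr0 ?add0r.
have kD : {morph k : m n / m + n}.
  move=> m n; have := hD (m, 0) (n, 0); rewrite !kE.
  have -> : (m, 0) + (n, 0) = (m + n, 0) :> (N * N) * (N * N) by congr pair; rewrite addr0.
  by rewrite kE => -[].
have kP v : k (pencil X v) = pencil X (k v).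
  by have [v'] := hgraph v; rewrite hk => -[-> ->].
have kL n : exists n', k (n, 0) = (n', 0).
  by have [n'] := hline n; rewrite hk => -[-> _]; exists n'.
move=> n; have [n' [en' eb]] := pencil_rigid kD kP kL n; exists n'.
have wE m m' : k (m, 0) = (m', 0) -> g (wit4 m) = wit4 m'.
  by move=> e; rewrite hE hk kP e.
by split=> [|b]; apply: wE.
Qed.

End LoopFour.

Theorem wild_loop_four (K : fieldType) (p x : nat) (hx : (0 < x)%N) :
  (1 < p)%N -> (3 < x)%N -> wild_rep_type (KQp_quot K p hx).
Proof.
move=> p1 x4; have p2 : p.-2.+1 = p.-1 by case: p p1 => [|[|p']].
have pp : (p.-2 < p.-1)%N by rewrite -p2.
pose i0 := Ordinal pp; have i0E : i0.+1 = p.-1 := p2.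
apply: (@wild_of_witness K p x hx row4 (vert4 i0) (coef4 (letter K) i0)
  (@wit4 _ _ (letter K)) (inl (inr (false, false)))).
- exact: coef4_tgt.
- exact: coef4_src.
- exact: coef4_nilp.
- by move=> N n; rewrite ffunE.
- exact: wit4D.
- exact: wit4Z.
by move=> N N' g; apply: rigid4.
Qed.

(** * The case of a loop of order three and two arrows before it *)

Section LoopThree.
Variables (K : fieldType) (F : algType K) (X : bool -> F).
Variables (p : nat) (i0 i1 : 'I_p.-1) (i0E : i0.+1 = p.-1) (i1E : i1.+1 = i0).

(** The rows at the last vertex, of degree 0 to 2, and at the two vertices
    before. *)
Definition row3 : finType :=
  (bool * bool + (option bool * bool) + (option bool * bool) +
   (bool + (bool * bool) + (bool * bool) + (unit + bool + bool)))%type.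
Local Notation v0 l := (inl (inl (inl l))).
Local Notation v1 l := (inl (inl (inr l))).
Local Notation v2 l := (inl (inr l)).
Local Notation w0 b := (inr (inl (inl (inl b)))).
Local Notation w1 l := (inr (inl (inl (inr l)))).
Local Notation w2 l := (inr (inl (inr l))).
Local Notation u0 := (inr (inr (inl (inl tt)))).
Local Notation u1 b := (inr (inr (inl (inr b)))).
Local Notation u2 b := (inr (inr (inr b))).

Definition vert3 (j : row3) : 'I_p.-1.+1 :=
  match j with
  | inl _ => ord_max
  | inr (inl _) => widen_ord (leqnSn _) i0
  | inr (inr _) => widen_ord (leqnSn _) i1
  end.

(** A vector [(u, v)] of degree zero enters degree one as [(u, u + v, u + pencil v)].
    In degree zero the two lower spaces are the pairs [(u, 0)] and those with [u]
    in the line [N * 0]; in degrees one and two they are a flag in the first two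
    summands and a flag in the last two. *)
Definition coef3 (a : option 'I_p.-1) (j : row3) : seq (row3 * F) :=
  match a with
  | None => match j with
    | v1 (Some false, b) => [:: (v0 (false, b), 1)]
    | v1 (Some true, b) => [:: (v0 (false, b), 1); (v0 (true, b), 1)]
    | v1 (None, false) =>
        [:: (v0 (false, false), 1); (v0 (true, false), X true); (v0 (true, true), X false)]
    | v1 (None, true) => [:: (v0 (false, true), 1); (v0 (true, false), 1)]
    | v2 l => [:: (v1 l, 1)]
    | _ => [::]
    end
  | Some i => if i == i0 then match j with
    | v0 (false, b) => [:: (w0 b, 1)]
    | v1 (Some c, b) => [:: (w1 (c, b), 1)]
    | v2 (Some true, b) => [:: (w2 (false, b), 1)]
    | v2 (None, b) => [:: (w2 (true, b), 1)]
    | _ => [::]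
    end else if i == i1 then match j with
    | w0 false => [:: (u0, 1)]
    | w1 (false, b) => [:: (u1 b, 1)]
    | w2 (true, b) => [:: (u2 b, 1)]
    | _ => [::]
    end else [::]
  end.

Definition lvl3 (j : row3) : nat :=
  match j with v1 _ => 1 | v2 _ => 2 | _ => 0 end.

Lemma coef3_nilp x : (2 < x)%N -> forall m, iter x (free_arrow coef3 None) m = 0.
Proof.
move=> x3; apply: (@graded_nilp _ _ _ _ _ _ lvl3) => [j|j u].
  by apply: leq_ltn_trans x3; case: j => [[[?|?]|?]|?].
case: j => [[[?|[[[]|] []]]|?]|?] //=; rewrite !inE;
  by do ?[move=> /eqP -> | case/orP | case/orP=> [/eqP ->|]].
Qed.

Lemma coef3_tgt a j : coef3 a j != [::] -> vert3 j = @target (Qp p) a.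
Proof.
case: a => [i|] /=; last by case: j.
case: (eqVneq i i0) => [->|_].
  by case: j => // j _; apply: val_inj; rewrite /= /bump add1n i0E.
case: (eqVneq i i1) => [->|_] //; case: j => [[[?|?]|?]|[j|?]] // _.
by apply: val_inj; rewrite /= /bump add1n i1E.
Qed.

Lemma coef3_src a j u : u \in coef3 a j -> vert3 u.1 = @source (Qp p) a.
Proof.
case: a => [i|] /=.
  case: (eqVneq i i0) => [->|_].
    case: j => [[[[[] []]|[[[]|] []]]|[[[]|] []]]|?] //=;
    by rewrite inE => /eqP ->.
  case: (eqVneq i i1) => [->|_] //.
  case: j => [[[?|?]|?]|[[[[]|[[] []]]|[[] []]]|?]] //=;
  by rewrite inE => /eqP ->.
case: j => [[[?|[[[]|] []]]|?]|?] //=; rewrite !inE;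
  by do ?[move=> /eqP -> | case/orP | case/orP=> [/eqP ->|]].
Qed.

Definition pick3 (T : Type) (t : T * T * T) (o : option bool) : T :=
  if o is Some b then pick t.1 b else t.2.

Lemma pick3E (T : Type) (t t' : T * T * T) : (forall o, pick3 t o = pick3 t' o) -> t = t'.
Proof.
case: t t' => [t c] [t' c'] e; congr pair; last exact: (e None).
by apply: pickE => b; exact: (e (Some b)).
Qed.

Section Elements.
Variable N : rmodType F.
Local Notation P := (N * N)%type.

Definition elt3 (v : P * P) (e1 e2 : P * P * P) : {ffun row3 -> N} :=
  [ffun j => match j with
    | v0 l => pick (pick v l.1) l.2
    | v1 l => pick (pick3 e1 l.1) l.2
    | v2 l => pick (pick3 e2 l.1) l.2
    | _ => 0 end].

Definition mid3 (q : P) (r1 r2 : P * P) : {ffun row3 -> N} :=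
  [ffun j => match j with
    | w0 b => pick q b
    | w1 l => pick (pick r1 l.1) l.2
    | w2 l => pick (pick r2 l.1) l.2
    | _ => 0 end].

Definition sub3 (n : N) (s t : P) : {ffun row3 -> N} :=
  [ffun j => match j with
    | u0 => n
    | u1 b => pick s b
    | u2 b => pick t b
    | _ => 0 end].

Lemma elt3_inj v e1 e2 v' e1' e2' :
  elt3 v e1 e2 = elt3 v' e1' e2' -> [/\ v = v', e1 = e1' & e2 = e2'].
Proof.
move/ffunP=> H; split.
- by apply: pickE => c; apply: pickE => b; have := H (v0 (c, b)); rewrite !ffunE.
- by apply: pick3E => c; apply: pickE => b; have := H (v1 (c, b)); rewrite !ffunE.
by apply: pick3E => c; apply: pickE => b; have := H (v2 (c, b)); rewrite !ffunE.
Qed.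

Let neq_last (i : 'I_p.-1) : (widen_ord (leqnSn _) i == ord_max) = false.
Proof. by rewrite -val_eqE /= ltn_eqF. Qed.

Let neq_i1 : (i1 == i0) = false.
Proof. by rewrite -val_eqE /= -i1E ltn_eqF. Qed.

Let neq_w : (widen_ord (leqnSn _) i1 == widen_ord (leqnSn _) i0) = false.
Proof. by rewrite -val_eqE /= -i1E ltn_eqF. Qed.

Lemma vert_elt3 m : exists v e1 e2, vertex_op vert3 ord_max m = elt3 v e1 e2.
Proof.
exists ((m (v0 (false, false)), m (v0 (false, true))), (m (v0 (true, false)), m (v0 (true, true)))).
pose tri (f : option bool * bool -> N) : P * P * P :=
  ((f (Some false, false), f (Some false, true)), (f (Some true, false), f (Some true, true)),
   (f (None, false), f (None, true))).
exists (tri (fun l => m (v1 l))), (tri (fun l => m (v2 l))).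
apply/ffunP => j; rewrite !ffunE.
by case: j => [[[[[] []]|[[[]|] []]]|[[[]|] []]]|[j|j]] /=; rewrite ?eqxx ?neq_last.
Qed.

Lemma elt3_vert v e1 e2 : vertex_op vert3 ord_max (elt3 v e1 e2) = elt3 v e1 e2.
Proof.
by apply/ffunP => j; rewrite !ffunE; case: j => [j|[j|j]] /=; rewrite ?eqxx ?if_same.
Qed.

Lemma vert_mid3 m : exists q r1 r2,
  vertex_op vert3 (widen_ord (leqnSn _) i0) m = mid3 q r1 r2.
Proof.
exists (m (w0 false), m (w0 true)).
exists ((m (w1 (false, false)), m (w1 (false, true))), (m (w1 (true, false)), m (w1 (true, true)))).
exists ((m (w2 (false, false)), m (w2 (false, true))), (m (w2 (true, false)), m (w2 (true, true)))).
apply/ffunP => j; rewrite !ffunE.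
case: j => [j|[[[[]|[[] []]]|[[] []]]|j]] /=; rewrite ?eqxx ?neq_w //.
by rewrite eq_sym neq_last.
Qed.

Lemma mid3_vert q r1 r2 :
  vertex_op vert3 (widen_ord (leqnSn _) i0) (mid3 q r1 r2) = mid3 q r1 r2.
Proof.
by apply/ffunP => j; rewrite !ffunE; case: j => [j|[j|j]] /=; rewrite ?eqxx ?if_same.
Qed.

Lemma vert_sub3 m : exists n s t,
  vertex_op vert3 (widen_ord (leqnSn _) i1) m = sub3 n s t.
Proof.
exists (m u0), (m (u1 false), m (u1 true)), (m (u2 false), m (u2 true)).
apply/ffunP => j; rewrite !ffunE.
case: j => [j|[j|[[[]|[]]|[]]]] /=; rewrite ?eqxx ?[_ == widen_ord _ i1]eq_sym ?neq_w //.
by rewrite neq_last.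
Qed.

Lemma sub3_vert n s t :
  vertex_op vert3 (widen_ord (leqnSn _) i1) (sub3 n s t) = sub3 n s t.
Proof.
by apply/ffunP => j; rewrite !ffunE; case: j => [j|[j|j]] /=; rewrite ?eqxx ?if_same.
Qed.

Definition embed (v : P * P) : P * P * P :=
  (v.1, v.1 + v.2, v.1 + pencil X v.2).

Lemma loop_elt3 v e1 e2 : arrow_op coef3 None (elt3 v e1 e2) = elt3 0 (embed v) e1.
Proof.
apply/ffunP => j; rewrite !ffunE.
case: j => [[[[[] []]|[[[]|] []]]|[[[]|] []]]|j] /=;
  by rewrite ?big_cons big_nil ?ffunE /= ?addr0 ?[(1 : F^c) *: _]scale1r.
Qed.

Lemma arrow_mid3 q r1 r2 : arrow_op coef3 (Some i0) (mid3 q r1 r2) =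
  elt3 (q, 0) (r1.1, r1.2, 0) (0, r2.1, r2.2).
Proof.
apply/ffunP => j; rewrite !ffunE /= eqxx.
case: j => [[[[[] []]|[[[]|] []]]|[[[]|] []]]|j] /=;
  by rewrite ?big_cons big_nil ?ffunE ?addr0 //; exact: scale1r.
Qed.

Lemma arrow_sub3 n s t : arrow_op coef3 (Some i1) (sub3 n s t) =
  mid3 (n, 0) (s, 0) (0, t).
Proof.
apply/ffunP => j; rewrite !ffunE /= neq_i1 eqxx.
case: j => [j|[[[[]|[[] []]]|[[] []]]|j]] /=;
  by rewrite ?big_cons big_nil ?ffunE ?addr0 //; exact: scale1r.
Qed.

Lemma elt3_0 : elt3 0 0 0 = 0.
Proof. by apply/ffunP => j; rewrite !ffunE; case: j => [[[[[] []]|[[[]|] []]]|[[[]|] []]]|j]. Qed.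

Lemma elt3_D e f : elt3 0 0 (e + f) = elt3 0 0 e + elt3 0 0 f.
Proof.
apply/ffunP => j; rewrite !ffunE.
by case: j => [[[[[] []]|[[[]|] []]]|[[[]|] []]]|j] /=; rewrite ?addr0.
Qed.

Definition wit3 (n : N) : {ffun row3 -> N} := elt3 0 0 ((n, 0), (n, 0), (n, 0)).

Lemma wit3D : {morph wit3 : m n / m + n}.
Proof.
move=> m n; apply/ffunP => j; rewrite !ffunE.
by case: j => [[[[[] []]|[[[]|] []]]|[[[]|] []]]|j] /=; rewrite ?addr0.
Qed.

Lemma wit3Z (c : K) (n : N) :
  wit3 ((c%:A : F^c) *: n) = [ffun j => (c%:A : F^c) *: wit3 n j].
Proof.
apply/ffunP => j; rewrite !ffunE.
by case: j => [[[[[] []]|[[[]|] []]]|[[[]|] []]]|j] /=; rewrite ?scaler0.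
Qed.

Lemma embed0 (q : P) : embed (q, 0) = (q, q, q).
Proof.
rewrite /embed /= addr0 (_ : pencil X 0 = 0) ?addr0 //.
by rewrite /pencil /= !scaler0 addr0.
Qed.

End Elements.

(** A map of systems acts on the kernel of the loop, three copies of [N * N].
    It preserves the flags of the first summand in the first two and of the
    last summand in the last two, hence each summand; it preserves the
    diagonal, so that it is three times the same map; finally it preserves the
    image of the square of the loop, which contains the graph of the pencil
    between the last two summands. *)
Lemma rigid3 (N N' : rmodType F) (g : {ffun row3 -> N} -> {ffun row3 -> N'}) :
  coords_hom vert3 coef3 g -> forall n, exists n', g (wit3 n) = wit3 n' /\
  forall b, g (wit3 ((X b : F^c) *: n)) = wit3 ((X b : F^c) *: n').
Proof.
case=> gD _ gV gA.
have g0 : g 0 = 0 by apply: (addrI (g 0)); rewrite -gD !addr0.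
have gelt v e1 e2 : exists v' e1' e2', g (elt3 v e1 e2) = elt3 v' e1' e2'.
  by rewrite -elt3_vert gV; apply: vert_elt3.
have gmid q r1 r2 : exists q' r1' r2', g (mid3 q r1 r2) = mid3 q' r1' r2'.
  by rewrite -mid3_vert gV; apply: vert_mid3.
have gsub n s t : exists n' s' t', g (sub3 n s t) = sub3 n' s' t'.
  by rewrite -sub3_vert gV; apply: vert_sub3.
have emb00 (L : rmodType F) : embed (0 : (L * L) * (L * L)) = 0 by exact: embed0.
have /choice[h hE] e : exists f, g (elt3 0 0 e) = elt3 0 0 f.
  have [v [a [b E]]] := gelt 0 0 e; exists b.
  have := gA None (elt3 0 0 e).
  rewrite E !loop_elt3 emb00 elt3_0 g0 -elt3_0 => /elt3_inj[_ ev a0].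
  case: v E ev => va vb E ev; have va0 : 0 = va := congr1 (fun t => t.1.1) ev.
  have : 0 = va + vb := congr1 (fun t => t.1.2) ev.
  by rewrite -va0 add0r -a0 => <-.
have loop2 (L : rmodType F) (v : (L * L) * (L * L)) e1 e2 :
    arrow_op coef3 None (arrow_op coef3 None (elt3 v e1 e2)) = elt3 0 0 (embed v).
  by rewrite !loop_elt3 emb00.
have hD : {morph h : e f / e + f}.
  move=> e f; have := gD (elt3 0 0 e) (elt3 0 0 f).
  by rewrite -elt3_D !hE -elt3_D => /elt3_inj[].
have hemb v : exists v', h (embed v) = embed v'.
  have [v' [a [b E]]] := gelt v 0 0; exists v'.
  have := hE (embed v); rewrite -(loop2 _ v 0 0) !gA E loop2.
  by case/elt3_inj.
have hdiag q : exists q', h (q, q, q) = (q', q', q').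
  have [q' [r1 [r2 E]]] := gmid q 0 0; exists q'.
  have := loop2 _ (q, 0) (0, 0, 0) (0, 0, 0); rewrite embed0 -(arrow_mid3 q 0 0).
  by move/(congr1 g); rewrite hE !gA E arrow_mid3 loop2 embed0 => /elt3_inj[].
have hline n : exists n', h ((n, 0), (n, 0), (n, 0)) = ((n', 0), (n', 0), (n', 0)).
  have [n' [s [t E]]] := gsub n 0 0; exists n'.
  have := loop2 _ ((n, 0), 0) (0, 0, 0) (0, 0, 0).
  rewrite embed0 -(arrow_mid3 (n, 0) (0, 0) (0, 0)) -arrow_sub3.
  by move/(congr1 g); rewrite hE !gA E arrow_sub3 arrow_mid3 loop2 embed0 => /elt3_inj[].
have hA1 r : exists r', h (r.1, r.2, 0) = (r'.1, r'.2, 0).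
  have [q [r1 [r2 E]]] := gmid 0 r 0; exists r1.
  have := loop_elt3 (0, 0) (r.1, r.2, 0) (0, 0, 0); rewrite emb00 -(arrow_mid3 0 r 0).
  by move/(congr1 g); rewrite hE !gA E arrow_mid3 loop_elt3 => /elt3_inj[].
have ha1 s : exists s', h (s, 0, 0) = (s', 0, 0).
  have [n [s' [t E]]] := gsub 0 s 0; exists s'.
  have := loop_elt3 (0, 0) (s, 0, 0) (0, 0, 0).
  rewrite emb00 -(arrow_mid3 (0, 0) (s, 0) (0, 0)) -arrow_sub3.
  by move/(congr1 g); rewrite hE !gA E arrow_sub3 arrow_mid3 loop_elt3 => /elt3_inj[].
have hA2 r : exists r', h (0, r.1, r.2) = (0, r'.1, r'.2).
  have [q [r1 [r2 E]]] := gmid 0 0 r; exists r2.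
  have := congr1 g (arrow_mid3 0 0 r).
  by rewrite [in RHS]hE !gA E arrow_mid3 => /elt3_inj[].
have ha2 t : exists t', h (0, 0, t) = (0, 0, t').
  have [n [s [t' E]]] := gsub 0 0 t; exists t'.
  have := congr1 g (arrow_mid3 (0, 0) (0, 0) (0, t)); rewrite -arrow_sub3.
  by rewrite [in RHS]hE !gA E arrow_sub3 arrow_mid3 => /elt3_inj[].
have [k kE] := choice ha1.
have hm q : exists q', h (0, q, 0) = (0, q', 0).
  have [r1 /= E1] := hA1 (0, q); have [r2 /= E2] := hA2 (q, 0).
  by exists r1.2; move: E2; rewrite E1 => -[<- _ _].
have hsplit a b c : h (a, b, c) = h (a, 0, 0) + h (0, b, 0) + h (0, 0, c).
  by rewrite -!hD; congr h; congr (_, _, _); rewrite /= ?addr0 ?add0r.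
have kb q : h (0, q, 0) = (0, k q, 0) /\ h (0, 0, q) = (0, 0, k q).
  have [b Eb] := hm q; have [c Ec] := ha2 q; have [d] := hdiag q.
  rewrite hsplit kE Eb Ec => -[]; rewrite /= !addr0 !add0r => -> -> ->.
  by [].
have hk a b c : h (a, b, c) = (k a, k b, k c).
  rewrite hsplit kE (kb b).1 (kb c).2.
  by congr (_, _, _); rewrite /= ?addr0 ?add0r.
have kD : {morph k : m n / m + n}.
  move=> m n; have := hD (m, 0, 0) (n, 0, 0); rewrite !kE.
  have -> : (m, 0, 0) + (n, 0, 0) = (m + n, 0, 0) :> (N * N) * (N * N) * (N * N).
    by congr (_, _, _); rewrite /= addr0.
  by rewrite kE => -[].
have k0 : k 0 = 0 by apply: (addrI (k 0)); rewrite -kD !addr0.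
have kP v : k (pencil X v) = pencil X (k v).
  have [v'] := hemb (0, v); rewrite hk /embed /= !add0r k0 => -[<-].
  by rewrite !add0r => -> ->.
have kL n : exists n', k (n, 0) = (n', 0).
  by have [n'] := hline n; rewrite hk => -[-> _ _]; exists n'.
move=> n; have [n' [en' eb]] := pencil_rigid kD kP kL n; exists n'.
have wE m m' : k (m, 0) = (m', 0) -> g (wit3 m) = wit3 m'.
  by move=> e; rewrite hE hk e.
by split=> [|b]; apply: wE.
Qed.

End LoopThree.

Theorem wild_loop_three (K : fieldType) (p x : nat) (hx : (0 < x)%N) :
  (2 < p)%N -> (2 < x)%N -> wild_rep_type (KQp_quot K p hx).
Proof.
move=> p1 x3; have p2 : p.-2.+1 = p.-1 by case: p p1 => [|[|p']].
have p3 : p.-2.-1.+1 = p.-2 by case: p p1 {p2} => [|[|[|p']]].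
have pp : (p.-2 < p.-1)%N by rewrite -p2.
have pq : (p.-2.-1 < p.-1)%N by rewrite -p2 ltnS leq_pred.
pose i0 := Ordinal pp; have i0E : i0.+1 = p.-1 := p2.
pose i1 := Ordinal pq; have i1E : i1.+1 = i0 := p3.
apply: (@wild_of_witness K p x hx row3 (vert3 i0 i1) (coef3 (letter K) i0 i1)
  (@wit3 _ _) (inl (inr (None, false)))).
- exact: coef3_tgt.
- exact: coef3_src.
- exact: coef3_nilp.
- by move=> N n; rewrite ffunE.
- exact: wit3D.
- exact: wit3Z.
by move=> N N' g; apply: rigid3.
Qed.

(** * Finite or wild *)

Theorem proposition8p1 (R : realType) (p x : nat) (hp : (1 < p)%N)
    (hx : (0 < x)%N) :
  wild_rep_type (KQp_quot R[i]%C p hx) <->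
  ~ finite_rep_type (KQp_quot R[i]%C p hx).
Proof.
split=> [|nfin].
  apply: wild_not_finite; last exact: KQp_finite_dim.
  by move=> m n /eqP; rewrite Num.Theory.eqr_nat => /eqP.
case: (ltnP 3 x) => [|x3]; first exact: wild_loop_four.
have x3' : ~~ (x <= 2)%N.
  by apply/negP => x2; apply: nfin; apply: finite_case; rewrite x2.
have xE : x = 3 by apply/eqP; rewrite eqn_leq x3 ltnNge x3'.
apply: wild_loop_three; last by rewrite xE.
rewrite ltn_neqAle hp andbT eq_sym; apply/eqP => p2; apply: nfin.
by apply: finite_case; rewrite p2 xE orbT.
Qed.
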